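(* Consider the uplink block-fading system with $M$ base station antennas and $K$ single-antenna users described in the context, in which $\tau_p$ of the $\tau_c$ samples of each coherence block are used for pilots and the remaining ones for data. In a data sample user $i$ transmits $x_i=\sqrt{\rho_i}\,s_i$, the base station receives $\mathbf{y}=\sum_{i=1}^K\mathbf{h}_ix_i+\mathbf{n}+\mathbf{e}$ with hardware distortion $\mathbf{e}$, and forms $\hat{s}_k=\mathbf{v}_k^H\mathbf{y}$ with a combining vector $\mathbf{v}_k$ that is a function of the received pilot signal. Then, for every $k\in\{1,\dots,K\}$, the spectral efficiency $$\mathrm{SE}_k=\Big(1-\frac{\tau_p}{\tau_c}\Big)\log_2\left(1+\mathrm{SINR}_k\right),\qquad \mathrm{SINR}_k=\frac{\left|\mathbb{E}\{\hat{s}_ks_k^*\}\right|^2}{\mathrm{Var}\left(\hat{s}_k-\mathbb{E}\{\hat{s}_ks_k^*\}s_k\right)},$$ is achievable for user $k$, i.e. it is a lower bound on the ergodic capacity of user $k$ (in bits per channel use). Moreover, when the hardware distortion follows the additive model $$\mathbf{e}=\mathbf{D}_{\epsilon}\Big(\sum_{i=1}^{K}\mathbb{E}\{|x_i|^2\}\,\mathrm{diag}\big(|[\mathbf{h}_i]_1|^2,\dots,|[\mathbf{h}_i]_M|^2\big)\Big)^{1/2}\mathbf{r},\qquad \mathbf{r}\sim\mathcal{CN}(\mathbf{0},\mathbf{I}_M),$$ the effective SINR equals $$\mathrm{SINR}_k=\frac{\left|\mathbb{E}\{\mathbf{v}_k^H\mathbf{h}_k\}\right|^2\rho_k}{\s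um_{i=1}^{K}\mathbb{E}\{|\mathbf{v}_k^H\mathbf{h}_i|^2\}\rho_i-\left|\mathbb{E}\{\mathbf{v}_k^H\mathbf{h}_k\}\right|^2\rho_k+\mathbb{E}\{|\mathbf{v}_k^H\mathbf{n}|^2\}+\mathbb{E}\{|\mathbf{v}_k^H\mathbf{e}|^2\}}.$$
   Context: Setting. Channels follow a block fading model: each coherence block consists of $\tau_c$ complex samples, during which the channels $\mathbf{h}_k\sim\mathcal{CN}(\mathbf{0},\mathbf{R}_k)$ ($k=1,\dots,K$, $\mathbf{R}_k\in\mathbb{C}^{M\times M}$ Hermitian positive semidefinite) are constant; realizations in different blocks are independent and identically distributed. In each block $\tau_p<\tau_c$ samples are used to send known pilots, and $\tau_c-\tau_p$ samples carry data. In a data sample, $s_1,\dots,s_K$ are independent $\mathcal{CN}(0,1)$ data symbols (independent over samples), $\rho_i\geq 0$ is the energy per data symbol of user $i$, $\mathbf{n}\sim\mathcal{CN}(\mathbf{0},\sigma^2\mathbf{I}_M)$ with $\sigma^2>0$ is thermal noise, and $\mathbf{e}\in\mathbb{C}^M$ is the distortion caused by the receiver hardware. The statistics of the transmission are the same in every data sample and in every block, and the second moments involved are finite, with nonzero variance in the denominator of $\mathrm{SINR}_k$. Data symbols and data-phase noise are independent of the channels and of the pilot-phase noise and distortion (hence of $\mathbf{v}_k$). In the additive distortion model, $\mathbf{D}_\epsilon=\mathrm{diag}(\epsilon_1,\dots,\epsilon_M)$ with constants $\epsilon_m\ge0$, $\mathbb{E}\{|x_i|^2\}=\rho_i$ during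 data transmission, and the vector $\mathbf{r}$ of a data sample is independent of channels, data symbols, noise and the received pilot signal. Achievability. The spectral efficiency $\mathrm{SE}_k$ is achievable for user $k$ if reliable communication (vanishing error probability) at that rate, in bits per channel use (averaged over all $\tau_c$ samples of a block), is possible by coding over a growing number of coherence blocks; the ergodic capacity is the supremum of achievable rates. $\mathrm{Var}(X)=\mathbb{E}|X-\mathbb{E}X|^2$. Expectations are over all randomness (channels, noise, distortion, data). *)

(* Defs.v *)
From HB Require Import structures.
From mathcomp Require Import all_boot all_order all_algebra.
From mathcomp Require Import complex.
From mathcomp Require Import all_classical all_reals all_analysis.

Set Implicit Arguments.
Unset Strict Implicit.
Unset Printing Implicit Defensive.
Import Order.TTheory GRing.Theory Num.Theory.
Local Open Scope classical_set_scope.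
Local Open Scope ring_scope.
Local Open Scope complex_scope.
Local Open Scope sesquilinear_scope.

(* Borel structure of the complex numbers and of complex matrices; the
   latter is the product sigma-algebra of the entries. *)

Definition complex_display : measure_display.
Proof. exact: default_measure_display. Qed.

Section measurable_complex.
Variable R : realType.

HB.instance Definition _ := isPointed.Build R[i] (0 : R[i]).

Let G : set (set R[i]) :=
  preimage_set_system setT (@complex.Re R) measurable `|`
  preimage_set_system setT (@complex.Im R) measurable.

HB.instance Definition _ := @isMeasurable.Build complex_display R[i] <<s G >>
  (@sigma_algebra0 _ setT G) (@sigma_algebraC _ G)
  (@sigma_algebra_bigcup _ setT G).

End measurable_complex.

Definition matrix_display : measure_display -> measure_display.
Proof. exact. Qed.

Section measurable_matrix.
Context {d} {T : measurableType d} (m n : nat).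

Let G : set (set 'M[T]_(m, n)) :=
  \bigcup_(ij in [set: 'I_m * 'I_n])
    preimage_set_system setT (fun A : 'M[T]_(m, n) => A ij.1 ij.2) measurable.

HB.instance Definition _ :=
  @isMeasurable.Build (matrix_display d) 'M[T]_(m, n) <<s G >>
  (@sigma_algebra0 _ setT G) (@sigma_algebraC _ G)
  (@sigma_algebra_bigcup _ setT G).

End measurable_matrix.

Section laws.
Context {d} {T : measurableType d} {R : realType} (P : probability T R).

Definition same_law d1 (E1 : measurableType d1) (X Y : T -> E1) :=
  forall A, measurable A -> P (X @^-1` A) = P (Y @^-1` A).

Definition indep2 d1 d2 (E1 : measurableType d1) (E2 : measurableType d2)
    (X : T -> E1) (Y : T -> E2) :=
  forall A B, measurable A -> measurable B ->
    P (X @^-1` A `&` Y @^-1` B) = (P (X @^-1` A) * P (Y @^-1` B))%E.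

(* Mutual independence of a finite family: the product rule for subfamilies
   is the case where the other sets [A i] are [setT]. *)
Definition mutual_indep (I : finType) d1 (E1 : measurableType d1)
    (X : I -> T -> E1) :=
  forall A : I -> set E1, (forall i, measurable (A i)) ->
    P [set w | forall i, A i (X i w)] = (\prod_(i : I) P (X i @^-1` A i))%E.

Definition indep_sequence d1 (E1 : measurableType d1) (X : nat -> T -> E1) :=
  forall n, mutual_indep (fun i : 'I_n => X i).

(* Expectation of a complex random variable, and Var(X) = E|X - E X|^2 *)
Definition cexp (X : T -> R[i]) : R[i] :=
  fine ('E_P[fun w => complex.Re (X w)])%E +i*
  fine ('E_P[fun w => complex.Im (X w)])%E.

Definition moment2 (X : T -> R[i]) : \bar R :=
  ('E_P[fun w => (Normc.normc (X w) ^+ 2)%R])%E.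

Definition cvar (X : T -> R[i]) : R := fine (moment2 (fun w => X w - cexp X)).

(* CN(0,1): real and imaginary parts are independent N(0,1/2); the second
   parameter of [normal_prob] is the standard deviation. *)
Definition std_cnormal (X : T -> R[i]) :=
  let re w := complex.Re (X w) in
  let im w := complex.Im (X w) in
  [/\ indep2 re im,
      forall A, measurable A -> P (re @^-1` A) = normal_prob 0 (Num.sqrt 2^-1) A
    & forall A, measurable A -> P (im @^-1` A) = normal_prob 0 (Num.sqrt 2^-1) A].

End laws.

(* CN(0,Sigma), Sigma possibly singular: the law of A w, where w has
   independent CN(0,1) entries and A A^H = Sigma. *)
Definition cnormal_vec d (T : measurableType d) (R : realType)
    (P : probability T R) m (X : T -> 'cV[R[i]]_m) (Sigma : 'M[R[i]]_m) :=
  exists (d' : measure_display) (T' : measurableType d')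
    (P' : probability T' R) (w : {RV P' >-> 'cV[R[i]]_m}) (A : 'M[R[i]]_m),
    [/\ forall i, std_cnormal P' (fun x => w x i 0),
        mutual_indep P' (fun i x => w x i 0),
        A *m A ^t* = Sigma
      & forall B, measurable B ->
          P (X @^-1` B) = P' ((fun x => A *m w x) @^-1` B)].

Definition hermitian_psd (R : realType) m (Sigma : 'M[R[i]]_m) :=
  Sigma ^t* = Sigma /\ forall a : 'cV[R[i]]_m, 0 <= (a ^t* *m Sigma *m a) 0 0.

(* One coherence block. A point of E is the realization, over the whole block,
   of all the randomness except the data symbols: channels, pilot-phase noise
   and distortion, data-phase noise and internal randomness of the receiver
   hardware. The hardware distortion of the data phase is its response to this
   realization and to the signals transmitted in the data samples, so that the
   same response describes Gaussian signalling and transmission of codewords. *)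
Record uplink (R : realType) (M K tauc taup : nat)
    (dE : measure_display) (E : measurableType dE) := Uplink {
  chan : {mfun E >-> 'M[R[i]]_(M, K)} ; (* column i is h_i *)
  pilot : 'I_K -> 'rV[R[i]]_taup ;
  pilot_noise : {mfun E >-> 'M[R[i]]_(M, taup)} ;
  pilot_dist : {mfun E >-> 'M[R[i]]_(M, taup)} ;
  noise : {mfun E >-> 'M[R[i]]_(M, tauc - taup)} ; (* column t is n *)
  hardware : {mfun (E * 'M[R[i]]_(K, tauc - taup))%type
                   >-> 'M[R[i]]_(M, tauc - taup)} ;
  rho : 'I_K -> R ;
  combiner : 'I_K -> {mfun 'M[R[i]]_(M, taup) >-> 'cV[R[i]]_M}
}.

Section uplink_signals.
Context {R : realType} {M K tauc taup : nat} {dE : measure_display}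
  {E : measurableType dE} (U : uplink R M K tauc taup E).
Local Notation C := R[i].
Local Notation taud := (tauc - taup)%N.
Implicit Types (e : E) (s : 'M[C]_(K, taud)) (t : 'I_taud) (k : 'I_K).

Definition h k e : 'cV[C]_M := col k (chan U e).

Definition rx_pilot e : 'M[C]_(M, taup) :=
  \sum_(i < K) h i e *m pilot U i + pilot_noise U e + pilot_dist U e.

Definition v k e : 'cV[C]_M := combiner U k (rx_pilot e).

Definition tx s : 'M[C]_(K, taud) :=
  \matrix_(i, t) ((Num.sqrt (rho U i))%:C * s i t).

Definition noise_at t e : 'cV[C]_M := col t (noise U e).

Definition dist_at t e s : 'cV[C]_M := col t (hardware U (e, tx s)).

Definition rx_data e s : 'M[C]_(M, taud) :=
  \matrix_(m, t)
    (\sum_(i < K) tx s i t *: h i e + noise_at t e + dist_at t e s) m 0.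

Definition shat k t e s : C := ((v k e) ^t* *m col t (rx_data e s)) 0 0.

(* User k sends the codeword symbols c; the other users keep sending the
   Gaussian symbols s. *)
Definition with_codeword k (c : 'rV[C]_taud) s : 'M[C]_(K, taud) :=
  \matrix_(i, t) if i == k then c 0 t else s i t.

Section sequence_of_blocks.
Context {d : measure_display} {T : measurableType d} (P : probability T R).
Variables (W : nat -> {RV P >-> E}) (S : nat -> {RV P >-> 'M[C]_(K, taud)}).

Definition sample_data b t (w : T) :=
  (chan U (W b w), rx_pilot (W b w), noise_at t (W b w), col t (S b w)).

Record uplink_model (Rcov : 'I_K -> 'M[C]_M) (sigma2 : R) : Prop := {
  pilots_lt_block : (taup < tauc)%N ;
  rho_ge0 : forall i, 0 <= rho U i ;
  sigma2_gt0 : 0 < sigma2 ;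
  Rcov_psd : forall i, hermitian_psd (Rcov i) ;
  blocks_indep : indep_sequence P (fun b w => (W b w, S b w)) ;
  blocks_same_law : forall b, same_law P (W b) (W 0%N) ;
  symbols_indep_rest : forall b, indep2 P (W b) (S b) ;
  symbols_indep : forall b,
    mutual_indep P (fun (it : 'I_K * 'I_taud) w => S b w it.1 it.2) ;
  symbols_law : forall b i t, std_cnormal P (fun w => S b w i t) ;
  chan_law : forall b i, cnormal_vec P (fun w => h i (W b w)) (Rcov i) ;
  noise_law : forall b t,
    cnormal_vec P (fun w => noise_at t (W b w)) (sigma2%:C)%:M ;
  noise_indep : forall b,
    indep2 P (fun w => noise U (W b w))
      (fun w => (chan U (W b w), pilot_noise U (W b w), pilot_dist U (W b w))) ;
  samples_same_law : forall b t t',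
    same_law P
      (fun w => (sample_data b t w, dist_at t (W b w) (S b w)))
      (fun w => (sample_data b t' w, dist_at t' (W b w) (S b w)))
}.

Definition shat_rv k b t (w : T) : C := shat k t (W b w) (S b w).

Definition corr k b t : C := cexp P (fun w => shat_rv k b t w * (S b w k t)^*).

Definition err_var k b t : R :=
  cvar P (fun w => shat_rv k b t w - corr k b t * S b w k t).

Definition SINR k b t : R := (Normc.normc (corr k b t)) ^+ 2 / err_var k b t.

Definition SE k b t : R :=
  (1 - taup%:R / tauc%:R) * (ln (1 + SINR k b t) / ln 2).

(* Rate r, in bits per channel use, is achievable over the channel that maps
   the codeword c of B blocks to the random observation [obs B c]. The power
   constraint says that the energy of x_k is at most rho_k per data symbol on
   average over each codeword. The error probability is maximal over the N
   messages. *)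
Definition achievable dO (O : nat -> measurableType dO)
    (obs : forall B, 'M[C]_(B, taud) -> T -> O B) (r : R) :=
  forall eps : R, 0 < eps -> \forall B \near \oo,
    exists (N : nat) (cw : 'I_N -> 'M[C]_(B, taud)) (dec : O B -> 'I_N),
    [/\ (0 < N)%N /\ r - eps <= (ln N%:R / ln 2) / (B * tauc)%:R,
        forall m, \sum_(b < B) \sum_(t < taud) (Normc.normc (cw m b t)) ^+ 2
                    <= (B * taud)%:R,
        forall m, measurable (dec @^-1` [set m])
      & forall m,
          (P [set w | dec (obs B (cw m) w) <> m] <= eps%:E)%E].

Definition rx_obs k B (c : 'M[C]_(B, taud)) (w : T) :
    B.-tuple ('M[C]_(M, taup) * 'M[C]_(M, taud)) :=
  [tuple (rx_pilot (W b w),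
          rx_data (W b w) (with_codeword k (row b c) (S b w))) | b < B].

Definition combined_obs k B (c : 'M[C]_(B, taud)) (w : T) : 'M[C]_(B, taud) :=
  \matrix_(b, t) shat k t (W b w) (with_codeword k (row b c) (S b w)).

Definition ergodic_capacity k : \bar R :=
  ereal_sup [set r%:E | r in achievable (rx_obs k)].

(* A^(1/2) for A diagonal with nonnegative entries *)
Definition diag_sqrt n (A : 'M[R]_n) : 'M[R]_n :=
  diag_mx (\row_j Num.sqrt (A j j)).

Definition additive_dist b t (epsilon : 'I_M -> R) (r : T -> 'cV[C]_M) :=
  forall w, dist_at t (W b w) (S b w) =
    map_mx (real_complex R)
      (diag_mx (\row_m epsilon m) *m
       diag_sqrt (\sum_(i < K) fine (moment2 P (fun w' => tx (S b w') i t)) *: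
         diag_mx (\row_m (Normc.normc (h i (W b w) m 0)) ^+ 2)))
    *m r w.

End sequence_of_blocks.
End uplink_signals.

(* Main.v *)
(* Write shat = a s_k + mu + e, where a = E{shat s_k^*} and e is centered and
   uncorrelated with s_k, and score a codeword by the sum over all data samples
   of i(s, y) = log of the ratio of the densities of CN(a s + mu, Var e) and
   CN(mu, |a|^2 + Var e) at y. The second moments alone give
   E{i(s_k, shat)} = ln (1 + SINR), so by the weak law of large numbers over the
   independent blocks the transmitted codeword passes a threshold just below
   n (tau_c - tau_p) ln (1 + SINR). For an independent codeword, E{exp i(s, y)} = 1
   for every fixed y, whatever the true law of y, so that it passes with
   probability at most exp(- threshold). A greedy (Feinstein) selection among
   Gaussian codewords that meet the power constraint with a slack factor
   1 + eta, followed by silent blocks that restore the exact constraint, gives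
   maximal error probability tending to 0; the silent blocks cost an arbitrarily
   small part of the rate.

   For the additive model, all cross terms of the second moments vanish because
   the laws of each symbol, of the noise and of r are invariant under a change
   of sign. *)
Require Import Defs.
From mathcomp Require Import all_boot all_order all_algebra.
From mathcomp Require Import ring lra.
From mathcomp Require Import complex.
From mathcomp Require Import all_classical all_reals all_analysis.
From mathcomp Require Import measurable_realfun.

Set Implicit Arguments.
Unset Strict Implicit.
Unset Printing Implicit Defensive.
Import Order.TTheory GRing.Theory Num.Theory.
Local Open Scope classical_set_scope.
Local Open Scope ring_scope.
Local Open Scope complex_scope.
Local Open Scope sesquilinear_scope.

(** * Measurability of complex-valued and matrix-valued maps *)

(** Capacity is operational here, so a code must be exhibited for a channel known only through
    second moments. Finite second moments of shat give the information density no more than a finite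
    first moment, and the samples of one block are dependent; hence a weak law by truncation,
    applied to sums over whole blocks. The identity E exp i(s, y) = 1 averages over the codeword at
    a fixed output, whereas the greedy selection bounds the probability that a fixed codeword is
    claimed by an unrelated output; Tonelli and Markov's inequality transfer the bound to all but a
    small fraction of the codewords. Since E|s_k|^2 = 1 is exactly the power allowance per sample,
    the law of large numbers yields the power constraint only with a slack. Finally, the hardware
    may react to the symbols of all users at once, so feeding a codeword to user k is not an
    additive channel: the substitution is justified by an identity between laws of whole sequences
    of blocks, checked on product sets. *)

Section complex_measurability.
Context {R : realType}.
Local Notation C := R[i].

Lemma measurable_Re : measurable_fun [set: C] (@complex.Re R).
Proof.
by move=> _ Y mY; apply: sub_sigma_algebra; left; exists Y.
Qed.

Lemma measurable_Im : measurable_fun [set: C] (@complex.Im R).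
Proof.
by move=> _ Y mY; apply: sub_sigma_algebra; right; exists Y.
Qed.

Context {d} {T : measurableType d}.
Implicit Types f g : T -> C.

Lemma measurable_complexP f : measurable_fun [set: T] f <->
  measurable_fun [set: T] (fun x => complex.Re (f x)) /\
  measurable_fun [set: T] (fun x => complex.Im (f x)).
Proof.
split=> [mf|[mre mim]].
  split; [exact: (measurableT_comp measurable_Re)|
          exact: (measurableT_comp measurable_Im)].
apply: (measurability (preimage_set_system setT (@complex.Re R) measurable `|`
  preimage_set_system setT (@complex.Im R) measurable)) => //.
move=> _ [_ [] [B mB <-] <-]; rewrite !setTI -[X in measurable X]setTI.
- exact: mre.
- exact: mim.
Qed.

Lemma measurable_complexD f g : measurable_fun setT f -> measurable_fun setT g ->
  measurable_fun setT (fun x => f x + g x).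
Proof.
move=> /measurable_complexP[f1 f2] /measurable_complexP[g1 g2].
apply/measurable_complexP; split.
- apply: eq_measurable_fun (measurable_funD f1 g1) => x _ /=.
  by case: (f x); case: (g x).
- apply: eq_measurable_fun (measurable_funD f2 g2) => x _ /=.
  by case: (f x); case: (g x).
Qed.

Lemma measurable_complexM f g : measurable_fun setT f -> measurable_fun setT g ->
  measurable_fun setT (fun x => f x * g x).
Proof.
move=> /measurable_complexP[f1 f2] /measurable_complexP[g1 g2].
apply/measurable_complexP; split.
- apply: eq_measurable_fun (measurable_funB (measurable_funM f1 g1)
    (measurable_funM f2 g2)) => x _ /=.
  by case: (f x); case: (g x).
- apply: eq_measurable_fun (measurable_funD (measurable_funM f1 g2)
    (measurable_funM f2 g1)) => x _ /=.
  by case: (f x); case: (g x).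
Qed.

Lemma measurable_complexN f : measurable_fun setT f ->
  measurable_fun setT (fun x => - f x).
Proof.
move=> mf; under eq_fun do rewrite -mulN1r.
exact: measurable_complexM.
Qed.

Lemma measurable_complexB f g : measurable_fun setT f -> measurable_fun setT g ->
  measurable_fun setT (fun x => f x - g x).
Proof. by move=> mf mg; apply/measurable_complexD/measurable_complexN. Qed.

Lemma measurable_conj f : measurable_fun setT f ->
  measurable_fun setT (fun x => (f x)^*%R).
Proof.
move=> /measurable_complexP[f1 f2]; apply/measurable_complexP; split.
- by apply: eq_measurable_fun f1 => x _; case: (f x).
- apply: eq_measurable_fun (measurable_funN f2) => x _ /=.
  by case: (f x).
Qed.

Lemma measurable_real_complex (f : T -> R) : measurable_fun setT f ->
  measurable_fun setT (fun x => (f x)%:C).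
Proof. by move=> mf; apply/measurable_complexP; split. Qed.

Lemma normc_sqr (z : C) :
  Normc.normc z ^+ 2 = complex.Re z ^+ 2 + complex.Im z ^+ 2.
Proof. by case: z => a b /=; rewrite sqr_sqrtr// addr_ge0 ?sqr_ge0. Qed.

Lemma measurable_normc_sqr f : measurable_fun setT f ->
  measurable_fun setT (fun x => Normc.normc (f x) ^+ 2).
Proof.
move=> /measurable_complexP[f1 f2]; under eq_fun do rewrite normc_sqr.
by apply: measurable_funD; apply: measurable_funX.
Qed.

Lemma measurable_complex_sum (I : Type) (s : seq I) (F : I -> T -> C) :
  (forall i, measurable_fun setT (F i)) ->
  measurable_fun setT (fun x => \sum_(i <- s) F i x).
Proof.
move=> mF; elim: s => [|i s IHs]; last first.
  by under eq_fun do rewrite big_cons; exact: measurable_complexD.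
by under eq_fun do rewrite big_nil; exact: measurable_cst.
Qed.

End complex_measurability.

Section matrix_measurability.
Context {d} {T : measurableType d} {dE} {E : measurableType dE}.

Lemma measurable_entry m n i j :
  measurable_fun setT (fun A : 'M[E]_(m, n) => A i j).
Proof.
move=> _ Y mY; apply: sub_sigma_algebra.
by exists (i, j) => //; exists Y.
Qed.

Lemma measurable_matrixP m n (f : T -> 'M[E]_(m, n)) : measurable_fun setT f <->
  forall i j, measurable_fun setT (fun x => f x i j).
Proof.
split=> [mf i j|mf]; first exact: (measurableT_comp (measurable_entry i j)).
apply: (measurability (\bigcup_(ij in [set: 'I_m * 'I_n])
    preimage_set_system setT (fun A : 'M[E]_(m, n) => A ij.1 ij.2) measurable)).
  by [].
move=> _ [_ [[i j] _ [B mB <-]] <-]; rewrite !setTI -[X in measurable X]setTI.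
exact: (mf i j).
Qed.

Lemma measurable_matrix m n (F : 'I_m -> 'I_n -> T -> E) :
  (forall i j, measurable_fun setT (F i j)) ->
  measurable_fun setT (fun x => \matrix_(i, j) F i j x).
Proof.
move=> mF; apply/measurable_matrixP => i j; under eq_fun do rewrite mxE.
exact: mF.
Qed.

Lemma measurable_col m n j (f : T -> 'M[E]_(m, n)) : measurable_fun setT f ->
  measurable_fun setT (fun x => col j (f x)).
Proof. by move=> /measurable_matrixP mf; apply: measurable_matrix. Qed.

Lemma measurable_row m n i (f : T -> 'M[E]_(m, n)) : measurable_fun setT f ->
  measurable_fun setT (fun x => row i (f x)).
Proof. by move=> /measurable_matrixP mf; apply: measurable_matrix. Qed.

End matrix_measurability.

Section complex_matrix_measurability.
Context {R : realType} {d} {T : measurableType d}.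
Local Notation C := R[i].

Lemma measurable_addmx m n (f g : T -> 'M[C]_(m, n)) :
  measurable_fun setT f -> measurable_fun setT g ->
  measurable_fun setT (fun x => f x + g x).
Proof.
move=> /measurable_matrixP mf /measurable_matrixP mg.
apply/measurable_matrixP => i j; under eq_fun do rewrite mxE.
exact: measurable_complexD.
Qed.

Lemma measurable_oppmx m n (f : T -> 'M[C]_(m, n)) :
  measurable_fun setT f -> measurable_fun setT (fun x => - f x).
Proof.
move=> /measurable_matrixP mf.
apply/measurable_matrixP => i j; under eq_fun do rewrite mxE.
exact: measurable_complexN.
Qed.

Lemma measurable_mulmx m n p (f : T -> 'M[C]_(m, n)) (g : T -> 'M[C]_(n, p)) :
  measurable_fun setT f -> measurable_fun setT g ->
  measurable_fun setT (fun x => f x *m g x).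
Proof.
move=> /measurable_matrixP mf /measurable_matrixP mg.
apply/measurable_matrixP => i j; under eq_fun do rewrite mxE.
by apply: measurable_complex_sum => l; apply: measurable_complexM.
Qed.

Lemma measurable_scalemx m n (a : T -> C) (f : T -> 'M[C]_(m, n)) :
  measurable_fun setT a -> measurable_fun setT f ->
  measurable_fun setT (fun x => a x *: f x).
Proof.
move=> ma /measurable_matrixP mf.
apply/measurable_matrixP => i j; under eq_fun do rewrite mxE.
exact: measurable_complexM.
Qed.

Lemma measurable_summx m n (I : Type) (s : seq I) (F : I -> T -> 'M[C]_(m, n)) :
  (forall i, measurable_fun setT (F i)) ->
  measurable_fun setT (fun x => \sum_(i <- s) F i x).
Proof.
move=> mF; elim: s => [|i s IHs]; last first.
  by under eq_fun do rewrite big_cons; exact: measurable_addmx.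
by under eq_fun do rewrite big_nil; exact: measurable_cst.
Qed.

Lemma measurable_adjmx m n (f : T -> 'M[C]_(m, n)) :
  measurable_fun setT f -> measurable_fun setT (fun x => (f x) ^t*).
Proof.
move=> /measurable_matrixP mf.
apply/measurable_matrixP => i j; under eq_fun do rewrite !mxE.
exact: measurable_conj.
Qed.

End complex_matrix_measurability.

(** * Laws and independence *)

Section integral_density.
Local Open Scope ereal_scope.
Import HBNNSimple.
Context {d1 d2} {T : measurableType d1} {E : measurableType d2} {R : realType}.
Variables (mu : {measure set T -> \bar R}) (nu : {measure set E -> \bar R}).
Variables (X : T -> E) (g : T -> R).
Hypotheses (mX : measurable_fun setT X) (mg : measurable_fun setT g).
Hypothesis g0 : forall x, (0 <= g x)%R.
Hypothesis nuE : forall A, measurable A -> nu A = \int[mu]_(x in X @^-1` A) (g x)%:E.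

(** Pushforward and density in one statement. It is applied with the identity map for the Gaussian
    density, and with a random variable and the product of the other factors as weight in
    [expectation_prod]. *)
Lemma integral_density (f : E -> \bar R) :
  (forall x, 0 <= f x) -> measurable_fun setT f ->
  \int[nu]_x f x = \int[mu]_x (f (X x) * (g x)%:E).
Proof.
move=> f0 mf; pose h := nnsfun_approx measurableT mf.
have mh n : measurable_fun setT (EFin \o h n) by exact/measurable_EFinP.
have h0 n x : 0 <= (EFin \o h n) x by rewrite lee_fin.
have hnd x : {homo (fun n => (EFin \o h n) x) : a b / (a <= b)%N >-> a <= b}.
  by move=> a b ab; rewrite lee_fin; exact/lefP/nd_nnsfun_approx.
have mEg : measurable_fun setT (EFin \o g) by exact/measurable_EFinP.
have -> : \int[nu]_x f x = lim (\int[nu]_x (EFin \o h n) x @[n --> \oo]).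
  rewrite -monotone_convergence//.
  apply: eq_integral => x _; apply/esym/cvg_lim => //.
  exact: cvg_nnsfun_approx.
have -> : \int[mu]_x (f (X x) * (g x)%:E) =
    lim (\int[mu]_x ((EFin \o h n) (X x) * (g x)%:E) @[n --> \oo]).
  rewrite -monotone_convergence//.
  - apply: eq_integral => x _; apply/esym/cvg_lim => //; apply: cvgeZr => //.
    exact: cvg_nnsfun_approx.
  - move=> n; apply: emeasurable_funM => //.
    exact: (measurableT_comp (mh n) mX).
  - by move=> n x _; rewrite mule_ge0 ?lee_fin.
  - by move=> x _ a b ab; rewrite lee_wpmul2r ?lee_fin//; exact: hnd.
(* Both sides are now monotone limits along the same simple functions, so equality for each [h n]
   suffices; by linearity this comes down to the indicators of its level sets, where [nuE]
   applies. *)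
suff suf n : \int[mu]_x ((EFin \o h n) (X x) * (g x)%:E) =
    \int[nu]_x (EFin \o h n) x by under [in RHS]eq_fun do rewrite suf.
have mI r : measurable_fun setT (fun x : E => (r * \1_(h n @^-1` [set r]) x)%:E).
  by apply/measurable_EFinP; exact: measurable_funM.
have mIX r : measurable_fun setT
    (fun x : T => (r * \1_(h n @^-1` [set r]) (X x))%:E).
  exact: (measurableT_comp (mI r) mX).
transitivity (\int[nu]_x
   (\sum_(y \in range (h n)) (y * \1_(h n @^-1` [set y]) x)%:E)); last first.
  by apply: eq_integral => t _; rewrite /= fimfunE -fsumEFin.
rewrite ge0_integral_fsum//; last by move=> m y _; exact: nnfun_muleindic_ge0.
transitivity (\int[mu]_x (\sum_(y \in range (h n))
    (y * \1_(h n @^-1` [set y]) (X x))%:E * (g x)%:E)).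
  apply: eq_integral => x _; rewrite -ge0_mule_fsuml => [|y].
    by rewrite fsumEFin // -(fimfunE _ (X x)).
  exact: nnfun_muleindic_ge0.
rewrite ge0_integral_fsum//; last 2 first.
  - by move=> y; exact: emeasurable_funM.
  - by move=> m y _; apply: mule_ge0; [exact: nnfun_muleindic_ge0|rewrite lee_fin].
apply: eq_fsbigr => r rhn.
have r0 : (0 <= r)%R by move: rhn; rewrite inE => -[t _ <-].
have mhr : measurable (h n @^-1` [set r]) by [].
under [RHS]eq_integral do rewrite EFinM.
rewrite integralZl_indic_nnsfun => //.
under eq_integral do rewrite EFinM -muleA.
rewrite ge0_integralZl//.
- congr *%E; rewrite integral_indic// setIT nuE// [in RHS]integral_mkcond.
  apply: eq_integral => x _; rewrite patchE indicE.
  have -> : (X x \in h n @^-1` [set r]) = (x \in X @^-1` (h n @^-1` [set r])).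
    by apply/idP/idP; rewrite !inE.
  by case: (x \in _); rewrite ?mul1e ?mul0e.
- apply: emeasurable_funM => //; apply/measurable_EFinP.
  have mi : measurable_fun setT (\1_(h n @^-1` [set r]) : E -> R).
    exact: measurable_indic.
  exact: (measurableT_comp mi mX).
- by move=> t _; rewrite mule_ge0 ?lee_fin.
Qed.
End integral_density.

(** * Laws determined by a generating pi-system *)

Section law_uniqueness.
Local Open Scope ereal_scope.
Context {d1 d2 dO} {T1 : measurableType d1} {T2 : measurableType d2}
  {O : measurableType dO} {R : realType}.
Variables (P1 : probability T1 R) (P2 : probability T2 R).
Variables (X1 : T1 -> O) (X2 : T2 -> O).
Hypotheses (mX1 : measurable_fun setT X1) (mX2 : measurable_fun setT X2).

(** Dynkin's uniqueness theorem. [G setT] provides the constant cover by a set of finite measure. *)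
Lemma law_unique (G : set (set O)) :
  setI_closed G -> G setT -> G `<=` measurable -> measurable `<=` <<s G >> ->
  (forall A, G A -> P1 (X1 @^-1` A) = P2 (X2 @^-1` A)) ->
  forall A, measurable A -> P1 (X1 @^-1` A) = P2 (X2 @^-1` A).
Proof.
move=> GI GT Gm mG eqG A mA.
pose Y1 := MeasurableFun.Pack (MeasurableFun.Class (isMeasurableFun.Build _ _ _ _ _ mX1)).
pose Y2 := MeasurableFun.Pack (MeasurableFun.Class (isMeasurableFun.Build _ _ _ _ _ mX2)).
apply: (g_sigma_algebra_measure_unique G Gm (fun=> setT) _ _
  (distribution P1 Y1) (distribution P2 Y2)) => //.
- by rewrite -subTset => x _; exists 0%N.
- by move=> k; rewrite (le_lt_trans (probability_le1 _ _)) ?ltry.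
- exact: mG.
Qed.

Lemma law_integral (f : O -> \bar R) :
  (forall A, measurable A -> P1 (X1 @^-1` A) = P2 (X2 @^-1` A)) ->
  (forall x, 0 <= f x) -> measurable_fun setT f ->
  \int[P1]_x f (X1 x) = \int[P2]_x f (X2 x).
Proof.
move=> eqP f0 mf.
rewrite -[LHS](@ge0_integral_pushforward _ _ _ _ _ _ mX1 P1 setT f)//.
rewrite -[RHS](@ge0_integral_pushforward _ _ _ _ _ _ mX2 P2 setT f)//.
by apply: eq_measure_integral => A mA _; exact: eqP.
Qed.

End law_uniqueness.

(** Lets generation by [G] be proved coordinatewise: measurability of the identity can be attacked
    with [measurable_matrixP] or [measurable_fun_pairP]. *)
Lemma generated_measurable d (O : measurableType d) (G : set (set O)) :
  measurable_fun [set: g_sigma_algebraType G] (id : g_sigma_algebraType G -> O) ->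
  measurable `<=` <<s G >>.
Proof. by move=> mid A mA; have := mid measurableT A mA; rewrite setTI. Qed.

Section product_laws.
Local Open Scope ereal_scope.
Context {d1 d2} {T1 : measurableType d1} {T2 : measurableType d2} {R : realType}.
Variables (P1 : probability T1 R) (P2 : probability T2 R).

Lemma pair_law_unique {dA dB} {EA : measurableType dA} {EB : measurableType dB}
    (X1 : T1 -> EA) (Y1 : T1 -> EB) (X2 : T2 -> EA) (Y2 : T2 -> EB) :
  measurable_fun setT X1 -> measurable_fun setT Y1 ->
  measurable_fun setT X2 -> measurable_fun setT Y2 ->
  (forall A B, measurable A -> measurable B ->
    P1 (X1 @^-1` A `&` Y1 @^-1` B) = P2 (X2 @^-1` A `&` Y2 @^-1` B)) ->
  forall A, measurable A ->
    P1 ((fun x => (X1 x, Y1 x)) @^-1` A) = P2 ((fun x => (X2 x, Y2 x)) @^-1` A).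
Proof.
move=> mX1 mY1 mX2 mY2 PP.
pose G := [set A `*` B | A in @measurable _ EA & B in @measurable _ EB].
apply: (law_unique _ _ (G := G)); first exact: measurable_fun_pair.
- exact: measurable_fun_pair.
- move=> _ _ [A mA [B mB <-]] [A' mA' [B' mB' <-]].
  exists (A `&` A'); first exact: measurableI.
  by exists (B `&` B'); [exact: measurableI|rewrite setXI].
- by exists setT => //; exists setT => //; rewrite setXTT.
- by move=> _ [A mA [B mB <-]]; exact: measurableX.
- by rewrite measurable_prod_measurableType.
- by move=> _ [A mA [B mB <-]]; exact: PP.
Qed.

(** Boxes with one measurable set per entry form a pi-system; they generate, because a box may
    constrain a single entry and leave the others free. *)
Lemma mx_law_unique {dE} {E : measurableType dE} m n
    (X1 : T1 -> 'M[E]_(m, n)) (X2 : T2 -> 'M[E]_(m, n)) :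
  measurable_fun setT X1 -> measurable_fun setT X2 ->
  (forall F : 'I_m -> 'I_n -> set E, (forall i j, measurable (F i j)) ->
    P1 [set x | forall i j, F i j (X1 x i j)] =
    P2 [set x | forall i j, F i j (X2 x i j)]) ->
  forall A, measurable A -> P1 (X1 @^-1` A) = P2 (X2 @^-1` A).
Proof.
move=> mX1 mX2 PP.
pose box (F : 'I_m -> 'I_n -> set E) := [set M : 'M[E]_(m, n) | forall i j, F i j (M i j)].
pose G := [set A | exists2 F, (forall i j, measurable (F i j)) & A = box F].
apply: (law_unique mX1 mX2 (G := G)).
- move=> _ _ [F mF ->] [F' mF' ->].
  exists (fun i j => F i j `&` F' i j) => [i j|]; first exact: measurableI.
  rewrite /box; apply/seteqP; split => [M [F1 F2] i j|M FM]; first by split.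
  by split => i j; case: (FM i j).
- exists (fun _ _ => setT) => //.
  by apply/seteqP; split.
- move=> _ [F mF ->].
  rewrite [X in measurable X](_ : _ = \bigcap_(ij in [set: 'I_m * 'I_n])
     ((fun M : 'M[E]_(m, n) => M ij.1 ij.2) @^-1` F ij.1 ij.2)).
    apply: fin_bigcap_measurable => [|[i j] _]; first exact: finite_finset.
    by rewrite -[X in measurable X]setTI; exact: measurable_entry.
  by apply/seteqP; split => [M FM [i j] _|M FM i j]; [exact: FM|exact: (FM (i, j))].
- apply: generated_measurable; apply/measurable_matrixP => i j _ Y mY.
  rewrite setTI; apply: sub_sigma_algebra.
  exists (fun i' j' => if (i' == i) && (j' == j) then Y else setT) => [i' j'|].
    by case: ifP.
  apply/seteqP; split => [M YM i' j'|M /(_ i j)].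
    by case: ifP => // /andP[/eqP-> /eqP->].
  by rewrite !eqxx.
- by move=> _ [F mF ->]; exact: PP.
Qed.

End product_laws.

(** * Independent families and expectations of products *)

Section independence.
Local Open Scope ereal_scope.
Context {d} {T : measurableType d} {R : realType} (P : probability T R).

Lemma indep2_same_law {dA dB} {EA : measurableType dA} {EB : measurableType dB}
    (X X' : T -> EA) (Y Y' : T -> EB) :
  measurable_fun setT X -> measurable_fun setT Y ->
  measurable_fun setT X' -> measurable_fun setT Y' ->
  indep2 P X Y -> indep2 P X' Y' -> same_law P X X' -> same_law P Y Y' ->
  same_law P (fun w => (X w, Y w)) (fun w => (X' w, Y' w)).
Proof.
move=> mX mY mX' mY' XY XY' XX' YY'; apply: pair_law_unique => // A B mA mB.
by rewrite XY// XY'// XX'// YY'.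
Qed.

Lemma mutual_indep_mx_same_law {dE} {E : measurableType dE} m n
    (X Y : T -> 'M[E]_(m, n)) :
  measurable_fun setT X -> measurable_fun setT Y ->
  mutual_indep P (fun (ij : 'I_m * 'I_n) w => X w ij.1 ij.2) ->
  mutual_indep P (fun (ij : 'I_m * 'I_n) w => Y w ij.1 ij.2) ->
  (forall i j, same_law P (fun w => X w i j) (fun w => Y w i j)) ->
  same_law P X Y.
Proof.
move=> mX mY iX iY XY; apply: mx_law_unique => // F mF.
have := iX (fun ij => F ij.1 ij.2) (fun ij => mF _ _).
have := iY (fun ij => F ij.1 ij.2) (fun ij => mF _ _).
have boxE (Z : T -> 'M[E]_(m, n)) : [set w | forall i j, F i j (Z w i j)] =
    [set w | forall ij, F ij.1 ij.2 (Z w ij.1 ij.2)].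
  by apply/seteqP; split => [w FZ [i j]|w FZ i j]; [exact: FZ|exact: (FZ (i, j))].
rewrite !boxE => -> ->; apply: eq_bigr => -[i j] _; exact: XY.
Qed.

Lemma indep2_comp {dA dB dA' dB'} {EA : measurableType dA} {EB : measurableType dB}
    {EA' : measurableType dA'} {EB' : measurableType dB'}
    (X : T -> EA) (Y : T -> EB) (f : EA -> EA') (g : EB -> EB') :
  measurable_fun setT f -> measurable_fun setT g -> indep2 P X Y ->
  indep2 P (fun w => f (X w)) (fun w => g (Y w)).
Proof.
move=> mf mg XY A B mA mB; apply: (XY (f @^-1` A) (g @^-1` B)).
- by rewrite -[X in measurable X]setTI; exact: mf.
- by rewrite -[X in measurable X]setTI; exact: mg.
Qed.

Lemma same_law_comp {dA dA'} {EA : measurableType dA} {EA' : measurableType dA'}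
    (X Y : T -> EA) (f : EA -> EA') : measurable_fun setT f ->
  same_law P X Y -> same_law P (fun w => f (X w)) (fun w => f (Y w)).
Proof.
move=> mf XY A mA; apply: (XY (f @^-1` A)).
by rewrite -[X in measurable X]setTI; exact: mf.
Qed.

Section product_expectation.
Context (I : finType) {dE} {E : measurableType dE} (X : I -> T -> E).
Hypothesis mX : forall i, measurable_fun setT (X i).
Hypothesis iX : mutual_indep P X.

Lemma expectation_prod (f : I -> E -> R) :
  (forall i x, (0 <= f i x)%R) -> (forall i, measurable_fun setT (f i)) ->
  (forall i, \int[P]_w (f i (X i w))%:E < +oo) ->
  \int[P]_w (\prod_i f i (X i w))%:E = \prod_i \int[P]_w (f i (X i w))%:E.
Proof.
(* Indicators are replaced by general functions one index at a time. *)
suff H (J : seq I) (g : I -> E -> R) :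
    (forall i x, (0 <= g i x)%R) -> (forall i, measurable_fun setT (g i)) ->
    (forall i, \int[P]_w (g i (X i w))%:E < +oo) ->
    (forall i, i \notin J -> exists2 A, measurable A & g i = \1_A) ->
    \int[P]_w (\prod_i g i (X i w))%:E = \prod_i \int[P]_w (g i (X i w))%:E.
  by move=> f0 mf foo; apply: (H (enum I)) => // i; rewrite mem_enum.
elim: J g => [|j J IH] g g0 mg goo gI.
  have {}gI i : {A | measurable A & g i = \1_A}.
    by apply: cid2; exact: gI.
  pose A i := s2val (gI i).
  have mA i : measurable (A i) by rewrite /A; case: (gI i).
  have gA i : g i = \1_(A i) by rewrite /A; case: (gI i).
  have mXA i : measurable (X i @^-1` A i).
    by rewrite -[X in measurable X]setTI; exact: mX.
  transitivity (\int[P]_w (\1_[set w | forall i, A i (X i w)] w)%:E).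
    apply: eq_integral => w _; congr EFin.
    rewrite indicE; have [/set_mem/= Aw|Aw] := boolP (w \in _).
      by apply: big1 => i _; rewrite gA indicE mem_set.
    move: Aw; rewrite notin_setE => /existsNP[i Ai].
    by rewrite (bigD1 i)//= gA indicE memNset// mul0r.
  rewrite integral_indic//; last first.
    rewrite [X in measurable X](_ : _ = \bigcap_(i in [set: I]) (X i @^-1` A i)).
      by apply: fin_bigcap_measurable => //; exact: finite_finset.
    by apply/seteqP; split => [w Aw i _|w Aw i]; [exact: Aw|exact: (Aw i)].
  rewrite setIT; apply: (etrans (iX mA)).
  apply: eq_bigr => i _; rewrite gA.
  transitivity (\int[P]_w (\1_(X i @^-1` A i) w)%:E).
    by rewrite integral_indic// setIT.
  by apply: eq_integral => w _.
have goofin i : \int[P]_w (g i (X i w))%:E \is a fin_num.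
  by rewrite ge0_fin_numE// integral_ge0// => w _; rewrite lee_fin.
pose c : R := (\prod_(i | i != j) fine (\int[P]_w (g i (X i w))%:E))%R.
have cE : c%:E = \prod_(i | i != j) \int[P]_w (g i (X i w))%:E.
  by rewrite -prodEFin; apply: eq_bigr => i _; rewrite fineK.
have c0 : (0 <= c)%R.
  by apply: prodr_ge0 => i _; rewrite fine_ge0// integral_ge0// => w _; rewrite lee_fin.
pose G w := (\prod_(i | i != j) g i (X i w))%R.
pose Xj := MeasurableFun.Pack (MeasurableFun.Class (isMeasurableFun.Build _ _ _ _ _ (mX j))).
have mgX i : measurable_fun setT (fun w => g i (X i w)).
  exact: (measurableT_comp (mg i) (mX i)).
have mG : measurable_fun setT G.
  rewrite /G; under eq_fun do rewrite big_mkcond/=.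
  by apply: measurable_prod => i _; case: (i != j) => //; exact: measurable_cst.
have G0 w : (0 <= G w)%R by apply: prodr_ge0.
(* With [g j] replaced by an indicator, the induction hypothesis says that [c] times the law of
   [X j] is the image under [X j] of the measure of density [G]. This is the premise of
   [integral_density], which then restores [g j]. *)
have step A : measurable A ->
    mscale (NngNum c0) (distribution P Xj) A = \int[P]_(w in X j @^-1` A) (G w)%:E.
  move=> mA; rewrite /mscale/= /distribution/pushforward/=.
  pose g' i := if i == j then \1_A else g i.
  have mXA : measurable (X j @^-1` A).
    by rewrite -[X in measurable X]setTI; exact: mX.
  have Pj : \int[P]_w (g' j (X j w))%:E = P (X j @^-1` A).
    transitivity (\int[P]_w (\1_(X j @^-1` A) w)%:E).
      by apply: eq_integral => w _; rewrite /g' eqxx.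
    by rewrite integral_indic// setIT.
  have IHg' : \int[P]_w (\prod_i g' i (X i w))%:E =
      \prod_i \int[P]_w (g' i (X i w))%:E.
    apply: IH.
    - by move=> i x; rewrite /g'; case: ifP.
    - by move=> i; rewrite /g'; case: ifP => // _; exact: measurable_indic.
    - move=> i; have [->|ij] := eqVneq i j; last by rewrite /g' (negbTE ij).
      by rewrite Pj (le_lt_trans (probability_le1 _ _)) ?ltry.
    - move=> i iJ; rewrite /g'; case: (eqVneq i j) => [_|ij]; first by exists A.
      by apply: gI; rewrite inE negb_or ij.
  move: IHg'; rewrite [RHS](bigD1 j)//= Pj.
  rewrite (eq_bigr (fun i => \int[P]_w (g i (X i w))%:E)); last first.
    by move=> i /negbTE ij; rewrite /g' ij.
  rewrite -cE [_ * c%:E]muleC => <-.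
  rewrite [RHS]integral_mkcond; apply: eq_integral => w _; rewrite patchE.
  rewrite (bigD1 j)//= {1}/g' eqxx indicE.
  have -> : (X j w \in A) = (w \in X j @^-1` A) by [].
  case: (w \in _); last by rewrite mul0r.
  rewrite mul1r; congr EFin; apply: eq_bigr => i /negbTE ij.
  by rewrite /g' ij.
rewrite (bigD1 j)//= -cE.
have /= := @integral_density _ _ _ _ _ P (mscale (NngNum c0) (distribution P Xj))
  (X j) G (mX j) mG G0 step (EFin \o g j).
have mgj : measurable_fun setT (EFin \o g j) by exact/measurable_EFinP.
rewrite ge0_integral_mscale//=; last by move=> x _; rewrite lee_fin.
rewrite (ge0_integral_distribution Xj mgj); last by move=> x; rewrite lee_fin.
rewrite muleC => ->//; last by move=> x; rewrite lee_fin.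
apply: eq_integral => w _; rewrite /G -EFinM (bigD1 j)//=.
Qed.

End product_expectation.

End independence.

(** * Tail bounds and the weak law of large numbers *)

Section tail_bounds.
Local Open Scope ereal_scope.
Context {d} {T : measurableType d} {R : realType} (P : probability T R).

Lemma measurable_le_set (f g : T -> R) : measurable_fun setT f ->
  measurable_fun setT g -> measurable [set w | (f w <= g w)%R].
Proof.
move=> mf mg; have := measurable_fun_ler mf mg measurableT.
move=> /(_ [set true] I); rewrite setTI.
by congr measurable; apply/seteqP.
Qed.

Lemma markov_ge0 (f : T -> R) (a : R) : measurable_fun setT f ->
  (forall w, 0 <= f w)%R -> (0 < a)%R ->
  P [set w | a <= f w]%R <= a^-1%:E * \int[P]_w (f w)%:E.
Proof.
move=> mf f0 a0; set A := [set w | _].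
have mA : measurable A by apply: measurable_le_set => //; exact: measurable_cst.
have mEf : measurable_fun setT (EFin \o f) by exact/measurable_EFinP.
have a0' : 0 <= a^-1%:E by rewrite lee_fin invr_ge0 ltW.
rewrite -(ge0_integralZl P measurableT mEf _ a0'); last by move=> w _; rewrite lee_fin.
rewrite -(setIT A) -integral_indic//; apply: ge0_le_integral => //.
- by apply/measurable_EFinP; exact: measurable_indic.
- by apply/measurable_EFinP; apply: measurable_funM => //; exact: measurable_cst.
- move=> w _; rewrite lee_fin indicE.
  have [/set_mem/= Aw|_] := boolP (w \in A).
    by rewrite mulrC ler_pdivlMr// mul1r.
  by rewrite mulr_ge0// invr_ge0 ltW.
Qed.

(** Avoids Taylor's formula: exp (-x) = 1 / exp x is at most 1 / (1 + x). The coefficient 2 is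
    generous enough for the product with 1 + x to stay above 1 on the whole range. *)
Lemma expRN_le_quadratic (x : R) :
  (`|x| <= 2^-1 -> expR (- x) <= 1 - x + 2 * x ^+ 2)%R.
Proof.
rewrite ler_norml => /andP[x1 x2].
have x0 : (0 < 1 + x)%R by lra.
rewrite expRN; apply: (@le_trans _ _ (1 + x)^-1%R).
  by rewrite lef_pV2 ?posrE ?expR_gt0// expR_ge1Dx.
rewrite -[leLHS]mul1r ler_pdivrMr//.
have -> : ((1 - x + 2 * x ^+ 2) * (1 + x) = 1 + x ^+ 2 * (1 + 2 * x))%R by ring.
by rewrite lerDl mulr_ge0 ?sqr_ge0//; lra.
Qed.

(** Dominated convergence along integer thresholds: if every tail exceeded eta, so would the limit,
    which is 0. *)
Lemma integrable_tail (f : T -> R) (eta : R) : P.-integrable setT (EFin \o f) ->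
  (0 < eta)%R -> exists2 A : R, (0 < A)%R &
    \int[P]_w (Num.norm (f w) * \1_[set w | A < Num.norm (f w)]%R w)%:E <= eta%:E.
Proof.
move=> intf eta0.
have mf : measurable_fun setT f by apply/measurable_EFinP; exact: measurable_int intf.
have mabs : measurable_fun setT (fun w => Num.norm (f w)) by exact: measurableT_comp.
pose g n w : \bar R := (Num.norm (f w) * \1_[set w | n.+1%:R < Num.norm (f w)]%R w)%:E.
have mg n : measurable_fun setT (g n).
  apply/measurable_EFinP; apply: measurable_funM => //.
  apply: measurable_indic; rewrite [X in measurable X](_ : _ = ~` [set w | Num.norm (f w) <= n.+1%:R]%R).
    by apply: measurableC; apply: measurable_le_set => //; exact: measurable_cst.
  by apply/seteqP; split => w /=; rewrite ltNge => /negP.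
have gcvg w : setT w -> g n w @[n --> \oo] --> (cst 0 w : \bar R).
  move=> _; apply: cvg_near_cst.
  near=> n; rewrite /g indicE memNset ?mulr0//= => /lt_geF.
  rewrite ltW//.
  apply: (lt_le_trans (truncnS_gt _)); rewrite ler_nat ltnS.
  by near: n; exact: nbhs_infty_ge.
have intabs : P.-integrable setT (fun w => (Num.norm (f w))%:E).
  have -> : (fun w => (Num.norm (f w))%:E) = abse \o (EFin \o f) by apply/funext.
  exact: integrable_abse.
have gle n w : setT w -> `|g n w| <= (Num.norm (f w))%:E.
  move=> _; rewrite /g lee_fin normrM normr_id indicE.
  by case: (_ \in _); rewrite ?normr1 ?mulr1 ?normr0 ?mulr0.
have gfin w : setT w -> (Num.norm (f w))%:E \is a fin_num by [].
have /= gint := dominated_cvg measurableT mg gcvg gfin intabs gle.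
rewrite integral0 in gint.
apply: contrapT => noA.
have : eta%:E <= lim (\int[P]_w g n w @[n --> \oo]).
  apply: lime_ge; first by apply/cvg_ex; exists 0.
  near=> n; rewrite leNgt; apply/negP => /ltW gn.
  by apply: noA; exists n.+1%:R.
by rewrite (cvg_lim _ gint)// lee_fin leNgt eta0.
Unshelve. all: by end_near. Qed.

End tail_bounds.

(** * The lower half of the weak law, from a first moment only *)

Section weak_law.
Local Open Scope ereal_scope.
Context {d} {T : measurableType d} {R : realType} (P : probability T R).

Lemma same_law_integral dE (E : measurableType dE) (X Y : T -> E) (f : E -> R) :
  measurable_fun setT X -> measurable_fun setT Y -> measurable_fun setT f ->
  same_law P X Y -> (forall x, 0 <= f x)%R ->
  \int[P]_w (f (X w))%:E = \int[P]_w (f (Y w))%:E.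
Proof.
move=> mX mY mf XY f0; apply: (law_integral mX mY (f := EFin \o f)) => //.
exact/measurable_EFinP.
Qed.

(** Positive and negative parts are compared separately, so the equality holds whether or not [f] is
    integrable. *)
Lemma same_law_integral_signed dE (E : measurableType dE) (X Y : T -> E) (f : E -> R) :
  measurable_fun setT X -> measurable_fun setT Y -> measurable_fun setT f ->
  same_law P X Y -> \int[P]_w (f (X w))%:E = \int[P]_w (f (Y w))%:E.
Proof.
move=> mX mY mf XY; have mEf : measurable_fun setT (EFin \o f) by exact/measurable_EFinP.
have H (g : E -> \bar R) : (forall x, 0 <= g x) -> measurable_fun setT g ->
    \int[P]_w g (X w) = \int[P]_w g (Y w).
  by move=> g0 mg; exact: (law_integral mX mY).
have pE (Z : T -> E) w : (fun w' => (f (Z w'))%:E)^\+ w = (EFin \o f)^\+ (Z w).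
  by rewrite !funeposE.
have nE (Z : T -> E) w : (fun w' => (f (Z w'))%:E)^\- w = (EFin \o f)^\- (Z w).
  by rewrite !funenegE.
rewrite integralE [RHS]integralE; congr (_ - _).
- under eq_integral do rewrite pE; under [RHS]eq_integral do rewrite pE.
  exact: (H _ (funepos_ge0 _) (measurable_funepos mEf)).
- under eq_integral do rewrite nE; under [RHS]eq_integral do rewrite nE.
  exact: (H _ (funeneg_ge0 _) (measurable_funeneg mEf)).
Qed.

Lemma mutual_indep_comp (I : finType) dE (E : measurableType dE)
    dE' (E' : measurableType dE') (X : I -> T -> E) (f : I -> E -> E') :
  (forall i, measurable_fun setT (f i)) -> mutual_indep P X ->
  mutual_indep P (fun i w => f i (X i w)).
Proof.
move=> mf iX A mA; apply: (iX (fun i => f i @^-1` A i)) => i.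
by rewrite -[X in measurable X]setTI; exact: mf.
Qed.

Lemma le_integral_real (f g : T -> R) :
  P.-integrable setT (EFin \o f) -> P.-integrable setT (EFin \o g) ->
  (forall w, f w <= g w)%R -> \int[P]_w (f w)%:E <= \int[P]_w (g w)%:E.
Proof. by move=> fi gi fg; apply: le_integral => // w _; rewrite lee_fin. Qed.

Lemma bounded_integrable (f : T -> R) (A : R) : measurable_fun setT f ->
  (forall w, `|f w| <= A)%R -> P.-integrable setT (EFin \o f).
Proof.
move=> mf fA; apply: measurable_bounded_integrable => //.
- by rewrite (le_lt_trans (probability_le1 _ _)) ?ltry.
- by exists A; split; [exact: num_real|move=> x Ax w _ /=; exact: (le_trans (fA w) (ltW Ax))].
Qed.

Lemma measurable_expRN dE (E : measurableType dE) (l : R) (f : E -> R) :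
  measurable_fun setT f -> measurable_fun setT (fun w => expR (- (l * f w))).
Proof.
move=> mf; apply: (measurableT_comp (@measurable_expR R)).
by apply: measurable_funN; apply: measurable_funM => //; exact: measurable_cst.
Qed.

(** Exponential Markov inequality for bounded variables. A common lower bound of the means is
    enough, which suits truncated variables, whose mean is known only approximately. *)
Lemma chernoff_lower (X : nat -> T -> R) (A m delta : R) :
  (forall b, measurable_fun setT (X b)) -> indep_sequence P X ->
  (0 < A)%R -> (0 < delta)%R -> (forall b w, `|X b w| <= A)%R ->
  (forall b, m%:E <= \int[P]_w (X b w)%:E) ->
  exists2 l : R, (0 < l)%R & forall n,
    P [set w | \sum_(b < n) X b w <= n%:R * (m - delta)]%R <= (expR (- (n%:R * l)))%:E.
Proof.
move=> mX iX A0 d0 XA mle.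
(* The first bound gives |lam X| <= 1/2, the range of [expRN_le_quadratic]. The second keeps the
   quadratic term below lam * delta / 2, so that half of the gain lam * delta per summand
   survives. *)
pose lam := Num.min (A^-1 / 2)%R (delta / (4 * A ^+ 2))%R.
have lam0 : (0 < lam)%R.
  by rewrite lt_min !divr_gt0 ?invr_gt0 ?mulr_gt0 ?exprn_gt0.
have lamA : (lam * A <= 2^-1)%R.
  by rewrite -ler_pdivlMr// mulrC /lam ge_min lexx.
have lamd : (2 * lam * A ^+ 2 <= delta / 2)%R.
  have : (lam <= delta / (4 * A ^+ 2))%R by rewrite /lam ge_min lexx orbT.
  rewrite ler_pdivlMr ?mulr_gt0 ?exprn_gt0// => h.
  by rewrite ler_pdivlMr//; apply: le_trans h; rewrite le_eqVlt; apply/orP; left; apply/eqP; ring.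
exists (lam * delta / 2)%R; first by rewrite !mulr_gt0.
move=> n.
have mexp b : measurable_fun setT (fun w => expR (- (lam * X b w))).
  exact: measurable_expRN.
have Eexp b : \int[P]_w (expR (- (lam * X b w)))%:E <=
    (expR (lam * (delta / 2 - m)))%:E.
  apply: (@le_trans _ _ (\int[P]_w (1 + 2 * (lam * A) ^+ 2 - lam * X b w)%:E)).
    apply: le_integral_real => [||w].
    - apply: (@bounded_integrable _ (expR (lam * A))) => // w.
      rewrite ger0_norm ?expR_ge0// ler_expR lerNl -mulrN ler_pM2l//.
      by have := XA b w; rewrite ler_norml => /andP[].
    - apply: (@bounded_integrable _ (1 + 2 * (lam * A) ^+ 2 + lam * A)).
        apply: measurable_funB; first exact: measurable_cst.
        by apply: measurable_funM => //; exact: measurable_cst.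
      move=> w; rewrite (le_trans (ler_normB _ _))// lerD//.
        by rewrite ger0_norm// addr_ge0// mulr_ge0// sqr_ge0.
      by rewrite normrM gtr0_norm// ler_pM2l.
    have lX : (`|lam * X b w| <= lam * A)%R by rewrite normrM gtr0_norm// ler_pM2l.
    rewrite (le_trans (expRN_le_quadratic (le_trans lX lamA)))//.
    rewrite addrAC lerD2r lerD2l ler_pM2l//.
    by rewrite -(real_normK (num_real (lam * X b w))) lerXn2r ?nnegrE// mulr_ge0 ?ltW.
  have iX' : P.-integrable setT (EFin \o X b) by exact: bounded_integrable.
  under eq_integral do rewrite EFinB EFinM.
  rewrite integralB//=; first last.
  - exact: integrableZl.
  - exact: finite_measure_integrable_cst.
  rewrite integral_cst//= probability_setT mule1 integralZl//.
  have Xfin : \int[P]_w (X b w)%:E \is a fin_num by exact: integrable_fin_num.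
  have := mle b; rewrite -(fineK Xfin) lee_fin; set e := fine _ => me.
  rewrite -EFinM -EFinB lee_fin.
  apply: (@le_trans _ _ (1 + lam * (delta / 2 - m))%R); last exact: expR_ge1Dx.
  rewrite -addrA lerD2l mulrBr lerB ?ler_pM2l//.
  have -> : (2 * (lam * A) ^+ 2 = lam * (2 * lam * A ^+ 2))%R by ring.
  by rewrite ler_pM2l.
have mS : measurable_fun setT (fun w => expR (- (lam * \sum_(b < n) X b w))).
  by apply: measurable_expRN; apply: measurable_sum.
have iXn : mutual_indep P (fun (b : 'I_n) w => X b w) by exact: iX.
have sumE w : expR (- (lam * \sum_(b < n) X b w)) =
    (\prod_(b < n) expR (- (lam * X b w)))%R.
  by rewrite mulr_sumr -sumrN expR_sum.
pose c := expR (- (lam * (n%:R * (m - delta))))%R.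
have setE : [set w | \sum_(b < n) X b w <= n%:R * (m - delta)]%R =
    [set w | c <= expR (- (lam * \sum_(b < n) X b w))]%R.
  by apply/seteqP; split => w /=; rewrite ler_expR lerN2 ler_pM2l.
rewrite setE; apply: le_trans.
  by apply: (markov_ge0 P mS) => [w|]; rewrite ?expR_ge0 ?expR_gt0.
under eq_integral do rewrite sumE.
rewrite (@expectation_prod _ _ _ P _ _ _ (fun b : 'I_n => X b) _ iXn
  (fun b x => expR (- (lam * x)))) => [|//|b x|b|b]; last first.
- by apply: le_lt_trans (Eexp b) _; rewrite ltry.
- exact: measurable_expRN.
- exact: expR_ge0.
apply: (@le_trans _ _ (c^-1%:E * \prod_(b < n) (expR (lam * (delta / 2 - m)))%:E)).
  rewrite lee_wpmul2l ?lee_fin ?invr_ge0 ?expR_ge0//.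
  suff /andP[] : 0 <= \prod_(b < n) \int[P]_w (expR (- (lam * X b w)))%:E <=
      \prod_(b < n) (expR (lam * (delta / 2 - m)))%:E by [].
  apply: (big_ind2 (fun x y => 0 <= x <= y)) => [|x1 x2 y1 y2|b _].
  - by rewrite lexx lee_fin ler01.
  - move=> /andP[x10 x12] /andP[y10 y12].
    by rewrite mule_ge0//= lee_pmul.
  - rewrite Eexp andbT; apply: integral_ge0 => w _.
    by rewrite lee_fin expR_ge0.
rewrite prodEFin -EFinM lee_fin big_const_ord iter_mulr_1 -expRM_natl.
rewrite /c -expRN opprK -expRD ler_expR le_eqVlt; apply/orP; left; apply/eqP.
by field.
Qed.

(** No variance is available for Chebyshev's inequality. The variables are truncated at a level
    where the tail has small mean: the bounded part [tr] obeys [chernoff_lower], and the sum of the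
    tails [tl] is controlled by Markov's inequality. *)
Lemma weak_law_lower (X : nat -> T -> R) (m theta eps : R) :
  (forall b, measurable_fun setT (X b)) -> indep_sequence P X ->
  (forall b, same_law P (X b) (X 0%N)) ->
  P.-integrable setT (EFin \o X 0%N) -> \int[P]_w (X 0%N w)%:E = m%:E ->
  (theta < m)%R -> (0 < eps)%R ->
  \forall n \near \oo,
    P [set w | \sum_(b < n) X b w <= n%:R * theta]%R <= eps%:E.
Proof.
move=> mX iX sX intX Em thm eps0.
(* The gap m - theta is spent in quarters: one for the mean lost by truncation, two for the
   deviation of the truncated sum, one for the sum of the tails. *)
pose delta := ((m - theta) / 4)%R.
have d0 : (0 < delta)%R by rewrite divr_gt0// subr_gt0.
(* The tail mean must be below delta to shift the truncated mean by at most delta, and below eps *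
   delta / 2 for Markov's inequality at level n * delta to give eps / 2. *)
have e0 : (0 < Num.min delta (eps * delta / 2))%R.
  by rewrite lt_min d0/= divr_gt0// mulr_gt0.
have [A A0 EA] := integrable_tail intX e0.
pose far := [set x : R | A < Num.norm x]%R.
have mfar : measurable far.
  rewrite /far [X in measurable X](_ : _ = ~` [set x : R | Num.norm x <= A]%R).
    apply: measurableC.
    apply: (@measurable_le_set _ R R (fun x => Num.norm x) (fun=> A)) => //.
  by apply/seteqP; split => x /=; rewrite ltNge => /negP.
pose tl x : R := (Num.norm x * \1_far x)%R.
pose tr x : R := (x * \1_(~` far) x)%R.
have trtl x : (tr x - tl x <= x)%R.
  rewrite /tr /tl !indicE in_setC; case: (x \in far) => /=.
    by rewrite mulr0 mulr1 sub0r lerNnormlW.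
  by rewrite mulr1 mulr0 subr0.
have xtr x : (x - tl x <= tr x)%R.
  rewrite /tr /tl !indicE in_setC; case: (x \in far) => /=.
    by rewrite mulr0 mulr1 subr_le0 ler_norm.
  by rewrite mulr1 mulr0 subr0.
have tl0 x : (0 <= tl x)%R by rewrite mulr_ge0// indicE.
have mtl : measurable_fun setT tl.
  by apply: measurable_funM => //; apply: measurable_indic.
have mtr : measurable_fun setT tr.
  by apply: measurable_funM => //; apply: measurable_indic; exact: measurableC.
have trA x : (`|tr x| <= A)%R.
  rewrite /tr indicE in_setC; have [_|] := boolP (x \in far) => /=.
    by rewrite mulr0 normr0 ltW.
  by rewrite notin_setE /far/= mulr1 leNgt => /negP.
have mtlX b : measurable_fun setT (fun w => tl (X b w)) by exact: measurableT_comp.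
have mtrX b : measurable_fun setT (fun w => tr (X b w)) by exact: measurableT_comp.
have Etl b : \int[P]_w (tl (X b w))%:E <= (Num.min delta (eps * delta / 2))%:E.
  by rewrite (same_law_integral (mX b) (mX 0%N) mtl (sX b) tl0).
have itl : P.-integrable setT (EFin \o (fun w => tl (X 0%N w))).
  apply/integrableP; split; first exact/measurable_EFinP.
  under eq_integral do rewrite /= ger0_norm//.
  by apply: le_lt_trans (Etl 0%N) _; rewrite ltry.
have Etr b : (m - delta)%:E <= \int[P]_w (tr (X b w))%:E.
  rewrite (same_law_integral_signed (mX b) (mX 0%N) mtr (sX b)).
  apply: (@le_trans _ _ (\int[P]_w (X 0%N w - tl (X 0%N w))%:E)).
    under eq_integral do rewrite EFinB.
    rewrite integralB// Em EFinB leeD2l// leeN2 (le_trans (Etl 0%N))//.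
    by rewrite lee_fin ge_min lexx.
  apply: le_integral_real => [||w]; last exact: xtr.
    exact: (integrableB measurableT intX itl).
  exact: (@bounded_integrable _ A).
have iXtr : indep_sequence P (fun b w => tr (X b w)).
  by move=> n; apply: (mutual_indep_comp (f := fun=> tr)) => //; exact: iX.
have d20 : (0 < 2 * delta)%R by rewrite mulr_gt0.
have [l l0 Hl] := chernoff_lower mtrX iXtr A0 d20 (fun b w => trA (X b w)) Etr.
near=> n.
have n0 : (0 < n%:R :> R)%R by rewrite ltr0n; near: n; exact: nbhs_infty_gt.
pose B1 := [set w | \sum_(b < n) tr (X b w) <= n%:R * (m - delta - 2 * delta)]%R.
pose B2 := [set w | n%:R * delta <= \sum_(b < n) tl (X b w)]%R.
have mS (f : R -> R) : measurable_fun setT f ->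
    measurable_fun setT (fun w => \sum_(b < n) f (X b w))%R.
  by move=> mf; apply: measurable_sum => b; exact: (measurableT_comp mf (mX b)).
have mB1 : measurable B1 by apply: measurable_le_set; [exact: mS|exact: measurable_cst].
have mB2 : measurable B2 by apply: measurable_le_set; [exact: measurable_cst|exact: mS].
have PB1 : P B1 <= (eps / 2)%:E.
  apply: le_trans (Hl n) _; rewrite lee_fin.
  rewrite -[leRHS]lnK ?posrE ?divr_gt0// ler_expR lerNl -ler_pdivrMr//.
  apply: ltW; apply: (lt_le_trans (truncnS_gt _)); rewrite ler_nat.
  by near: n; exact: nbhs_infty_ge.
have PB2 : P B2 <= (eps / 2)%:E.
  apply: le_trans.
    apply: (markov_ge0 P (mS _ mtl)); first by move=> w; exact: sumr_ge0.
    by rewrite mulr_gt0.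
  under eq_integral do rewrite -sumEFin.
  rewrite ge0_integral_sum//; last 2 first.
    by move=> b; exact/measurable_EFinP.
    by move=> b w _; rewrite lee_fin.
  apply: (@le_trans _ _ ((n%:R * delta)^-1%:E * \sum_(b < n) (eps * delta / 2)%:E)).
    rewrite lee_wpmul2l ?lee_fin ?invr_ge0 ?(ltW (mulr_gt0 n0 d0))//.
    apply: lee_sum => b _; apply: le_trans (Etl b) _.
    by rewrite lee_fin ge_min lexx orbT.
  rewrite sumEFin -EFinM lee_fin sumr_const card_ord -mulr_natl.
  rewrite le_eqVlt; apply/orP; left; apply/eqP; field.
  by rewrite !gt_eqF.
apply: (@le_trans _ _ (P (B1 `|` B2))).
  apply: le_measure; rewrite ?inE//.
  - by apply: measurable_le_set; [exact: (mS id)|exact: measurable_cst].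
  - exact: measurableU.
  - move=> w /= Sw; rewrite /B1 /B2/=.
    have [B2w|B2w] := leP (n%:R * delta)%R (\sum_(b < n) tl (X b w))%R; first by right.
    left; apply: (@le_trans _ _ (\sum_(b < n) (X b w + tl (X b w)))%R).
      by apply: ler_sum => b _; rewrite -lerBlDr.
    rewrite big_split/= (le_trans (lerD Sw (ltW B2w)))// -mulrDr ler_pM2l//.
    by rewrite /delta; lra.
apply: le_trans (measureU2 _ mB1 mB2) _.
by rewrite [eps]splitr EFinD leeD.
Unshelve. all: by end_near. Qed.

End weak_law.

(** * Gaussian integrals *)

Section gaussian.
Context {R : realType}.
Local Open Scope ereal_scope.
Local Notation sd := (Num.sqrt (2^-1 : R)).

Lemma normal_integral d (T : measurableType d) (P : probability T R) (X : T -> R)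
    (f : R -> R) : measurable_fun setT X ->
  (forall A, measurable A -> P (X @^-1` A) = normal_prob 0 sd A) ->
  (forall x, 0 <= f x)%R -> measurable_fun setT f ->
  \int[P]_w (f (X w))%:E =
  \int[lebesgue_measure]_x ((f x)%:E * (normal_pdf 0 sd x)%:E).
Proof.
move=> mX lX f0 mf; have mEf : measurable_fun setT (EFin \o f) by exact/measurable_EFinP.
transitivity (\int[normal_prob 0 sd]_x (f x)%:E).
  exact: (@law_integral _ _ _ _ _ _ _ P (normal_prob 0 sd) X id mX _ (EFin \o f) lX).
have mpdf : measurable_fun setT (normal_pdf 0 sd) by exact: measurable_normal_pdf.
have mid : measurable_fun setT (id : measurableTypeR R -> measurableTypeR R) by [].
have pdf0 x : (0 <= normal_pdf 0 sd x)%R by exact: normal_pdf_ge0.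
have Ef0 x : 0 <= (EFin \o f) x by rewrite lee_fin.
have := @integral_density _ _ (measurableTypeR R) (measurableTypeR R) R
  lebesgue_measure (normal_prob 0 sd) id
  (normal_pdf 0 sd) mid mpdf pdf0 _ (EFin \o f) Ef0 mEf.
exact.
Qed.

(** Completing the square. At variance 1/2 the density is exp (-x^2) / sqrt pi, so the integrand
    becomes a constant times the normal density of mean b / (1 + a) and variance 1 / (2 (1 + a)). *)
Lemma gaussian_exp_quadratic d (T : measurableType d) (P : probability T R)
    (X : T -> R) (a b : R) : measurable_fun setT X ->
  (forall A, measurable A -> P (X @^-1` A) = normal_prob 0 sd A) ->
  (0 < 1 + a)%R ->
  \int[P]_w (expR (2 * b * X w - a * X w ^+ 2))%:E =
  ((Num.sqrt (1 + a))^-1 * expR (b ^+ 2 / (1 + a)))%:E.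
Proof.
move=> mX lX a1.
rewrite (normal_integral (f := fun x => expR (2 * b * x - a * x ^+ 2)) mX lX) => [|x|]; [|exact: expR_ge0|]; last first.
  apply: (measurableT_comp (@measurable_expR R)); apply: measurable_funB.
    by apply: measurable_funM => //; exact: measurable_cst.
  by apply: measurable_funM => //; exact: measurable_cst.
pose s' := Num.sqrt ((2 * (1 + a))^-1)%R.
have s'2 : (s' ^+ 2 = (2 * (1 + a))^-1)%R.
  by rewrite sqr_sqrtr// invr_ge0 mulr_ge0// ltW.
have s'0 : s' != 0%R.
  by rewrite gt_eqF// sqrtr_gt0 invr_gt0 mulr_gt0.
have sd2 : (sd ^+ 2 = 2^-1)%R by rewrite sqr_sqrtr// invr_ge0.
have sd0 : sd != 0%R by rewrite gt_eqF// sqrtr_gt0 invr_gt0.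
pose c := ((Num.sqrt (1 + a))^-1 * expR (b ^+ 2 / (1 + a)))%R.
have c0 : (0 <= c)%R by rewrite mulr_ge0 ?expR_ge0// invr_ge0 sqrtr_ge0.
transitivity (c%:E * \int[lebesgue_measure]_x (normal_pdf (b / (1 + a)) s' x)%:E);
  last by rewrite integral_normal_pdf mule1.
have mpdf : measurable_fun setT (fun x => (normal_pdf (b / (1 + a)) s' x)%:E).
  by apply/measurable_EFinP; exact: measurable_normal_pdf.
have cE0 : 0 <= c%:E by rewrite lee_fin.
have pdf0 x : [set: R] x -> 0 <= (normal_pdf (b / (1 + a)) s' x)%:E.
  by rewrite lee_fin normal_pdf_ge0.
rewrite -(ge0_integralZl lebesgue_measure measurableT mpdf pdf0 cE0).
apply: eq_integral => x _; rewrite -!EFinM; congr EFin.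
rewrite !normal_pdfE//= /normal_peak /normal_fun s'2 sd2 /c.
have -> : (Num.sqrt ((2 * (1 + a))^-1 * pi *+ 2) =
    (Num.sqrt (1 + a))^-1 * Num.sqrt pi :> R)%R.
  rewrite -sqrtrV ?ltW// -sqrtrM ?invr_ge0 ?ltW//; congr Num.sqrt.
  by rewrite -mulr_natr; field; rewrite gt_eqF.
have -> : (2^-1 * pi *+ 2 = pi :> R)%R by rewrite -mulr_natr; field.
have sa0 : Num.sqrt (1 + a) != 0%R by rewrite gt_eqF// sqrtr_gt0.
have -> : (((Num.sqrt (1 + a))^-1 * Num.sqrt pi)^-1 =
    Num.sqrt (1 + a) * (Num.sqrt pi)^-1)%R by rewrite invfM invrK.
have -> (u v x1 x2 : R) : (u^-1 * x1 * (u * v * x2) = (u^-1 * u) * (v * (x1 * x2)))%R.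
  by ring.
rewrite mulVf// mul1r mulrCA -!expRD; congr (_ * expR _)%R.
by field; rewrite gt_eqF.
Qed.

Lemma inv_sqrt_le (y z : R) : (0 < y -> 0 <= z -> 1 <= y * z ^+ 2 ->
  (Num.sqrt y)^-1 <= z)%R.
Proof.
move=> y0 z0 yz; have sy : (0 < Num.sqrt y)%R by rewrite sqrtr_gt0.
rewrite -[leLHS]mul1r ler_pdivrMr// -(ger0_norm z0) -sqrtr_sqr -sqrtrM ?sqr_ge0//.
by rewrite -[leLHS]sqrtr1 ler_wsqrtr// mulrC.
Qed.

(* 1 + u <= exp u bounds E X^2 on both sides by difference quotients of
   a |-> E exp (- a X^2), known from [gaussian_exp_quadratic]. *)
Lemma gaussian_sqr d (T : measurableType d) (P : probability T R) (X : T -> R) :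
  measurable_fun setT X ->
  (forall A, measurable A -> P (X @^-1` A) = normal_prob 0 sd A) ->
  \int[P]_w (X w ^+ 2)%:E = (2^-1)%:E.
Proof.
move=> mX lX.
have mX2 : measurable_fun setT (fun w => X w ^+ 2)%R by exact: measurable_funX.
have mexp (l : R) : measurable_fun setT (fun w => expR (l * X w ^+ 2)).
  apply: (measurableT_comp (@measurable_expR R)).
  by apply: measurable_funM => //; exact: measurable_cst.
have E (a : R) : (0 < 1 + a)%R ->
    \int[P]_w (expR (- a * X w ^+ 2))%:E = ((Num.sqrt (1 + a))^-1)%:E.
  move=> a1; have := gaussian_exp_quadratic 0 mX lX a1.
  rewrite expr0n/= mul0r expR0 mulr1 => <-; apply: eq_integral => w _.
  by rewrite mulr0 mul0r sub0r mulNr.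
have upper (a : R) : (0 < a <= 2^-1)%R ->
    1 + a%:E * \int[P]_w (X w ^+ 2)%:E <= (1 + a / 2 + a ^+ 2)%:E.
  move=> /andP[a0 a2].
  apply: (@le_trans _ _ ((Num.sqrt (1 - a))^-1)%:E); last first.
    rewrite lee_fin; apply: inv_sqrt_le; [by lra|by have := sqr_ge0 a; lra|].
    rewrite -subr_ge0; have -> : ((1 - a) * (1 + a / 2 + a ^+ 2) ^+ 2 - 1 =
        a ^+ 2 * (5 / 4 - 5 / 4 * a - a ^+ 3))%R by field.
    have a3 : (a ^+ 3 <= a)%R by rewrite ler_iXnr//; lra.
    by rewrite mulr_ge0 ?sqr_ge0//; lra.
  rewrite -E; last by lra.
  have -> : 1 + a%:E * \int[P]_w (X w ^+ 2)%:E =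
      \int[P]_w ((1 : R)%:E + a%:E * (X w ^+ 2)%:E).
    rewrite ge0_integralD//; last 2 first.
    - by move=> w _; rewrite -EFinM lee_fin mulr_ge0 ?sqr_ge0 ?ltW.
    - by apply/measurable_EFinP; apply: measurable_funM => //; exact: measurable_cst.
    rewrite integral_cst//= probability_setT mule1 ge0_integralZl//.
    - exact/measurable_EFinP.
    - by move=> w _; rewrite lee_fin sqr_ge0.
    - by rewrite lee_fin ltW.
  apply: ge0_le_integral => //.
  - by move=> w _; rewrite -EFinM lee_fin addr_ge0// mulr_ge0 ?sqr_ge0 ?ltW.
  - apply/measurable_EFinP; apply: measurable_funD; first exact: measurable_cst.
    by apply: measurable_funM => //; exact: measurable_cst.
  - by apply/measurable_EFinP; exact: mexp.
  - by move=> w _; rewrite lee_fin opprK expR_ge1Dx.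
(* The upper bound at a = 1/2 excludes an infinite second moment; integrability is then available
   for the lower bound, where the second moment is subtracted. *)
have fin : \int[P]_w (X w ^+ 2)%:E \is a fin_num.
  have i0 : 0 <= \int[P]_w (X w ^+ 2)%:E.
    by apply: integral_ge0 => w _; rewrite lee_fin sqr_ge0.
  rewrite ge0_fin_numE//.
  have a1 : (0 < (2^-1 : R) <= 2^-1)%R by rewrite lexx invr_gt0 ltr0n.
  have := upper _ a1.
  case: (\int[P]_w _) i0 => [r|_|]//; first by rewrite ltry.
  by rewrite gt0_muley ?lte_fin// addey.
set e := \int[P]_w _ in upper fin *.
have intX2 : P.-integrable setT (EFin \o (fun w => X w ^+ 2)%R).
  apply/integrableP; split; first exact/measurable_EFinP.
  under eq_integral do rewrite /= ger0_norm ?sqr_ge0//.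
  by rewrite -ge0_fin_numE//; apply: integral_ge0 => w _; rewrite lee_fin sqr_ge0.
have lower (a : R) : (0 < a <= 2^-1)%R ->
    1 - a%:E * e <= (1 - a / 2 + a ^+ 2)%:E.
  move=> /andP[a0 a2].
  apply: (@le_trans _ _ ((Num.sqrt (1 + a))^-1)%:E); last first.
    rewrite lee_fin; apply: inv_sqrt_le; [by lra|by have := sqr_ge0 a; lra|].
    rewrite -subr_ge0; have -> : ((1 + a) * (1 - a / 2 + a ^+ 2) ^+ 2 - 1 =
        a ^+ 2 * (5 / 4 + 5 / 4 * a + a ^+ 3))%R by field.
    have a3 : (0 <= a ^+ 3)%R by rewrite exprn_ge0// ltW.
    by rewrite mulr_ge0 ?sqr_ge0//; lra.
  rewrite -E; last by lra.
  have iZ : P.-integrable setT (fun w => a%:E * (X w ^+ 2)%:E) by exact: integrableZl.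
  have i1 : P.-integrable setT (fun w => 1%:E) by exact: finite_measure_integrable_cst.
  have -> : 1 - a%:E * e = \int[P]_w ((1 : R)%:E - a%:E * (X w ^+ 2)%:E).
    by rewrite integralB// integral_cst//= probability_setT mule1 integralZl.
  apply: le_integral => //.
  - exact: integrableB.
  - apply: (@bounded_integrable _ _ _ _ _ 1) => // w.
    rewrite ger0_norm ?expR_ge0// expR_le1 mulNr oppr_le0 mulr_ge0 ?sqr_ge0//.
    exact: ltW.
  - by move=> w _; rewrite lee_fin mulNr expR_ge1Dx.
rewrite -(fineK fin); congr EFin.
have bound (a : R) : (0 < a <= 2^-1 -> `|fine e - 2^-1| <= a)%R.
  move=> a2; move: (upper _ a2) (lower _ a2).
  rewrite -(fineK fin) -!EFinM -EFinD -EFinB !lee_fin => u l.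
  case/andP: a2 => a0 a2.
  rewrite ler_norml; apply/andP; split; rewrite -(ler_pM2l a0); lra.
apply/eqP; rewrite -subr_eq0 -normr_eq0; apply/eqP/le_anti.
rewrite normr_ge0 andbT; apply/ler_addgt0Pr => a a0; rewrite add0r.
have m0 : (0 < Num.min a 2^-1 <= 2^-1)%R.
  by rewrite lt_min a0 invr_gt0 ltr0n/= ge_min lexx orbT.
by rewrite (le_trans (bound _ m0))// ge_min lexx.
Qed.

End gaussian.

Section independent_pairs.
Local Open Scope ereal_scope.
Context {d} {T : measurableType d} {R : realType} (P : probability T R).
Context {dA dB} {EA : measurableType dA} {EB : measurableType dB}.
Variables (X : T -> EA) (Y : T -> EB).
Hypotheses (mX : measurable_fun setT X) (mY : measurable_fun setT Y).
Hypothesis XY : indep2 P X Y.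

(** [X] and [Y] have different codomains, but [f] and [g] send both to the reals, so the pair
    becomes a family indexed by bool and [expectation_prod] applies. *)
Lemma indep2_expectation (f : EA -> R) (g : EB -> R) :
  (forall x, 0 <= f x)%R -> (forall x, 0 <= g x)%R ->
  measurable_fun setT f -> measurable_fun setT g ->
  \int[P]_w (f (X w))%:E < +oo -> \int[P]_w (g (Y w))%:E < +oo ->
  \int[P]_w (f (X w) * g (Y w))%:E =
  \int[P]_w (f (X w))%:E * \int[P]_w (g (Y w))%:E.
Proof.
move=> f0 g0 mf mg foo goo.
pose Z (b : bool) w := if b then f (X w) else g (Y w).
have mZ b : measurable_fun setT (Z b).
  by case: b; [exact: (measurableT_comp mf mX)|exact: (measurableT_comp mg mY)].
have iZ : mutual_indep P Z.
  move=> A mA; rewrite big_bool/= -(indep2_comp mf mg XY (mA true) (mA false)).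
  congr (P _); apply/seteqP; split => [w /= AZ|w [Aw1 Aw2] []//].
  by split; [exact: (AZ true)|exact: (AZ false)].
(* [expectation_prod] asks for functions that are nonnegative on all of R, not merely on the values
   taken; hence the positive part instead of the identity. *)
have := expectation_prod mZ iZ (f := fun _ x => Num.max x 0%R).
under eq_integral do rewrite big_bool/= !max_l//.
rewrite big_bool/=; under [X in X * _]eq_integral do rewrite max_l//.
under [X in _ * X]eq_integral do rewrite max_l//.
apply.
- by move=> _ x; rewrite le_max lexx orbT.
- by move=> _; apply: measurable_maxr => //; exact: measurable_cst.
- by case; under eq_integral do rewrite /= max_l//.
Qed.

End independent_pairs.

Section complex_gaussian.
Context {R : realType}.
Local Notation C := R[i].
Local Notation sd := (Num.sqrt (2^-1 : R)).
Local Open Scope ereal_scope.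

(* [normal_prob 0 0] is the uniform law on [0, 1], which is not symmetric. *)
Lemma normal_prob_opp (s : R) (A : set R) : s != 0%R -> measurable A ->
  normal_prob 0 s (-%R @^-1` A) = normal_prob 0 s A.
Proof.
move=> s0 mA; rewrite /normal_prob.
have mpdf : measurable_fun A (fun x => (normal_pdf 0 s x)%:E).
  by apply/measurable_funTS/measurable_EFinP; exact: measurable_normal_pdf.
have mN : measurable_fun setT (-%R : R -> measurableTypeR R) by [].
transitivity (\int[pushforward lebesgue_measure (-%R : R -> measurableTypeR R)]_(y in A)
    (normal_pdf 0 s y)%:E).
  have pdf0 : {in A, forall y, 0 <= (normal_pdf 0 s y)%:E}.
    by move=> y _; rewrite lee_fin normal_pdf_ge0.
  rewrite (@ge0_integral_pushforward _ _ (measurableTypeR R) (measurableTypeR R) R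
    -%R mN lebesgue_measure A _ mA mpdf pdf0).
  apply: eq_integral => x _; congr EFin.
  by rewrite /= !normal_pdfE// /normal_fun !subr0 sqrrN.
by apply: eq_measure_integral => D mD _; exact: lebesgue_measureN.
Qed.

Lemma complex_law_unique d1 d2 (T1 : measurableType d1) (T2 : measurableType d2)
    (P1 : probability T1 R) (P2 : probability T2 R) (X1 : T1 -> C) (X2 : T2 -> C) :
  measurable_fun setT X1 -> measurable_fun setT X2 ->
  (forall A B, measurable A -> measurable B ->
    P1 [set w | A (complex.Re (X1 w)) /\ B (complex.Im (X1 w))] =
    P2 [set w | A (complex.Re (X2 w)) /\ B (complex.Im (X2 w))]) ->
  forall A, measurable A -> P1 (X1 @^-1` A) = P2 (X2 @^-1` A).
Proof.
move=> /[dup] mX1 /measurable_complexP[mr1 mi1] /[dup] mX2 /measurable_complexP[mr2 mi2] H A mA.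
have mpair : measurable_fun setT (fun ab : R * R => ab.1 +i* ab.2).
  apply/measurable_complexP; split; [exact: measurable_fst|exact: measurable_snd].
have mA' : measurable ((fun ab : R * R => ab.1 +i* ab.2) @^-1` A).
  by rewrite -[X in measurable X]setTI; exact: mpair.
have := pair_law_unique mr1 mi1 mr2 mi2 H mA'.
rewrite /preimage/=.
have E d (T : measurableType d) (X : T -> C) : [set t | A (complex.Re (X t) +i* complex.Im (X t))] = [set t | A (X t)].
  by apply/seteqP; split => w /=; case: (X w).
by rewrite !E.
Qed.

Lemma std_cnormal_rect d (T : measurableType d) (P : probability T R) (X : T -> C) A B :
  std_cnormal P X -> measurable A -> measurable B ->
  P [set w | A (complex.Re (X w)) /\ B (complex.Im (X w))] =
  normal_prob 0 sd A * normal_prob 0 sd B.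
Proof. by move=> [iX lr li] mA mB; rewrite -lr// -li// -iX. Qed.

Lemma std_cnormal_law d1 d2 (T1 : measurableType d1) (T2 : measurableType d2)
    (P1 : probability T1 R) (P2 : probability T2 R) (X1 : T1 -> C) (X2 : T2 -> C) :
  measurable_fun setT X1 -> measurable_fun setT X2 ->
  std_cnormal P1 X1 -> std_cnormal P2 X2 ->
  forall A, measurable A -> P1 (X1 @^-1` A) = P2 (X2 @^-1` A).
Proof.
move=> mX1 mX2 sX1 sX2; apply: complex_law_unique => // A B mA mB.
by rewrite !std_cnormal_rect.
Qed.

Context d (T : measurableType d) (P : probability T R) (X : T -> C).
Hypotheses (mX : measurable_fun setT X) (sX : std_cnormal P X).

Lemma std_cnormal_opp : same_law P (fun w => - X w)%R X.
Proof.
apply: complex_law_unique => //; first exact: measurable_complexN.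
move=> A B mA mB; rewrite (std_cnormal_rect sX mA mB).
have mN (D : set R) : measurable D -> measurable (-%R @^-1` D).
  by move=> mD; rewrite -[X in measurable X]setTI; exact: oppr_measurable.
have sd0 : sd != 0%R by rewrite gt_eqF// sqrtr_gt0 invr_gt0 ltr0n.
rewrite -(normal_prob_opp sd0 mA) -(normal_prob_opp sd0 mB).
rewrite -(std_cnormal_rect sX (mN _ mA) (mN _ mB)); congr (P _).
by apply/seteqP; split => w /=; case: (X w).
Qed.

Lemma std_cnormal_moment2 : \int[P]_w (Normc.normc (X w) ^+ 2)%:E = 1.
Proof.
have [mr mi] : measurable_fun setT (fun w => complex.Re (X w)) /\
   measurable_fun setT (fun w => complex.Im (X w)) by apply/measurable_complexP.
have [_ lr li] := sX.
under eq_integral do rewrite normc_sqr EFinD.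
rewrite ge0_integralD//; first last.
- by apply/measurable_EFinP; exact: measurable_funX.
- by move=> w _; rewrite lee_fin sqr_ge0.
- by apply/measurable_EFinP; exact: measurable_funX.
- by move=> w _; rewrite lee_fin sqr_ge0.
by rewrite (gaussian_sqr mr lr) (gaussian_sqr mi li) -EFinD; congr EFin; field.
Qed.

(** As Re (z X) = Re z Re X - Im z Im X, independence of the two parts factors the integral into two
    instances of [gaussian_exp_quadratic], with b = Re z and b = - Im z. *)
Lemma std_cnormal_exp (z : C) (a : R) : (0 < 1 + a)%R ->
  \int[P]_w (expR (2 * complex.Re (z * X w) - a * Normc.normc (X w) ^+ 2))%:E =
  ((1 + a)^-1 * expR (Normc.normc z ^+ 2 / (1 + a)))%:E.
Proof.
move=> a1.
have [mr mi] : measurable_fun setT (fun w => complex.Re (X w)) /\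
   measurable_fun setT (fun w => complex.Im (X w)) by apply/measurable_complexP.
have [iX lr li] := sX.
pose f (b : R) x := expR (2 * b * x - a * x ^+ 2).
have mf b : measurable_fun setT (f b).
  apply: (measurableT_comp (@measurable_expR R)); apply: measurable_funB.
    by apply: measurable_funM => //; exact: measurable_cst.
  by apply: measurable_funM => //; exact: measurable_cst.
have f0 b x : (0 <= f b x)%R by exact: expR_ge0.
have Er b := gaussian_exp_quadratic b mr lr a1.
have Ei b := gaussian_exp_quadratic b mi li a1.
transitivity (\int[P]_w (f (complex.Re z) (complex.Re (X w)) *
    f (- complex.Im z) (complex.Im (X w)))%:E).
  apply: eq_integral => w _; congr EFin; rewrite /f -expRD normc_sqr.
  by congr expR; case: z => z1 z2; case: (X w) => x1 x2 /=; ring.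
have E1 : \int[P]_w (f (complex.Re z) (complex.Re (X w)))%:E < +oo.
  by rewrite Er ltry.
have E2 : \int[P]_w (f (- complex.Im z) (complex.Im (X w)))%:E < +oo.
  by rewrite Ei ltry.
rewrite (indep2_expectation mr mi iX (f0 _) (f0 _) (mf _) (mf _) E1 E2) Er Ei.
rewrite -EFinM; congr EFin; rewrite mulrACA -invfM -expr2 sqr_sqrtr ?ltW//.
by rewrite -expRD -mulrDl sqrrN normc_sqr.
Qed.

End complex_gaussian.

(** * The uplink with Gaussian symbols *)

Section uplink_measurability.
Context {R : realType} {M K tauc taup : nat} {dE : measure_display}
  {E : measurableType dE} (U : uplink R M K tauc taup E).
Local Notation C := R[i].
Local Notation taud := (tauc - taup)%N.

Lemma measurable_h i : measurable_fun setT (h U i).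
Proof. by apply: measurable_col; exact: measurable_funPT. Qed.

Lemma measurable_rx_pilot : measurable_fun setT (rx_pilot U).
Proof.
apply: measurable_addmx; last exact: measurable_funPT.
apply: measurable_addmx; last exact: measurable_funPT.
apply: measurable_summx => i; apply: measurable_mulmx; first exact: measurable_h.
exact: measurable_cst.
Qed.

Lemma measurable_v k : measurable_fun setT (v U k).
Proof.
by apply: (measurableT_comp _ measurable_rx_pilot); exact: measurable_funPT.
Qed.

Lemma measurable_tx : measurable_fun setT (tx U).
Proof.
apply: measurable_matrix => i t; apply: measurable_complexM.
  exact: measurable_cst.
exact: measurable_entry.
Qed.

Lemma measurable_noise_at t : measurable_fun setT (noise_at U t).
Proof. by apply: measurable_col; exact: measurable_funPT. Qed.

Lemma measurable_dist_at t :
  measurable_fun setT (fun es : E * 'M[C]_(K, taud) => dist_at U t es.1 es.2).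
Proof.
apply: measurable_col.
apply: (@measurableT_comp _ _ _ _ _ _ (hardware U)); first exact: measurable_funPT.
apply: measurable_fun_pair; first exact: measurable_fst.
exact: (measurableT_comp measurable_tx measurable_snd).
Qed.

(* Reads off shat from the data of one sample, the only data whose law is
   known not to depend on t. *)
Definition sample_shat k
    (z : ('M[C]_(M, K) * 'M[C]_(M, taup) * 'cV[C]_M * 'cV[C]_K) * 'cV[C]_M) : C :=
  ((combiner U k z.1.1.1.2) ^t* *m
     (\sum_(i < K) ((Num.sqrt (rho U i))%:C * z.1.2 i 0) *: col i z.1.1.1.1
      + z.1.1.2 + z.2)) 0 0.

Lemma shatE k t e s : shat U k t e s =
  sample_shat k (chan U e, rx_pilot U e, noise_at U t e, col t s, dist_at U t e s).
Proof.
suff rxE : col t (rx_data U e s) =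
    \sum_(i < K) ((Num.sqrt (rho U i))%:C * s i t) *: h U i e
    + noise_at U t e + dist_at U t e s.
  rewrite /shat rxE /sample_shat /=.
  by under [in RHS]eq_bigr do rewrite mxE.
apply/matrixP => m j; rewrite [LHS]mxE [LHS]mxE ord1.
by under eq_bigr do rewrite mxE.
Qed.

Lemma measurable_sample_shat k : measurable_fun setT (sample_shat k).
Proof.
have m1 : measurable_fun setT
    (fun z : ('M[C]_(M, K) * 'M[C]_(M, taup) * 'cV[C]_M * 'cV[C]_K) * 'cV[C]_M => z.1).
  exact: measurable_fst.
have m11 := measurableT_comp measurable_fst m1.
have m111 := measurableT_comp measurable_fst m11.
apply: (measurableT_comp (measurable_entry 0 0)).
apply: measurable_mulmx.
  apply: measurable_adjmx.
  apply: (measurableT_comp (measurable_funPT (combiner U k))).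
  exact: (measurableT_comp measurable_snd m111).
apply: measurable_addmx; last exact: measurable_snd.
apply: measurable_addmx; last exact: (measurableT_comp measurable_snd m11).
apply: measurable_summx => i; apply: measurable_scalemx.
  apply: measurable_complexM; first exact: measurable_cst.
  apply: (measurableT_comp (measurable_entry i 0)).
  exact: (measurableT_comp measurable_snd m1).
by apply: measurable_col; exact: (measurableT_comp measurable_fst m111).
Qed.

Lemma measurable_sample_data t : measurable_fun setT
  (fun es : E * 'M[C]_(K, taud) =>
     (chan U es.1, rx_pilot U es.1, noise_at U t es.1, col t es.2,
      dist_at U t es.1 es.2)).
Proof.
apply: measurable_fun_pair; last exact: measurable_dist_at.
apply: measurable_fun_pair; last by apply: measurable_col; exact: measurable_snd.
apply: measurable_fun_pair; last exact: (measurableT_comp (measurable_noise_at t) measurable_fst).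
apply: measurable_fun_pair; last exact: (measurableT_comp measurable_rx_pilot measurable_fst).
exact: (measurableT_comp (measurable_funPT (chan U)) measurable_fst).
Qed.

Lemma measurable_shat k t :
  measurable_fun setT (fun es : E * 'M[C]_(K, taud) => shat U k t es.1 es.2).
Proof.
under eq_fun do rewrite shatE.
exact: (measurableT_comp (measurable_sample_shat k) (measurable_sample_data t)).
Qed.

Lemma measurable_with_codeword k dT (T : measurableType dT)
    (c : T -> 'rV[C]_taud) (s : T -> 'M[C]_(K, taud)) :
  measurable_fun setT c -> measurable_fun setT s ->
  measurable_fun setT (fun x => with_codeword k (c x) (s x)).
Proof.
move=> /measurable_matrixP mc /measurable_matrixP ms.
by apply: measurable_matrix => i t; case: (i == k).
Qed.

End uplink_measurability.

Section uplink_laws.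
Context {R : realType} {M K tauc taup : nat} {dE : measure_display}
  {E : measurableType dE} (U : uplink R M K tauc taup E).
Local Notation C := R[i].
Local Notation taud := (tauc - taup)%N.
Context {d : measure_display} {T : measurableType d} {P : probability T R}.
Variables (W : nat -> {RV P >-> E}) (S : nat -> {RV P >-> 'M[C]_(K, taud)}).
Variables (Rcov : 'I_K -> 'M[C]_M) (sigma2 : R).
Hypothesis model : uplink_model U W S Rcov sigma2.

Lemma measurable_symbol b i t : measurable_fun setT (fun w => S b w i t).
Proof. exact: (measurableT_comp (measurable_entry i t) (measurable_funPT (S b))). Qed.

Lemma measurable_block b : measurable_fun setT (fun w => (W b w, S b w)).
Proof. by apply: measurable_fun_pair; exact: measurable_funPT. Qed.

Lemma symbols_same_law b b' : same_law P (S b) (S b').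
Proof.
apply: mutual_indep_mx_same_law => //.
- exact: (symbols_indep model).
- exact: (symbols_indep model).
- move=> i t; apply: std_cnormal_law; first exact: measurable_symbol.
  + exact: measurable_symbol.
  + exact: (symbols_law model).
  + exact: (symbols_law model).
Qed.

Lemma block_same_law b :
  same_law P (fun w => (W b w, S b w)) (fun w => (W 0%N w, S 0%N w)).
Proof.
apply: indep2_same_law => //.
- exact: (symbols_indep_rest model).
- exact: (symbols_indep_rest model).
- exact: (blocks_same_law model).
- exact: symbols_same_law.
Qed.

Lemma measurable_shat_rv k b t : measurable_fun setT (shat_rv U W S k b t).
Proof. exact: (measurableT_comp (measurable_shat U k t) (measurable_block b)). Qed.

(** The SINR is computed at one sample of one block, while a code uses them all. Stationarity over
    samples is assumed only for [sample_data] and the distortion, stationarity over blocks only for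
    [W]; the chain goes through block 0. *)
Lemma shat_symbol_same_law k b t b' t' :
  same_law P (fun w => (shat_rv U W S k b t w, S b w k t))
             (fun w => (shat_rv U W S k b' t' w, S b' w k t')).
Proof.
have blk b1 t1 : same_law P (fun w => (shat_rv U W S k b1 t1 w, S b1 w k t1))
    (fun w => (shat_rv U W S k 0 t1 w, S 0%N w k t1)).
  pose f (es : E * 'M[C]_(K, taud)) := (shat U k t1 es.1 es.2, es.2 k t1).
  have mf : measurable_fun setT f.
    apply: measurable_fun_pair; first exact: measurable_shat.
    exact: (measurableT_comp (measurable_entry k t1) measurable_snd).
  exact: (same_law_comp mf (block_same_law b1)).
have smp : same_law P (fun w => (shat_rv U W S k 0 t w, S 0%N w k t))
    (fun w => (shat_rv U W S k 0 t' w, S 0%N w k t')).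
  pose f z := (sample_shat U k z, z.1.2 k 0).
  have mf : measurable_fun setT f.
    apply: measurable_fun_pair; first exact: measurable_sample_shat.
    apply: (measurableT_comp (measurable_entry k 0)).
    exact: (measurableT_comp measurable_snd measurable_fst).
  have fE t1 : (fun w => (shat_rv U W S k 0 t1 w, S 0%N w k t1)) =
      (fun w => f (sample_data U W S 0 t1 w, dist_at U t1 (W 0%N w) (S 0%N w))).
    by apply/funext => w; rewrite /f /shat_rv shatE /sample_data/= mxE.
  rewrite !fE; exact: (same_law_comp mf (samples_same_law model 0 t t')).
by move=> A mA; rewrite (blk b t A mA) (smp A mA) (blk b' t' A mA).
Qed.

End uplink_laws.

(** * Gaussian signalling versus an independent random codeword *)

Section codeword_laws.
Context {R : realType} {M K tauc taup : nat} {dE : measure_display}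
  {E : measurableType dE} (U : uplink R M K tauc taup E).
Local Notation C := R[i].
Local Notation taud := (tauc - taup)%N.
Context {d : measure_display} {T : measurableType d} {P : probability T R}.
Variables (W : nat -> {RV P >-> E}) (S : nat -> {RV P >-> 'M[C]_(K, taud)}).
Variables (Rcov : 'I_K -> 'M[C]_M) (sigma2 : R).
Hypothesis model : uplink_model U W S Rcov sigma2.

Let box (A : set E) (F : 'I_K -> 'I_taud -> set C) : set (E * 'M[C]_(K, taud)) :=
  [set x : E * 'M[C]_(K, taud) | A x.1 /\ forall i t, F i t (x.2 i t)].

Lemma measurable_box A F : measurable A -> (forall i t, measurable (F i t)) ->
  measurable (box A F).
Proof.
move=> mA mF; rewrite (_ : box A F = (fst @^-1` A) `&`
   \bigcap_(it in [set: 'I_K * 'I_taud])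
     ((fun x : E * 'M[C]_(K, taud) => x.2 it.1 it.2) @^-1` F it.1 it.2)).
  apply: measurableI.
    by rewrite -[X in measurable X]setTI; exact: measurable_fst.
  apply: fin_bigcap_measurable => [|[i t] _]; first exact: finite_finset.
  rewrite -[X in measurable X]setTI.
  exact: (measurableT_comp (measurable_entry i t) measurable_snd).
apply/seteqP; split => x [Ax Fx]; split => //.
  by move=> [i t] _; exact: Fx.
by move=> i t; exact: (Fx (i, t)).
Qed.

(** All three independence assumptions act in turn: between blocks, between [W] and the symbols of a
    block, and between single symbols. What remains is a product over entries, where sets can be
    regrouped freely. *)
Lemma blocks_box n (A : 'I_n -> set E) (F : 'I_n -> 'I_K -> 'I_taud -> set C) :
  (forall b, measurable (A b)) -> (forall b i t, measurable (F b i t)) ->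
  P [set w | forall b : 'I_n, box (A b) (F b) (W b w, S b w)] =
  (\prod_(b < n) (P (W b @^-1` A b) *
     \prod_(it : 'I_K * 'I_taud) P ((fun w => S b w it.1 it.2) @^-1` F b it.1 it.2)))%E.
Proof.
move=> mA mF.
have mB b : measurable (box (A b) (F b)) by exact: measurable_box.
apply: (etrans (blocks_indep model mB)); apply: eq_bigr => b _.
pose Fb := [set s : 'M[C]_(K, taud) | forall it : 'I_K * 'I_taud, F b it.1 it.2 (s it.1 it.2)].
have mFb : measurable Fb.
  rewrite (_ : Fb = \bigcap_(it in [set: 'I_K * 'I_taud])
     ((fun s : 'M[C]_(K, taud) => s it.1 it.2) @^-1` F b it.1 it.2)).
    apply: fin_bigcap_measurable => [|[i t] _]; first exact: finite_finset.
    by rewrite -[X in measurable X]setTI; exact: measurable_entry.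
  by apply/seteqP; split => s Fs it; [move=> _; exact: Fs|exact: Fs].
rewrite -(symbols_indep model b (A := fun it => F b it.1 it.2))//.
rewrite -(symbols_indep_rest model b (mA b) mFb); congr (P _).
apply/seteqP; split => w [Aw Fw]; split => //.
  by move=> i t; exact: (Fw (i, t)).
Qed.

Variable k : 'I_K.

Definition block_row n (w : T) : 'rV[E * 'M[C]_(K, taud)]_n :=
  \row_(b < n) (W b w, S b w).

(* Row k of the symbols is taken from the first, independent copy of w: this
   is the channel fed with a random codeword. *)
Definition coded_row n (ww : T * T) : 'rV[E * 'M[C]_(K, taud)]_n :=
  \row_(b < n) (W b ww.2, with_codeword k (row k (S b ww.1)) (S b ww.2)).

Lemma measurable_block_row n : measurable_fun setT (block_row n).
Proof.
by apply: measurable_matrix => _ b; exact: measurable_block.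
Qed.

Lemma measurable_coded_row n : measurable_fun setT (coded_row n).
Proof.
apply: measurable_matrix => _ b; apply: measurable_fun_pair.
  exact: (measurableT_comp (measurable_funPT (W b)) measurable_snd).
apply: measurable_with_codeword.
  apply: measurable_row.
  exact: (measurableT_comp (measurable_funPT (S b)) measurable_fst).
exact: (measurableT_comp (measurable_funPT (S b)) measurable_snd).
Qed.

(** The symbols of user k are independent of all else, so taking them from an independent copy
    leaves the joint law unchanged. On boxes both sides are the same product over entries, by
    [blocks_box]. *)
Lemma coded_row_law n (A : set 'rV[E * 'M[C]_(K, taud)]_n) : measurable A ->
  (P \x P)%E (coded_row n @^-1` A) = P (block_row n @^-1` A).
Proof.
pose rect (A : 'I_n -> set E) (F : 'I_n -> 'I_K -> 'I_taud -> set C) :=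
  [set z : 'rV[E * 'M[C]_(K, taud)]_n | forall b, box (A b) (F b) (z 0 b)].
pose G := [set D | exists A F, [/\ forall b, measurable (A b),
  forall b i t, measurable (F b i t) & D = rect A F]].
apply: (@law_unique _ _ _ _ _ _ _ (P \x P)%E P _ _
  (@measurable_coded_row n) (@measurable_block_row n) G).
- move=> _ _ [A1 [F1 [mA1 mF1 ->]]] [A2 [F2 [mA2 mF2 ->]]].
  exists (fun b => A1 b `&` A2 b), (fun b i t => F1 b i t `&` F2 b i t).
  split=> [b|b i t|]; [exact: measurableI|exact: measurableI|].
  apply/seteqP; split => [z [z1 z2] b|z z12].
    have [? z1b] := z1 b; have [? z2b] := z2 b.
    by split.
  by split => b; have [[? ?] zb] := z12 b; split => // i t; case: (zb i t).
- exists (fun=> setT), (fun _ _ _ => setT); split => //.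
  by apply/seteqP; split.
- move=> _ [A1 [F1 [mA1 mF1 ->]]].
  rewrite (_ : rect A1 F1 = \bigcap_(b in [set: 'I_n])
      ((fun z : 'rV[E * 'M[C]_(K, taud)]_n => z 0 b) @^-1` box (A1 b) (F1 b))).
    apply: fin_bigcap_measurable => [|b _]; first exact: finite_finset.
    rewrite -[X in measurable X]setTI; apply: measurable_entry => //.
    exact: measurable_box.
  by apply/seteqP; split => z zb b; [move=> _; exact: zb|exact: zb].
- apply: generated_measurable; apply/measurable_matrixP => r b; rewrite ord1.
  apply/measurable_fun_pairP; split.
    move=> _ Y mY; rewrite setTI; apply: sub_sigma_algebra.
    exists (fun b' => if b' == b then Y else setT), (fun _ _ _ => setT).
    split => // [b'|]; first by case: ifP.
    apply/seteqP; split => [z Yz b'|z /(_ b) []]; last by rewrite eqxx.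
    by split => //; case: eqP => // ->.
  apply/measurable_matrixP => i t _ Y mY; rewrite setTI; apply: sub_sigma_algebra.
  exists (fun=> setT), (fun b' i' t' => if [&& b' == b, i' == i & t' == t] then Y else setT).
  split => // [b' i' t'|]; first by case: ifP.
  apply/seteqP; split => [z Yz b'|z /(_ b) [_ /(_ i t)]]; last by rewrite !eqxx.
  by split => // i' t'; case: ifP => // /and3P[/eqP-> /eqP-> /eqP->].
- move=> _ [A1 [F1 [mA1 mF1 ->]]].
  (* The preimage of a box splits as a rectangle: [F2] keeps the constraints on row k, borne by the
     first copy, and [F3] those on the other rows, borne by the second. *)
  pose F2 b i t := if i == k then F1 b i t else setT.
  pose F3 b i t := if i == k then setT else F1 b i t.
  have mF2 b i t : measurable (F2 b i t) by rewrite /F2; case: ifP.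
  have mF3 b i t : measurable (F3 b i t) by rewrite /F3; case: ifP.
  have -> : coded_row n @^-1` rect A1 F1 =
      [set w | forall b : 'I_n, box setT (F2 b) (W b w, S b w)] `*`
      [set w | forall b : 'I_n, box (A1 b) (F3 b) (W b w, S b w)].
    apply/seteqP; split => [[w' w] /= z|[w' w] /= [z1 z2] b].
      split => b; have := z b; rewrite /coded_row mxE /= => -[/= Aw Fw].
        split => //= i t; rewrite /F2; case: eqP => // ->.
        by have := Fw k t; rewrite !mxE eqxx.
      split => //= i t; rewrite /F3; case: eqP => // /eqP/negbTE ik.
      by have := Fw i t; rewrite !mxE ik.
    have [_ /= Fw'] := z1 b; have [/= Aw Fw] := z2 b.
    rewrite mxE; split => //= i t; rewrite mxE.
    have := Fw' i t; have := Fw i t; rewrite /F2 /F3.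
    by case: eqP => [->|//]; rewrite mxE.
  have mrect A' F : (forall b, measurable (A' b)) -> (forall b i t, measurable (F b i t)) ->
      measurable [set w | forall b : 'I_n, box (A' b) (F b) (W b w, S b w)].
    move=> mA mF; rewrite [X in measurable X](_ : _ = \bigcap_(b in [set: 'I_n])
      ((fun w => (W b w, S b w)) @^-1` box (A' b) (F b))).
      apply: fin_bigcap_measurable => [|b _]; first exact: finite_finset.
      rewrite -[X in measurable X]setTI; apply: measurable_block => //.
      exact: measurable_box.
    by apply/seteqP; split => w wb b; [move=> _; exact: wb|exact: wb].
  have PE (X Y : set T) : measurable X -> measurable Y ->
      (P \x P)%E (X `*` Y) = (P X * P Y)%E by exact: product_measure1E.
  apply: etrans (PE _ _ _ _) _; [exact: mrect|exact: mrect|].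
  rewrite blocks_box// blocks_box//.
  transitivity (P [set w | forall b : 'I_n, box (A1 b) (F1 b) (W b w, S b w)]); last first.
    congr (P _); apply/seteqP; split => w zw b; have := zw b; by rewrite mxE.
  rewrite blocks_box// -big_split/=; apply: eq_bigr => b _.
  rewrite preimage_setT probability_setT mul1e muleCA; congr *%E.
  rewrite -big_split/=; apply: eq_bigr => -[i t] _ /=.
  rewrite /F2 /F3; case: eqP => _; rewrite preimage_setT probability_setT.
    by rewrite mule1.
  by rewrite mul1e.
Qed.

End codeword_laws.

(** * Feinstein's maximal coding argument *)

Section feinstein.
Local Open Scope ereal_scope.
Context {d dC dO} {T : measurableType d} {CW : measurableType dC}
  {O : measurableType dO} {R : realType} (P : probability T R).
Variables (X : T -> CW) (Y : CW -> T -> O) (Yg : T -> O).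
Hypotheses (mX : measurable_fun setT X) (mYg : measurable_fun setT Yg).
Hypothesis mY : measurable_fun setT (fun cw : CW * T => Y cw.1 cw.2).
(** The only link between the channel [Y], which carries a prescribed codeword, and the reference
    output [Yg]. False alarms are measured with the law of [Yg], decoding errors with that of
    [Y c]. *)
Hypothesis law : forall A, measurable A ->
  (P \x P) [set ww | A (X ww.1, Y (X ww.1) ww.2)] = P [set w | A (X w, Yg w)].
Variables (F : set CW) (D : set (CW * O)) (N : nat) (delta eps : R).
Hypotheses (mF : measurable F) (mD : measurable D).
Hypothesis eps01 : (0 < eps <= 1)%R.
Hypothesis FD : forall c, F c -> P [set w | D (c, Yg w)] <= delta%:E.
Hypothesis delta0 : (0 <= delta)%R.
Hypothesis Ndelta : (N%:R * delta <= eps / 3)%R.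
Hypothesis XD : P [set w | ~ (F (X w) /\ D (X w, Yg w))] <= (eps / 3)%:E.

(* [size cs] when no codeword passes. *)
Definition threshold_decode (cs : seq CW) (y : O) : nat := find (fun c => `[< D (c, y) >]) cs.

Let Dc c : set O := [set y | D (c, y)].
Let mDc c : measurable (Dc c).
Proof.
have := measurable_xsection c mD; congr measurable.
by apply/seteqP; split => y; rewrite /xsection /= ?inE.
Qed.

Let preO (B : set O) (f : T -> O) : measurable_fun setT f -> measurable B ->
  measurable (f @^-1` B).
Proof. by move=> mf mB; rewrite -[X in measurable X]setTI; exact: mf. Qed.

Let mYc c : measurable_fun setT (Y c).
Proof.
apply: (measurableT_comp mY (g := fun w => (c, w))).
by apply: measurable_fun_pair; [exact: measurable_cst|exact: measurable_id].
Qed.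

Lemma measurable_threshold_decode cs i : measurable [set y | threshold_decode cs y = i].
Proof.
elim: cs i => [|c cs IH] i.
  rewrite /threshold_decode/=; case: i => [|i].
    by rewrite (_ : [set _ | _] = setT)//; apply/seteqP; split.
  by rewrite (_ : [set _ | _] = set0)//; apply/seteqP; split.
have E : [set y | threshold_decode (c :: cs) y = i] =
   (Dc c `&` [set y | 0%N = i]) `|` (~` Dc c `&` [set y | (threshold_decode cs y).+1 = i]).
  apply/seteqP; split => y; rewrite /threshold_decode/=.
    by case: asboolP => Dy; [left|right].
  by case: asboolP => Dy [[//]|[//]].
rewrite E; apply: measurableU; apply: measurableI => //.
- case: i {E} => [|i].
    by rewrite (_ : [set _ | _] = setT)//; apply/seteqP; split.
  by rewrite (_ : [set _ | _] = set0)//; apply/seteqP; split.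
- exact: measurableC.
- case: i {E} => [|i]; first by rewrite (_ : [set _ | _] = set0)//; apply/seteqP; split.
  rewrite (_ : [set _ | _] = [set y | threshold_decode cs y = i])//.
  by apply/seteqP; split => y /= => [[]|->].
Qed.

Let used cs : set O := [set y | has (fun c => `[< D (c, y) >]) cs].

Let used_cons c cs : used (c :: cs) = Dc c `|` used cs.
Proof.
apply/seteqP; split => y; rewrite /used /=.
  by move=> /orP[/asboolP|]; [left|right].
by case => [/asboolP->//|->]; rewrite orbT.
Qed.

Let mused cs : measurable (used cs).
Proof.
elim: cs => [|c cs IH]; last by rewrite used_cons; exact: measurableU.
by rewrite (_ : used [::] = set0)//; apply/seteqP; split.
Qed.

Let used_prob cs : (forall c, c \in (cs : seq CW) -> F c) ->
  P (Yg @^-1` used cs) <= ((size cs)%:R * delta)%:E.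
Proof.
elim: cs => [_|c cs IH Fcs].
  rewrite mul0r (_ : used [::] = set0) ?preimage_set0 ?measure0//.
  by apply/seteqP; split.
rewrite used_cons preimage_setU.
apply: (le_trans (measureU2 _ (preO mYg (mDc c)) (preO mYg (mused cs)))).
have -> : ((size (c :: cs))%:R * delta = delta + (size cs)%:R * delta)%R.
  by rewrite /= -natr1 mulrDl mul1r addrC.
rewrite EFinD leeD//.
  exact: (FD (Fcs c (mem_head _ _))).
by apply: IH => c' c'cs; apply: Fcs; rewrite inE c'cs orbT.
Qed.

(** If no admissible codeword worked, each would pass outside the outputs already claimed with
    probability at most 1 - eps. Averaging over a random codeword, this event together with [XD] and
    the claimed outputs would have to cover a set of probability 1. *)
Let extend cs : (size cs < N)%N -> (forall c, c \in (cs : seq CW) -> F c) ->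
  exists2 c, F c & P [set w | ~ (D (c, Y c w) /\ ~ used cs (Y c w))] <= eps%:E.
Proof.
move=> szN Fcs; have [eps0 eps1] := andP eps01.
apply: contrapT => noc.
have bad c : F c -> P [set w | D (c, Y c w) /\ ~ used cs (Y c w)] <= (1 - eps)%:E.
  move=> Fc; rewrite leNgt; apply/negP => Pc; apply: noc; exists c => //.
  set B := [set w | D (c, Y c w) /\ ~ used cs (Y c w)] in Pc.
  have mB : measurable B.
    exact: (preO (mYc c) (measurableI _ _ (mDc c) (measurableC (mused cs)))).
  have -> : [set w | ~ (D (c, Y c w) /\ ~ used cs (Y c w))] = ~` B by apply/seteqP; split.
  rewrite probability_setC// leeBlDr; last exact: fin_num_measure.
  rewrite -leeBlDl//.
  by apply: ltW; apply: le_lt_trans Pc; rewrite EFinB.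
pose A := [set cy : CW * O | [/\ F cy.1, D cy & ~ used cs cy.2]].
have mA : measurable A.
  rewrite (_ : A = (fst @^-1` F) `&` D `&` (snd @^-1` (~` used cs))).
    apply: measurableI; first apply: measurableI => //.
      by rewrite -[X in measurable X]setTI; exact: measurable_fst.
    rewrite -[X in measurable X]setTI; apply: measurable_snd => //.
    exact: measurableC.
  by apply/seteqP; split => cy; [move=> [? ? ?]|move=> [[? ?] ?]].
(* [law] rewrites this probability as an average over an independent codeword of the probabilities
   bounded by [bad]; codewords outside [F] contribute 0. *)
have upper : P [set w | A (X w, Yg w)] <= (1 - eps)%:E.
  rewrite -(law mA) /product_measure1.
  have mXY : measurable_fun setT (fun ww : T * T => (X ww.1, Y (X ww.1) ww.2)).
    have mX1 : measurable_fun setT (fun ww : T * T => X ww.1).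
      exact: (measurableT_comp mX measurable_fst).
    apply: measurable_fun_pair => //.
    apply: (measurableT_comp mY (g := fun ww => (X ww.1, ww.2))).
    by apply: measurable_fun_pair => //; exact: measurable_snd.
  have mS : measurable [set ww : T * T | A (X ww.1, Y (X ww.1) ww.2)].
    by have := mXY measurableT _ mA; rewrite setTI.
  apply: (@le_trans _ _ (\int[P]_x (1 - eps)%:E)); last first.
    by rewrite integral_cst//= probability_setT mule1.
  apply: ge0_le_integral => //.
  - exact: (measurable_fun_xsection P mS).
  - move=> w' _ /=.
    have [FX|NFX] := pselect (F (X w')).
      apply: le_trans (bad _ FX); rewrite le_eqVlt; apply/orP; left; apply/eqP.
      congr (P _); apply/seteqP; split => w; rewrite /xsection/= inE.
        by case.
      by move=> [Dw Uw]; split.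
    rewrite (_ : xsection _ _ = set0) ?measure0 ?lee_fin ?subr_ge0//.
    by apply/seteqP; split => w; rewrite /xsection/= ?inE => // -[].
have mP1 : measurable [set w | A (X w, Yg w)].
  by have := measurable_fun_pair mX mYg measurableT mA; rewrite setTI.
have mP2 : measurable [set w | ~ (F (X w) /\ D (X w, Yg w))].
  apply: measurableC; apply: measurableI.
    by rewrite -[X in measurable X]setTI; exact: mX.
  by have := measurable_fun_pair mX mYg measurableT mD; rewrite setTI.
have mP3 := preO mYg (mused cs).
have cover : setT `<=` ([set w | A (X w, Yg w)] `|`
    [set w | ~ (F (X w) /\ D (X w, Yg w))]) `|` (Yg @^-1` used cs).
  move=> w _; have [Uw|Uw] := pselect (used cs (Yg w)); [by right|left].
  by have [[Fw Dw]|] := pselect (F (X w) /\ D (X w, Yg w)); [left|right].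
(* The right-hand side is 1 - eps / 3, below the total mass: this is what the two thirds of eps in
   the hypotheses are for. *)
have : P setT <= (1 - eps)%:E + (eps / 3)%:E + (eps / 3)%:E.
  apply: le_trans (le_measure _ _ _ cover) _; rewrite ?inE//.
    by apply: measurableU => //; exact: measurableU.
  apply: le_trans (measureU2 _ (measurableU _ _ mP1 mP2) mP3) _.
  apply: leeD; last first.
    apply: le_trans (used_prob Fcs) _; rewrite lee_fin.
    by apply: le_trans Ndelta; rewrite ler_wpM2r// ler_nat ltnW.
  by apply: le_trans (measureU2 _ mP1 mP2) _; exact: leeD.
rewrite probability_setT -!EFinD lee_fin; lra.
Qed.

(** New codewords are appended at the end. As [find] returns the first match, outputs decoded to an
    earlier codeword keep that decision, so earlier error events do not grow. *)
Lemma feinstein j : (j <= N)%N -> exists cs : seq CW,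
  [/\ size cs = j, forall c, c \in cs -> F c &
   forall c0 i, (i < j)%N ->
     P [set w | threshold_decode cs (Y (nth c0 cs i) w) <> i] <= eps%:E].
Proof.
elim: j => [_|j IH jN]; first by exists [::].
have [cs [szcs Fcs Pcs]] := IH (ltnW jN).
have [c Fc Pc] : exists2 c, F c &
  P [set w | ~ (D (c, Y c w) /\ ~ used cs (Y c w))] <= eps%:E.
  by apply: extend => //; rewrite szcs.
exists (rcons cs c); split; first by rewrite size_rcons szcs.
  by move=> c'; rewrite mem_rcons inE => /orP[/eqP->//|]; exact: Fcs.
have mdec cs' i (f : T -> O) : measurable_fun setT f -> measurable [set w | threshold_decode cs' (f w) <> i].
  move=> mf; have := preO mf (measurableC (measurable_threshold_decode cs' i)).
  by congr measurable; apply/seteqP; split.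
move=> c0 i; rewrite ltnS leq_eqVlt nth_rcons szcs => /predU1P[->|ij].
  rewrite ltnn eqxx; apply: le_trans Pc; apply: le_measure; rewrite ?inE//.
  - exact: mdec.
  - apply: (preO (mYc c) (measurableC (measurableI _ _ (mDc c) (measurableC (mused cs))))).
  - move=> w /= dj [Dw /negP Uw]; apply: dj.
    by rewrite /threshold_decode -cats1 find_cat (negbTE Uw)/= asboolT// addn0.
rewrite ij; apply: le_trans (Pcs c0 i ij); apply: le_measure; rewrite ?inE//.
- exact: mdec.
- exact: mdec.
- move=> w /= dj di; apply: dj; move: di; rewrite /threshold_decode -cats1 find_cat.
  by case: ifPn => // /hasNfind ->; rewrite szcs => /eqP; rewrite gtn_eqF.
Qed.

End feinstein.

(** * Second-moment calculus for complex random variables *)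

Section complex_L2.
Context {d} {T : measurableType d} {R : realType} (P : probability T R).
Local Notation C := R[i].
Implicit Types X Y Z : T -> C.

Definition cintegrable X :=
  P.-integrable setT (EFin \o (fun w => complex.Re (X w))) /\
  P.-integrable setT (EFin \o (fun w => complex.Im (X w))).

Lemma cexp_ReE X : complex.Re (cexp P X) = fine (\int[P]_w (complex.Re (X w))%:E).
Proof. by rewrite /cexp/= unlock. Qed.

Lemma cexp_ImE X : complex.Im (cexp P X) = fine (\int[P]_w (complex.Im (X w))%:E).
Proof. by rewrite /cexp/= unlock. Qed.

Lemma moment2E X : moment2 P X = (\int[P]_w (Normc.normc (X w) ^+ 2)%:E)%E.
Proof. by rewrite /moment2 unlock. Qed.

Lemma complex_eqP (x y : C) :
  complex.Re x = complex.Re y -> complex.Im x = complex.Im y -> x = y.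
Proof. by case: x => a b; case: y => a' b' /= -> ->. Qed.

Lemma conj_add (x y : C) : (x + y)^*%R = x^*%R + y^*%R.
Proof. exact: rmorphD. Qed.

Lemma conj_sub (x y : C) : (x - y)^*%R = x^*%R - y^*%R.
Proof. exact: rmorphB. Qed.

Lemma conj_mul (x y : C) : (x * y)^*%R = x^*%R * y^*%R.
Proof. exact: rmorphM. Qed.

Lemma fine_integralD (f g : T -> R) :
  P.-integrable setT (EFin \o f) -> P.-integrable setT (EFin \o g) ->
  fine (\int[P]_w (f w + g w)%:E) =
  fine (\int[P]_w (f w)%:E) + fine (\int[P]_w (g w)%:E).
Proof.
move=> fi gi; under eq_integral do rewrite EFinD.
by rewrite integralD// fineD//; exact: integrable_fin_num.
Qed.

Lemma fine_integralZ (c : R) (f : T -> R) :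
  P.-integrable setT (EFin \o f) ->
  fine (\int[P]_w (c * f w)%:E) = c * fine (\int[P]_w (f w)%:E).
Proof.
move=> fi; under eq_integral do rewrite EFinM.
by rewrite integralZl// fineM//; exact: integrable_fin_num.
Qed.

Lemma integrableD_real (f g : T -> R) :
  P.-integrable setT (EFin \o f) -> P.-integrable setT (EFin \o g) ->
  P.-integrable setT (EFin \o (fun w => f w + g w)).
Proof. by move=> fi gi; exact: (integrableD measurableT fi gi). Qed.

Lemma integrableZ_real (c : R) (f : T -> R) :
  P.-integrable setT (EFin \o f) ->
  P.-integrable setT (EFin \o (fun w => c * f w)).
Proof. by move=> fi; exact: (integrableZl measurableT c fi). Qed.

Lemma cintegrableD X Y : cintegrable X -> cintegrable Y ->
  cintegrable (fun w => X w + Y w).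
Proof.
move=> [X1 X2] [Y1 Y2]; split.
- have -> : (fun w => complex.Re (X w + Y w)) = (fun w => complex.Re (X w) + complex.Re (Y w)).
    by apply/funext => w; case: (X w); case: (Y w).
  exact: integrableD_real.
- have -> : (fun w => complex.Im (X w + Y w)) = (fun w => complex.Im (X w) + complex.Im (Y w)).
    by apply/funext => w; case: (X w); case: (Y w).
  exact: integrableD_real.
Qed.

Lemma cexpD X Y : cintegrable X -> cintegrable Y ->
  cexp P (fun w => X w + Y w) = cexp P X + cexp P Y.
Proof.
move=> [X1 X2] [Y1 Y2]; apply: complex_eqP.
- transitivity (complex.Re (cexp P X) + complex.Re (cexp P Y)); last by case: cexp; case: cexp.
  rewrite !cexp_ReE -fine_integralD//; congr fine; apply: eq_integral => w _.
  by case: (X w); case: (Y w).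
- transitivity (complex.Im (cexp P X) + complex.Im (cexp P Y)); last by case: cexp; case: cexp.
  rewrite !cexp_ImE -fine_integralD//; congr fine; apply: eq_integral => w _.
  by case: (X w); case: (Y w).
Qed.

Lemma cintegrableZ (c : C) X : cintegrable X -> cintegrable (fun w => c * X w).
Proof.
move=> [X1 X2]; case: c => a b; split.
- have -> : (fun w => complex.Re ((a +i* b) * X w)) =
     (fun w => a * complex.Re (X w) + (- b) * complex.Im (X w)).
    by apply/funext => w; case: (X w) => x y /=; rewrite mulNr.
  by apply: integrableD_real; exact: integrableZ_real.
- have -> : (fun w => complex.Im ((a +i* b) * X w)) =
     (fun w => a * complex.Im (X w) + b * complex.Re (X w)).
    by apply/funext => w; case: (X w).
  by apply: integrableD_real; exact: integrableZ_real.
Qed.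

Lemma cexpZ (c : C) X : cintegrable X -> cexp P (fun w => c * X w) = c * cexp P X.
Proof.
move=> [X1 X2]; case: c => a b; apply: complex_eqP.
- transitivity (a * complex.Re (cexp P X) + (- b) * complex.Im (cexp P X)); last first.
    by case: cexp => x y /=; rewrite mulNr.
  rewrite !cexp_ReE cexp_ImE -!fine_integralZ// -fine_integralD; [|exact: integrableZ_real..].
  by congr fine; apply: eq_integral => w _; case: (X w) => x y /=; rewrite mulNr.
- transitivity (a * complex.Im (cexp P X) + b * complex.Re (cexp P X)); last by case: cexp.
  rewrite cexp_ReE !cexp_ImE -!fine_integralZ// -fine_integralD; [|exact: integrableZ_real..].
  by congr fine; apply: eq_integral => w _; case: (X w).
Qed.

Lemma cintegrable_cst (c : C) : cintegrable (fun=> c).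
Proof. by split; apply: finite_measure_integrable_cst. Qed.

Lemma cexp_cst (c : C) : cexp P (fun=> c) = c.
Proof.
apply: complex_eqP.
- by rewrite cexp_ReE integral_cst//= probability_setT mule1.
- by rewrite cexp_ImE integral_cst//= probability_setT mule1.
Qed.

Lemma cintegrableN X : cintegrable X -> cintegrable (fun w => - X w).
Proof.
by move=> /(cintegrableZ (-1)); congr cintegrable; apply/funext => w; rewrite mulN1r.
Qed.

Lemma cexpN X : cintegrable X -> cexp P (fun w => - X w) = - cexp P X.
Proof.
move=> /(cexpZ (-1)); rewrite mulN1r => <-; congr cexp.
by apply/funext => w; rewrite mulN1r.
Qed.

Lemma cexpB X Y : cintegrable X -> cintegrable Y ->
  cexp P (fun w => X w - Y w) = cexp P X - cexp P Y.
Proof. by move=> iX iY; rewrite cexpD ?cexpN//; exact: cintegrableN. Qed.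

Lemma cintegrable_sum (I : Type) (s : seq I) (F : I -> T -> C) :
  (forall i, cintegrable (F i)) -> cintegrable (fun w => \sum_(i <- s) F i w).
Proof.
move=> iF; elim: s => [|i s IH].
  by under eq_fun do rewrite big_nil; exact: cintegrable_cst.
by under eq_fun do rewrite big_cons; exact: cintegrableD.
Qed.

Lemma cexp_sum (I : Type) (s : seq I) (F : I -> T -> C) :
  (forall i, cintegrable (F i)) ->
  cexp P (fun w => \sum_(i <- s) F i w) = \sum_(i <- s) cexp P (F i).
Proof.
move=> iF; elim: s => [|i s IH].
  by under eq_fun do rewrite big_nil; rewrite cexp_cst big_nil.
under eq_fun do rewrite big_cons.
by rewrite cexpD// ?IH ?big_cons//; exact: cintegrable_sum.
Qed.

Lemma cexp_conj X : cintegrable X -> cexp P (fun w => (X w)^*%R) = (cexp P X)^*%R.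
Proof.
move=> [X1 X2]; apply: complex_eqP.
- transitivity (complex.Re (cexp P X)); last by case: cexp.
  by rewrite !cexp_ReE; congr fine; apply: eq_integral => w _; case: (X w).
- transitivity (- complex.Im (cexp P X)); last by case: cexp.
  rewrite !cexp_ImE -mulN1r -fine_integralZ//; congr fine.
  by apply: eq_integral => w _; rewrite mulN1r; case: (X w).
Qed.

Definition L2 X := measurable_fun setT X /\ (moment2 P X < +oo)%E.

(** Both parts of the product are dominated by |X|^2 + |Y|^2; Cauchy-Schwarz is avoided. *)
Lemma L2_cintegrableM X Y : L2 X -> L2 Y -> cintegrable (fun w => X w * (Y w)^*%R).
Proof.
move=> [mX X2] [mY Y2].
have mXY := measurable_complexM mX (measurable_conj mY).
have [mr mi] : measurable_fun setT (fun w => complex.Re (X w * (Y w)^*%R)) /\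
    measurable_fun setT (fun w => complex.Im (X w * (Y w)^*%R)).
  exact/measurable_complexP.
pose g w := Normc.normc (X w) ^+ 2 + Normc.normc (Y w) ^+ 2.
have mg : measurable_fun setT g.
  by apply: measurable_funD; exact: measurable_normc_sqr.
have ig : P.-integrable setT (EFin \o g).
  apply/integrableP; split; first exact/measurable_EFinP.
  under eq_integral do rewrite /= ger0_norm ?addr_ge0 ?sqr_ge0// EFinD.
  rewrite ge0_integralD//; first last.
  - by apply/measurable_EFinP; exact: measurable_normc_sqr.
  - by move=> w _; rewrite lee_fin sqr_ge0.
  - by apply/measurable_EFinP; exact: measurable_normc_sqr.
  - by move=> w _; rewrite lee_fin sqr_ge0.
  by rewrite -!moment2E lte_add_pinfty.
have bound (x1 x2 y1 y2 : R) : `|x1 * y1 + x2 * y2| <= x1 ^+ 2 + x2 ^+ 2 + (y1 ^+ 2 + y2 ^+ 2).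
  rewrite ler_norml.
  have := sqr_ge0 (x1 + y1); have := sqr_ge0 (x1 - y1).
  have := sqr_ge0 (x2 + y2); have := sqr_ge0 (x2 - y2).
  have := sqr_ge0 x1; have := sqr_ge0 x2; have := sqr_ge0 y1; have := sqr_ge0 y2.
  by move=> *; apply/andP; split; lra.
split; apply: le_integrable ig => //; try exact/measurable_EFinP.
- move=> w _; rewrite lee_fin [leRHS]ger0_norm ?addr_ge0 ?sqr_ge0// /g !normc_sqr.
  case: (X w) => x1 x2; case: (Y w) => y1 y2 /=.
  by rewrite mulrN opprK; exact: bound.
- move=> w _; rewrite lee_fin [leRHS]ger0_norm ?addr_ge0 ?sqr_ge0// /g !normc_sqr.
  case: (X w) => x1 x2; case: (Y w) => y1 y2 /=.
  by rewrite mulrN -mulNr [y1 ^+ 2 + _]addrC -[x1 ^+ 2]sqrrN; exact: bound.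
Qed.

Lemma L2D X Y : L2 X -> L2 Y -> L2 (fun w => X w + Y w).
Proof.
move=> [mX X2] [mY Y2]; split; first exact: measurable_complexD.
rewrite moment2E; apply: (@le_lt_trans _ _ (\int[P]_w
    ((2 : R)%:E * (Normc.normc (X w) ^+ 2)%:E + (2 : R)%:E * (Normc.normc (Y w) ^+ 2)%:E))%E).
  apply: ge0_le_integral => //.
  - by move=> w _; rewrite lee_fin sqr_ge0.
  - by apply/measurable_EFinP; apply/measurable_normc_sqr; exact: measurable_complexD.
  - apply: emeasurable_funD; apply: emeasurable_funM; try exact: measurable_cst.
      by apply/measurable_EFinP; exact: measurable_normc_sqr.
    by apply/measurable_EFinP; exact: measurable_normc_sqr.
  - move=> w _; rewrite -!EFinM -EFinD lee_fin !normc_sqr.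
    case: (X w) => x1 x2; case: (Y w) => y1 y2 /=.
    by have := sqr_ge0 (x1 - y1); have := sqr_ge0 (x2 - y2); lra.
have mXE : measurable_fun setT (fun w => (Normc.normc (X w) ^+ 2)%:E).
  by apply/measurable_EFinP; exact: measurable_normc_sqr.
have mYE : measurable_fun setT (fun w => (Normc.normc (Y w) ^+ 2)%:E).
  by apply/measurable_EFinP; exact: measurable_normc_sqr.
have X0 w : setT w -> (0 <= (Normc.normc (X w) ^+ 2)%:E)%E by rewrite lee_fin sqr_ge0.
have Y0 w : setT w -> (0 <= (Normc.normc (Y w) ^+ 2)%:E)%E by rewrite lee_fin sqr_ge0.
rewrite ge0_integralD//; first last.
- by apply: emeasurable_funM => //; exact: measurable_cst.
- by move=> w Tw; rewrite mule_ge0// Y0.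
- by apply: emeasurable_funM => //; exact: measurable_cst.
- by move=> w Tw; rewrite mule_ge0// X0.
have two0 : (0 <= (2 : R)%:E)%E by rewrite lee_fin.
rewrite (ge0_integralZl P measurableT mXE X0 two0) (ge0_integralZl P measurableT mYE Y0 two0).
by rewrite -!moment2E lte_add_pinfty// lte_mul_pinfty.
Qed.

Lemma normc_sqrM (x y : C) : Normc.normc (x * y) ^+ 2 = Normc.normc x ^+ 2 * Normc.normc y ^+ 2.
Proof. by rewrite !normc_sqr; case: x => a b; case: y => a' b' /=; ring. Qed.

Lemma moment2Z (c : C) X : measurable_fun setT X ->
  moment2 P (fun w => c * X w) = ((Normc.normc c ^+ 2)%:E * moment2 P X)%E.
Proof.
move=> mX; rewrite !moment2E; under eq_integral do rewrite normc_sqrM EFinM.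
rewrite ge0_integralZl ?lee_fin ?sqr_ge0//.
- by apply/measurable_EFinP; exact: measurable_normc_sqr.
- by move=> w _; rewrite lee_fin sqr_ge0.
Qed.

Lemma L2Z (c : C) X : L2 X -> L2 (fun w => c * X w).
Proof.
move=> [mX X2]; split; first by apply: measurable_complexM => //; exact: measurable_cst.
by rewrite moment2Z// lte_mul_pinfty// lee_fin sqr_ge0.
Qed.

Lemma L2N X : L2 X -> L2 (fun w => - X w).
Proof.
by move=> /(L2Z (-1)); congr L2; apply/funext => w; rewrite mulN1r.
Qed.

Lemma L2B X Y : L2 X -> L2 Y -> L2 (fun w => X w - Y w).
Proof. by move=> X2 Y2; apply: L2D => //; exact: L2N. Qed.

Lemma L2_cst (c : C) : L2 (fun=> c).
Proof.
split; first exact: measurable_cst.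
by rewrite moment2E integral_cst//= probability_setT mule1 ltry.
Qed.

Lemma L2_sum (I : Type) (s : seq I) (F : I -> T -> C) :
  (forall i, L2 (F i)) -> L2 (fun w => \sum_(i <- s) F i w).
Proof.
move=> LF; elim: s => [|i s IH].
  by under eq_fun do rewrite big_nil; exact: L2_cst.
by under eq_fun do rewrite big_cons; exact: L2D.
Qed.

Lemma L2_cintegrable X : L2 X -> cintegrable X.
Proof.
move=> X2; have := L2_cintegrableM X2 (L2_cst 1); congr cintegrable.
by apply/funext => w; rewrite rmorph1 mulr1.
Qed.

(** The Hermitian product of L2, linear in the first argument, so that [corr] is by definition the
    product of shat with the symbol. *)
Definition inner X Y : C := cexp P (fun w => X w * (Y w)^*%R).

Lemma innerDl X Y Z : L2 X -> L2 Y -> L2 Z ->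
  inner (fun w => X w + Y w) Z = inner X Z + inner Y Z.
Proof.
move=> X2 Y2 Z2; rewrite /inner -cexpD; [|exact: L2_cintegrableM..].
by congr cexp; apply/funext => w; rewrite mulrDl.
Qed.

Lemma inner_conj X Y : L2 X -> L2 Y -> inner Y X = (inner X Y)^*%R.
Proof.
move=> X2 Y2; rewrite /inner -cexp_conj; last exact: L2_cintegrableM.
congr cexp; apply/funext => w; case: (X w) => x1 x2; case: (Y w) => y1 y2.
by apply: complex_eqP => /=; ring.
Qed.

Lemma innerDr X Y Z : L2 X -> L2 Y -> L2 Z ->
  inner Z (fun w => X w + Y w) = inner Z X + inner Z Y.
Proof.
move=> X2 Y2 Z2; rewrite inner_conj; [|exact: L2D|by []].
by rewrite innerDl// conj_add (inner_conj X2 Z2) (inner_conj Y2 Z2).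
Qed.

Lemma innerZl (c : C) X Y : L2 X -> L2 Y -> inner (fun w => c * X w) Y = c * inner X Y.
Proof.
move=> X2 Y2; rewrite /inner -cexpZ; last exact: L2_cintegrableM.
by congr cexp; apply/funext => w; rewrite mulrA.
Qed.

Lemma innerZr (c : C) X Y : L2 X -> L2 Y -> inner X (fun w => c * Y w) = c^*%R * inner X Y.
Proof.
move=> X2 Y2; rewrite inner_conj; [|exact: L2Z|by []].
by rewrite innerZl// conj_mul (inner_conj Y2 X2).
Qed.

Lemma innerBl X Y Z : L2 X -> L2 Y -> L2 Z ->
  inner (fun w => X w - Y w) Z = inner X Z - inner Y Z.
Proof.
move=> X2 Y2 Z2; rewrite innerDl//; last exact: L2N.
have -> : (fun w => - Y w) = (fun w => (-1) * Y w) by apply/funext => w; rewrite mulN1r.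
by rewrite innerZl// mulN1r.
Qed.

Lemma innerBr X Y Z : L2 X -> L2 Y -> L2 Z ->
  inner Z (fun w => X w - Y w) = inner Z X - inner Z Y.
Proof.
move=> X2 Y2 Z2; rewrite inner_conj; [|exact: L2B|by []].
by rewrite innerBl// conj_sub (inner_conj X2 Z2) (inner_conj Y2 Z2).
Qed.

Lemma inner_self X : L2 X -> inner X X = (fine (moment2 P X))%:C.
Proof.
move=> [mX X2]; apply: complex_eqP.
- rewrite cexp_ReE moment2E /=; congr fine; apply: eq_integral => w _; congr EFin.
  by rewrite normc_sqr; case: (X w) => a b /=; ring.
- rewrite cexp_ImE /=; transitivity (fine (\int[P]_w (0 : R)%:E)%E).
    congr fine; apply: eq_integral => w _; congr EFin.
    by case: (X w) => a b /=; ring.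
  by rewrite integral0.
Qed.

Lemma inner_cst1 X : L2 X -> inner X (fun=> 1) = cexp P X.
Proof. by move=> X2; congr cexp; apply/funext => w; rewrite rmorph1 mulr1. Qed.

End complex_L2.

(** * Information density and coding *)

Section information_density.
Context {R : realType}.
Local Notation C := R[i].
Variables (a mu : C) (V : R).
Hypothesis V0 : 0 < V.

Let G : R := Normc.normc a ^+ 2.
Let G0 : 0 <= G. Proof. exact: sqr_ge0. Qed.

(* log-likelihood ratio of the Gaussian laws CN(a s + mu, V) and
   CN(mu, |a|^2 + V) at y; the actual law of y need not be Gaussian. *)
Definition info_density (s y : C) : R :=
  ln (1 + Normc.normc a ^+ 2 / V) - Normc.normc (y - mu - a * s) ^+ 2 / V
  + Normc.normc (y - mu) ^+ 2 / (Normc.normc a ^+ 2 + V).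

Lemma measurable_info_density d (T : measurableType d) (s y : T -> C) :
  measurable_fun setT s -> measurable_fun setT y ->
  measurable_fun setT (fun w => info_density (s w) (y w)).
Proof.
move=> ms my; apply: measurable_funD.
  apply: measurable_funB; first exact: measurable_cst.
  apply: measurable_funM; last exact: measurable_cst.
  apply: measurable_normc_sqr; apply: measurable_complexB.
    by apply: measurable_complexB => //; exact: measurable_cst.
  by apply: measurable_complexM => //; exact: measurable_cst.
apply: measurable_funM; last exact: measurable_cst.
by apply: measurable_normc_sqr; apply: measurable_complexB => //; exact: measurable_cst.
Qed.

(** The exponential is the ratio of the density of CN(a s + mu, V) to that of CN(mu, |a|^2 + V) at
    [y]; averaging the numerator over a standard Gaussian s gives the denominator. *)
Lemma info_density_exp d (T : measurableType d) (P : probability T R) (X : T -> C)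
    (y : C) : measurable_fun setT X -> std_cnormal P X ->
  (\int[P]_w (expR (info_density (X w) y))%:E = 1)%E.
Proof.
move=> mX sX; pose u := y - mu.
have GV0 : 0 < G + V by rewrite ltr_wpDl.
have GV1 : 0 < 1 + G / V by rewrite ltr_pwDl// divr_ge0// ltW.
(* Expanding |u - a s|^2 in s: [c] collects the terms free of s, [z] is half the coefficient of the
   linear term, and G / V multiplies |s|^2. This is the integrand of [std_cnormal_exp]. *)
pose c := expR (ln (1 + G / V) + Normc.normc u ^+ 2 / (G + V) - Normc.normc u ^+ 2 / V).
pose z := (V^-1)%:C * (u^*%R * a).
transitivity (\int[P]_w (c%:E * (expR (2 * complex.Re (z * X w) - (G / V) * Normc.normc (X w) ^+ 2))%:E))%E.
  apply: eq_integral => w _; rewrite -EFinM -expRD; congr (expR _)%:E.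
  rewrite /info_density -/u /z /G !normc_sqr.
  case: {+}u => u1 u2; case: (X w) => x1 x2; case: {+}a => a1 a2 /=.
  have Vn0 : V != 0 by rewrite gt_eqF.
  have GVn0 : a1 ^+ 2 + a2 ^+ 2 + V != 0.
    by rewrite gt_eqF// ltr_wpDl// addr_ge0 ?sqr_ge0.
  by field; rewrite Vn0 GVn0.
have c0 : (0 <= c%:E)%E by rewrite lee_fin expR_ge0.
have := std_cnormal_exp mX sX z GV1.
set I := (\int[P]_w _)%E => IE.
have mexp : measurable_fun setT (fun w =>
    (expR (2 * complex.Re (z * X w) - G / V * Normc.normc (X w) ^+ 2))%:E).
  apply/measurable_EFinP; apply: (measurableT_comp (@measurable_expR R)).
  apply: measurable_funB.
    apply: measurable_funM; first exact: measurable_cst.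
    suff /measurable_complexP[] : measurable_fun setT (fun w => z * X w) by [].
    by apply: measurable_complexM => //; exact: measurable_cst.
  by apply: measurable_funM; [exact: measurable_cst|exact: measurable_normc_sqr].
have exp0 w : setT w -> (0 <= (expR (2 * complex.Re (z * X w) - G / V * Normc.normc (X w) ^+ 2))%:E)%E.
  by rewrite lee_fin expR_ge0.
rewrite (ge0_integralZl P measurableT mexp exp0 c0) -/I IE -EFinM; congr EFin.
have -> : c = (1 + G / V) * expR (Normc.normc u ^+ 2 / (G + V) - Normc.normc u ^+ 2 / V).
  by rewrite /c -addrA expRD lnK.
rewrite mulrACA divff ?gt_eqF// mul1r -expRD -[RHS]expR0; congr expR.
have -> : Normc.normc z ^+ 2 = Normc.normc u ^+ 2 * G / V ^+ 2.
  rewrite /z /G !normc_sqr; case: {+}u => u1 u2; case: {+}a => a1 a2 /=.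
  by field; rewrite gt_eqF.
by field; rewrite !gt_eqF//= addrC.
Qed.

End information_density.

Section complex_laws.
Context {d} {T : measurableType d} {R : realType} (P : probability T R).
Local Notation C := R[i].

Lemma same_law_cexp dE (E : measurableType dE) (X Y : T -> E) (f : E -> C) :
  measurable_fun setT X -> measurable_fun setT Y -> measurable_fun setT f ->
  same_law P X Y -> cexp P (fun w => f (X w)) = cexp P (fun w => f (Y w)).
Proof.
move=> mX mY /measurable_complexP[mr mi] XY; apply: complex_eqP.
- rewrite !cexp_ReE; congr fine.
  exact: (same_law_integral_signed (f := fun x => complex.Re (f x)) mX mY mr XY).
- rewrite !cexp_ImE; congr fine.
  exact: (same_law_integral_signed (f := fun x => complex.Im (f x)) mX mY mi XY).
Qed.

Lemma eq_opp_complex (x : C) : x = - x -> x = 0.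
Proof. by move=> /eqP; rewrite -addr_eq0 -mulr2n mulrn_eq0/= => /eqP. Qed.

Lemma std_cnormal_L2 (X : T -> C) : measurable_fun setT X -> std_cnormal P X -> L2 P X.
Proof. by move=> mX sX; split=> //; rewrite moment2E std_cnormal_moment2// ltry. Qed.

Lemma std_cnormal_mean (X : T -> C) : measurable_fun setT X -> std_cnormal P X ->
  cexp P X = 0.
Proof.
move=> mX sX; apply: eq_opp_complex.
rewrite -cexpN; last exact/L2_cintegrable/std_cnormal_L2.
apply/esym; apply: (same_law_cexp (f := id)) => //; first exact: measurable_complexN.
exact: std_cnormal_opp.
Qed.

Lemma inner_std_cnormal (X : T -> C) : measurable_fun setT X -> std_cnormal P X ->
  inner P X X = 1.
Proof.
move=> mX sX; rewrite inner_self; last exact: std_cnormal_L2.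
by rewrite moment2E std_cnormal_moment2.
Qed.

Lemma normc_sqrE (z : C) : (Normc.normc z ^+ 2)%:C = z * z^*%R.
Proof. by rewrite normc_sqr; case: z => x y; apply: complex_eqP => /=; ring. Qed.

Lemma inner_cstl (c : C) (X : T -> C) : L2 P X -> inner P (fun=> c) X = c * (cexp P X)^*%R.
Proof.
move=> X2; rewrite -cexp_conj; last exact: L2_cintegrable.
rewrite -cexpZ //; have := L2_cintegrableM (L2_cst P 1) X2; congr cintegrable.
by apply/funext => w; rewrite mul1r.
Qed.

Lemma moment2_fineK (X : T -> C) : L2 P X ->
  (\int[P]_w (Normc.normc (X w) ^+ 2)%:E = (fine (moment2 P X))%:E)%E.
Proof.
move=> [mX X2]; rewrite moment2E fineK// ge0_fin_numE -?moment2E//.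
by rewrite moment2E; apply: integral_ge0 => w _; rewrite lee_fin sqr_ge0.
Qed.

Lemma moment2_integrable (X : T -> C) : L2 P X ->
  P.-integrable setT (EFin \o (fun w => Normc.normc (X w) ^+ 2)).
Proof.
move=> [mX X2]; apply/integrableP; split.
  by apply/measurable_EFinP; exact: measurable_normc_sqr.
by under eq_integral do rewrite /= ger0_norm ?sqr_ge0//; rewrite -moment2E.
Qed.

Variables (X Y : T -> C).
Hypotheses (mX : measurable_fun setT X) (sX : std_cnormal P X) (Y2 : L2 P Y).
Let a := inner P Y X.
Let mu := cexp P (fun w => Y w - a * X w).
Let V := cvar P (fun w => Y w - a * X w).
Let X2 : L2 P X. Proof. exact: std_cnormal_L2. Qed.
Let aX2 : L2 P (fun w => a * X w). Proof. exact: L2Z. Qed.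
Let e w := Y w - a * X w - mu.
Let e2 : L2 P e. Proof. by apply: L2B; [exact: L2B|exact: L2_cst]. Qed.

Let inner_eX : inner P e X = 0.
Proof.
rewrite innerBl//; [|exact: L2B|exact: L2_cst].
rewrite innerBl// innerZl// inner_std_cnormal// mulr1 subrr inner_cstl//.
by rewrite std_cnormal_mean// conjC0 mulr0 subr0.
Qed.

(** Pythagoras: Y - mu = a X + e, where e is orthogonal to X because a is the projection coefficient
    and X has unit power and zero mean. *)
Lemma moment2_centered_output :
  fine (moment2 P (fun w => Y w - mu)) = Normc.normc a ^+ 2 + V.
Proof.
have YE : (fun w => Y w - mu) = (fun w => a * X w + e w).
  by apply/funext => w; rewrite /e; ring.
have aXe : L2 P (fun w => a * X w + e w) by exact: L2D.
have inner_Xe : inner P X e = 0 by rewrite (inner_conj e2 X2) inner_eX conjC0.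
suff self : (fine (moment2 P (fun w => Y w - mu)))%:C = (Normc.normc a ^+ 2 + V)%:C.
  exact: (congr1 (@complex.Re R) self).
rewrite YE -inner_self// (innerDl aX2 e2 aXe) (innerDr aX2 e2 aX2) (innerDr aX2 e2 e2).
rewrite (inner_self e2) (innerZl a X2 aX2) (innerZl a X2 e2) (innerZr a X2 X2).
rewrite inner_Xe (innerZr a e2 X2) inner_eX.
rewrite inner_std_cnormal// !mulr0 addr0 add0r mulr1 -normc_sqrE.
by apply: complex_eqP => //=; rewrite addr0.
Qed.

(** The two quadratic terms of the density have means V / V and (|a|^2 + V) / (|a|^2 + V), which
    cancel and leave the logarithm. Of the law of [Y] only second moments enter. *)
Lemma info_density_mean : V != 0 ->
  [/\ 0 < V, P.-integrable setT (EFin \o (fun w => info_density a mu V (X w) (Y w))) &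
   (\int[P]_w (info_density a mu V (X w) (Y w))%:E =
     (ln (1 + Normc.normc a ^+ 2 / V))%:E)%E].
Proof.
move=> Vn0; have V0 : 0 < V.
  rewrite lt_neqAle eq_sym Vn0/=; apply: fine_ge0; rewrite moment2E.
  by apply: integral_ge0 => w _; rewrite lee_fin sqr_ge0.
have GV0 : 0 < Normc.normc a ^+ 2 + V by rewrite ltr_wpDl ?sqr_ge0.
have Ymu2 : L2 P (fun w => Y w - mu) by apply: L2B => //; exact: L2_cst.
have ecomm w : e w = Y w - mu - a * X w by rewrite /e addrAC.
have ie := moment2_integrable e2.
have iYmu := moment2_integrable Ymu2.
pose lam := ln (1 + Normc.normc a ^+ 2 / V).
have dE w : info_density a mu V (X w) (Y w) = lam +
    (- V^-1 * Normc.normc (e w) ^+ 2 + (Normc.normc a ^+ 2 + V)^-1 * Normc.normc (Y w - mu) ^+ 2).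
  by rewrite /info_density -ecomm -/lam mulNr [V^-1 * _]mulrC [_^-1 * _]mulrC addrA.
have ilam : P.-integrable setT (EFin \o (fun=> lam)).
  exact: finite_measure_integrable_cst.
have i12 : P.-integrable setT (EFin \o (fun w => - V^-1 * Normc.normc (e w) ^+ 2 +
    (Normc.normc a ^+ 2 + V)^-1 * Normc.normc (Y w - mu) ^+ 2)).
  by apply: integrableD_real; exact: integrableZ_real.
have id : P.-integrable setT (EFin \o (fun w => info_density a mu V (X w) (Y w))).
  by under eq_fun do rewrite dE; exact: integrableD_real.
split=> //.
rewrite -[LHS]fineK; last exact: integrable_fin_num id.
congr EFin; under eq_integral do rewrite dE.
rewrite (fine_integralD ilam i12).
rewrite (fine_integralD (integrableZ_real _ ie) (integrableZ_real _ iYmu)).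
rewrite (fine_integralZ _ ie) (fine_integralZ _ iYmu).
rewrite integral_cst//= probability_setT mule1/= moment2_fineK//= moment2_fineK//=.
rewrite moment2_centered_output.
have -> : fine (moment2 P e) = V by [].
by rewrite mulNr mulVf// mulVf ?gt_eqF// addNr addr0.
Qed.

End complex_laws.

(** * Codes over blocks, with a slack in the power *)

Section block_coding.
Context {R : realType} {M K tauc taup : nat} {dE : measure_display}
  {E : measurableType dE} (U : uplink R M K tauc taup E).
Local Notation C := R[i].
Local Notation taud := (tauc - taup)%N.
Context {d : measure_display} {T : measurableType d} {P : probability T R}.
Variables (W : nat -> {RV P >-> E}) (S : nat -> {RV P >-> 'M[C]_(K, taud)}).
Variables (Rcov : 'I_K -> 'M[C]_M) (sigma2 : R).
Hypothesis model : uplink_model U W S Rcov sigma2.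
Variables (k : 'I_K) (b0 : nat) (t0 : 'I_taud).
Hypothesis shat_moment2 : (moment2 P (shat_rv U W S k b0 t0) < +oo)%E.
Hypothesis err_var_neq0 : err_var U W S k b0 t0 != 0.

Let a := corr U W S k b0 t0.
Let V := err_var U W S k b0 t0.
Let mu := cexp P (fun w => shat_rv U W S k b0 t0 w - a * S b0 w k t0).
Let dens := info_density a mu V.
Let lam := ln (1 + SINR U W S k b0 t0).

Lemma integral_indicT (A : set T) : measurable A ->
  (\int[P]_w (\1_A w)%:E = P A)%E.
Proof. by move=> mA; rewrite integral_indic// setIT. Qed.

Lemma same_law_integrable dX (EX : measurableType dX) (X Y : T -> EX) (f : EX -> R) :
  measurable_fun setT X -> measurable_fun setT Y -> measurable_fun setT f ->
  same_law P X Y -> P.-integrable setT (EFin \o (fun w => f (X w))) ->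
  P.-integrable setT (EFin \o (fun w => f (Y w))).
Proof.
move=> mX mY mf XY /integrableP[_ fX]; apply/integrableP; split.
  by apply/measurable_EFinP; exact: (measurableT_comp mf mY).
apply: le_lt_trans fX.
have mabs : measurable_fun setT (fun x => `|f x|) by exact: (measurableT_comp _ mf).
by rewrite -(same_law_integral (f := fun x => `|f x|) mX mY mabs XY).
Qed.

Let shat_L2 : L2 P (shat_rv U W S k b0 t0).
Proof. by split => //; exact: measurable_shat_rv. Qed.

Let mean0 : [/\ 0 < V,
   P.-integrable setT (EFin \o (fun w => dens (S b0 w k t0) (shat_rv U W S k b0 t0 w))) &
   (\int[P]_w (dens (S b0 w k t0) (shat_rv U W S k b0 t0 w))%:E = lam%:E)%E].
Proof.
exact: (info_density_mean (measurable_symbol S b0 k t0) (symbols_law model b0 k t0) shat_L2).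
Qed.

Let V0 : 0 < V. Proof. by case: mean0. Qed.

Let mdens : measurable_fun setT (fun ys : C * C => dens ys.2 ys.1).
Proof.
by apply: measurable_info_density; [exact: measurable_snd|exact: measurable_fst].
Qed.

Let mpair b t : measurable_fun setT (fun w => (shat_rv U W S k b t w, S b w k t)).
Proof.
by apply: measurable_fun_pair; [exact: measurable_shat_rv|exact: measurable_symbol].
Qed.

Let dens_integrable b t :
  P.-integrable setT (EFin \o (fun w => dens (S b w k t) (shat_rv U W S k b t w))).
Proof.
have [_ i0 _] := mean0.
exact: (same_law_integrable (mpair b0 t0) (mpair b t) mdens
  (shat_symbol_same_law model k b0 t0 b t) i0).
Qed.

Let dens_mean b t :
  (\int[P]_w (dens (S b w k t) (shat_rv U W S k b t w))%:E = lam%:E)%E.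
Proof.
have [_ _ <-] := mean0.
exact: (same_law_integral_signed (mpair b t) (mpair b0 t0) mdens
  (shat_symbol_same_law model k b t b0 t0)).
Qed.

Let symbol_power b t : (\int[P]_w (Normc.normc (S b w k t) ^+ 2)%:E = 1)%E.
Proof.
exact: (std_cnormal_moment2 (measurable_symbol S b k t) (symbols_law model b k t)).
Qed.

Let integral_sum_real (n : nat) (f : 'I_n -> T -> R) (m : R) :
  (forall i, P.-integrable setT (EFin \o f i)) ->
  (forall i, \int[P]_w (f i w)%:E = m%:E)%E ->
  P.-integrable setT (EFin \o (fun w => \sum_i f i w)) /\
  (\int[P]_w (\sum_i f i w)%:E = (n%:R * m)%:E)%E.
Proof.
move=> fi fm.
have E1 : EFin \o (fun w => \sum_i f i w) = (fun w => \sum_i (f i w)%:E)%E.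
  by apply/funext => w; rewrite /= sumEFin.
split; first by rewrite E1; apply: integrable_sum => // i _; exact: fi.
under eq_integral do rewrite -sumEFin.
rewrite integral_sum//; under eq_bigr do rewrite fm.
by rewrite sumEFin sumr_const card_ord mulr_natl.
Qed.

(** Samples of one block share channels and hardware and are dependent. The sums over a block are
    independent and identically distributed with mean taud * m, so the weak law is applied to
    them. *)
Lemma block_weak_law (f : C * C -> R) (m theta eps : R) :
  measurable_fun setT f ->
  (forall b t, P.-integrable setT (EFin \o (fun w => f (shat_rv U W S k b t w, S b w k t)))) ->
  (forall b t, \int[P]_w (f (shat_rv U W S k b t w, S b w k t))%:E = m%:E)%E ->
  theta < taud%:R * m -> 0 < eps ->
  \forall n \near \oo,
    (P [set w | (\sum_(b < n) \sum_t f (shat_rv U W S k b t w, S b w k t) <= n%:R * theta)%R]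
     <= eps%:E)%E.
Proof.
move=> mf fi fm thm eps0.
pose g (es : E * 'M[C]_(K, taud)) := \sum_t f (shat U k t es.1 es.2, es.2 k t).
have mg : measurable_fun setT g.
  apply: measurable_sum => t; apply: (measurableT_comp mf).
  apply: measurable_fun_pair; first exact: measurable_shat.
  exact: (measurableT_comp (measurable_entry k t) measurable_snd).
have [gi gm] := integral_sum_real (fi 0%N) (fm 0%N).
apply: (weak_law_lower (X := fun b w => g (W b w, S b w)) _ _ _ gi gm thm eps0).
- by move=> b; exact: (measurableT_comp mg (measurable_block W S b)).
- move=> n; apply: (mutual_indep_comp (f := fun=> g)) => //.
  exact: (blocks_indep model).
- by move=> b; exact: (same_law_comp mg (block_same_law model b)).
Qed.

Definition sent n (w : T) : 'M[C]_(n, taud) := \matrix_(b, t) S b w k t.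

(** The output when every user, k included, sends Gaussian symbols: the reference [Yg] of
    Feinstein's argument. *)
Definition received n (w : T) : 'M[C]_(n, taud) :=
  \matrix_(b, t) shat_rv U W S k b t w.

Let total_density n (cy : 'M[C]_(n, taud) * 'M[C]_(n, taud)) : R :=
  \sum_b \sum_t dens (cy.1 b t) (cy.2 b t).

Lemma measurable_sent n : measurable_fun setT (@sent n).
Proof. by apply: measurable_matrix => b t; exact: measurable_symbol. Qed.

Lemma measurable_received n : measurable_fun setT (@received n).
Proof. by apply: measurable_matrix => b t; exact: measurable_shat_rv. Qed.

Lemma measurable_combined_obs n : measurable_fun setT
  (fun cw : 'M[C]_(n, taud) * T => combined_obs U W S k cw.1 cw.2).
Proof.
apply: measurable_matrix => b t.
apply: (measurableT_comp (measurable_shat U k t)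
  (g := fun cw => (W b cw.2, with_codeword k (row b cw.1) (S b cw.2)))).
apply: measurable_fun_pair.
  exact: (measurableT_comp (measurable_funPT (W b)) measurable_snd).
apply: measurable_with_codeword; first by apply: measurable_row; exact: measurable_fst.
exact: (measurableT_comp (measurable_funPT (S b)) measurable_snd).
Qed.

(** The hypothesis [law] of Feinstein's argument, as the image of [coded_row_law] under the map that
    reads off codeword and combined output. *)
Lemma combined_obs_law n (A : set ('M[C]_(n, taud) * 'M[C]_(n, taud))) : measurable A ->
  ((P \x P) [set ww | A (sent n ww.1, combined_obs U W S k (sent n ww.1) ww.2)] =
   P [set w | A (sent n w, received n w)])%E.
Proof.
move=> mA.
pose phi (z : 'rV[E * 'M[C]_(K, taud)]_n) : 'M[C]_(n, taud) * 'M[C]_(n, taud) :=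
  (\matrix_(b, t) (z 0 b).2 k t, \matrix_(b, t) shat U k t (z 0 b).1 (z 0 b).2).
have mphi : measurable_fun setT phi.
  apply: measurable_fun_pair; apply: measurable_matrix => b t.
    apply: (measurableT_comp (measurable_entry k t)).
    exact: (measurableT_comp measurable_snd (measurable_entry 0 b)).
  exact: (measurableT_comp (measurable_shat U k t) (measurable_entry 0 b)).
have mA' : measurable (phi @^-1` A).
  by rewrite -[X in measurable X]setTI; exact: mphi.
have := coded_row_law model k mA'.
have -> : coded_row W S k n @^-1` (phi @^-1` A) =
    [set ww | A (sent n ww.1, combined_obs U W S k (sent n ww.1) ww.2)].
  apply/seteqP; split => ww /=; congr (A (_, _)); apply/matrixP => b t;
    rewrite !mxE ?eqxx ?mxE //=; congr (shat _ _ _ _ _); apply/matrixP => i t';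
    by rewrite !mxE.
have -> : block_row W S n @^-1` (phi @^-1` A) =
    [set w | A (sent n w, received n w)].
  by apply/seteqP; split => w /=; congr (A (_, _)); apply/matrixP => b t; rewrite !mxE.
by [].
Qed.

Lemma sent_indep n :
  mutual_indep P (fun (bt : 'I_n * 'I_taud) w => S bt.1 w k bt.2).
Proof.
move=> A mA; pose F (b : 'I_n) i t := if i == k then A (b, t) else setT.
have mF b i t : measurable (F b i t) by rewrite /F; case: ifP.
have := blocks_box model (A := fun=> setT) (fun=> measurableT) mF.
have -> : [set w | forall b : 'I_n, (setT (W b w)) /\ forall i t, F b i t (S b w i t)] =
    [set w | forall bt, A bt (S bt.1 w k bt.2)].
  apply/seteqP; split => w Aw.
    by move=> [b t]; have [_ /(_ k t)] := Aw b; rewrite /F eqxx.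
  by move=> b; split => // i t; rewrite /F; case: eqP => // ->; exact: (Aw (b, t)).
move=> ->; transitivity (\prod_(b < n) \prod_(t < taud)
    P ((fun w => S b w k t) @^-1` A (b, t)))%E; last first.
  by rewrite pair_big; apply: eq_bigr => -[].
apply: eq_bigr => b _; rewrite preimage_setT probability_setT mul1e.
rewrite (eq_bigr (fun it => if it.1 == k then P ((fun w => S b w it.1 it.2) @^-1` A (b, it.2)) else 1%E)); last first.
  move=> [i t] _ /=; rewrite /F; case: ifP => // _.
  by rewrite preimage_setT probability_setT.
rewrite -(pair_big xpredT xpredT (fun i t => if i == k then P ((fun w => S b w i t) @^-1` A (b, t)) else 1%E))/=.
rewrite (bigD1 k)//= eqxx [X in (_ * X)%E]big1 ?mule1// => i /negbTE ik.
by rewrite ik big1.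
Qed.

Lemma measurable_total_density n : measurable_fun setT (@total_density n).
Proof.
apply: measurable_sum => b; apply: measurable_sum => t.
apply: measurable_info_density.
- exact: (measurableT_comp (measurable_entry b t) measurable_fst).
- exact: (measurableT_comp (measurable_entry b t) measurable_snd).
Qed.

(* The likelihood ratio has mean one under an independent codeword. *)
Lemma total_density_tail n (y : 'M[C]_(n, taud)) (theta : R) :
  (P [set w | (theta < total_density (sent n w, y))%R] <= (expR (- theta))%:E)%E.
Proof.
have mdy : measurable_fun setT (fun w => total_density (sent n w, y)).
  apply: (measurableT_comp (@measurable_total_density n)).
  by apply: measurable_fun_pair; [exact: measurable_sent|exact: measurable_cst].
have mexp : measurable_fun setT (fun w => expR (total_density (sent n w, y))).
  exact: (measurableT_comp (@measurable_expR R)).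
apply: (@le_trans _ _ (P [set w | (expR theta <= expR (total_density (sent n w, y)))%R])).
  apply: le_measure; rewrite ?inE.
  - have -> : [set w | (theta < total_density (sent n w, y))%R] =
        ~` [set w | (total_density (sent n w, y) <= theta)%R].
      by apply/seteqP; split => w /=; rewrite ltNge => /negP.
    by apply: measurableC; apply: measurable_le_set => //; exact: measurable_cst.
  - by apply: measurable_le_set => //; exact: measurable_cst.
  - by move=> w /=; rewrite ler_expR => /ltW.
apply: le_trans.
  by apply: (markov_ge0 P mexp) => [w|]; rewrite ?expR_ge0 ?expR_gt0.
rewrite expRN -[leRHS]mule1 lee_wpmul2l ?lee_fin ?invr_ge0 ?expR_ge0//.
pose f (bt : 'I_n * 'I_taud) s := expR (dens s (y bt.1 bt.2)).
have mf bt : measurable_fun setT (f bt).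
  by apply: (measurableT_comp (@measurable_expR R)); apply: measurable_info_density.
have f1 (bt : 'I_n * 'I_taud) : (\int[P]_w (f bt (S bt.1 w k bt.2))%:E = 1)%E.
  exact: (info_density_exp a mu V0 (y bt.1 bt.2)
    (measurable_symbol S bt.1 k bt.2) (symbols_law model bt.1 k bt.2)).
have -> : (\int[P]_w (expR (total_density (sent n w, y)))%:E =
    \int[P]_w (\prod_bt f bt (S bt.1 w k bt.2))%:E)%E.
  apply: eq_integral => w _; congr EFin; rewrite /total_density/= pair_big/=.
  rewrite expR_sum; apply: eq_bigr => -[b t] _; by rewrite /f/= mxE.
rewrite (expectation_prod _ (sent_indep (n := n)) (f := f))//.
- by rewrite big1.
- by move=> bt; exact: measurable_symbol.
- by move=> bt x; exact: expR_ge0.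
- by move=> bt; rewrite f1 ltry.
Qed.

Let power n (c : 'M[C]_(n, taud)) : R := \sum_b \sum_t Normc.normc (c b t) ^+ 2.

Let measurable_power n : measurable_fun setT (@power n).
Proof.
apply: measurable_sum => b; apply: measurable_sum => t.
by apply: measurable_normc_sqr; exact: measurable_entry.
Qed.

Let false_alarm n (D : set ('M[C]_(n, taud) * 'M[C]_(n, taud)))
    (c : 'M[C]_(n, taud)) : \bar R :=
  P [set w | D (c, received n w)].

Let measurable_false_alarm n D : measurable D -> measurable_fun setT (@false_alarm n D).
Proof.
move=> mD.
have mDr : measurable [set cw : 'M[C]_(n, taud) * T | D (cw.1, received n cw.2)].
  have mf : measurable_fun setT
      (fun cw : 'M[C]_(n, taud) * T => (cw.1, received n cw.2)).
    apply: measurable_fun_pair; first exact: measurable_fst.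
    exact: (measurableT_comp (@measurable_received n) measurable_snd).
  by have := mf measurableT _ mD; rewrite setTI.
have := measurable_fun_xsection P mDr; congr (measurable_fun _ _).
apply/funext => c; rewrite /false_alarm /=; congr (P _).
by apply/seteqP; split => w; rewrite /xsection/= inE.
Qed.

(** [total_density_tail] fixes the output and draws the codeword; the selection needs the reverse.
    Tonelli exchanges the two, at the price of a bound only on average over codewords. *)
Lemma mean_false_alarm n (theta : R) :
  (\int[P]_w false_alarm [set cy | (theta < total_density cy)%R] (sent n w) <=
   (expR (- theta))%:E)%E.
Proof.
set D := [set cy | _].
have mD : measurable D.
  have -> : D = ~` [set cy | (total_density cy <= theta)%R].
    by apply/seteqP; split => w; rewrite /D /=; rewrite ltNge => /negP.
  apply: measurableC; apply: measurable_le_set; last exact: measurable_cst.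
  exact: measurable_total_density.
have mS : measurable [set ww : T * T | D (sent n ww.1, received n ww.2)].
  have mf : measurable_fun setT (fun ww : T * T => (sent n ww.1, received n ww.2)).
    apply: measurable_fun_pair.
      exact: (measurableT_comp (@measurable_sent n) measurable_fst).
    exact: (measurableT_comp (@measurable_received n) measurable_snd).
  by have := mf measurableT _ mD; rewrite setTI.
set S1 := [set ww | _] in mS.
pose f (ww : T * T) : \bar R := (\1_S1 ww)%:E.
have mf : measurable_fun setT f by apply/measurable_EFinP; exact: measurable_indic.
have f0 x : (0 <= f x)%E by rewrite lee_fin indicE.
have fx w' : (\int[P]_w f (w', w) = false_alarm D (sent n w'))%E.
  have mX : measurable [set w | D (sent n w', received n w)].
    have := measurable_xsection w' mS; congr measurable.
    by apply/seteqP; split => w; rewrite /xsection/= inE.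
  apply: etrans (integral_indicT mX); exact: eq_integral.
have fy w : (\int[P]_w' f (w', w) = P [set w' | D (sent n w', received n w)])%E.
  have mX : measurable [set w' | D (sent n w', received n w)].
    have := measurable_ysection w mS; congr measurable.
    by apply/seteqP; split => w'; rewrite /ysection/= inE.
  apply: etrans (integral_indicT mX); exact: eq_integral.
under eq_integral do rewrite -fx.
have := fubini_tonelli (m1 := P) (m2 := P) f mf f0; rewrite /fubini_F /fubini_G => ->.
apply: (@le_trans _ _ (\int[P]_w (expR (- theta))%:E)%E).
  apply: ge0_le_integral => //.
  - by move=> w _; apply: integral_ge0.
  - exact: (measurable_fun_fubini_tonelli_G f mf f0).
  - by move=> w _; rewrite fy; exact: total_density_tail.
by rewrite integral_cst//= probability_setT mule1.
Qed.

(** Three bad events cost eps / 9 each and make up the eps / 3 of [XD]: too low a density, too much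
    power, an atypical false alarm. One delta lowers the threshold below its mean; the other absorbs
    the constants that depend on eps. The factor 2 leaves room for rounding the number of messages
    up. *)
Lemma block_code (eps eta delta : R) : 0 < eps <= 1 -> 0 < eta -> 0 < delta ->
  \forall n \near \oo, forall N : nat,
    N%:R <= 2 * expR (n%:R * (taud%:R * lam - 2 * delta)) ->
    exists (cs : seq 'M[C]_(n, taud)) (dec : 'M[C]_(n, taud) -> nat),
    [/\ size cs = N,
        forall c, c \in cs -> power c <= n%:R * taud%:R * (1 + eta),
        forall i, measurable [set y | dec y = i]
      & forall c0 i, (i < N)%N ->
          (P [set w | dec (combined_obs U W S k (nth c0 cs i) w) <> i] <= eps%:E)%E].
Proof.
move=> /andP[eps0 eps1] eta0 delta0.
have e9 : 0 < eps / 9 by rewrite divr_gt0.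
have taud0 : 0 < taud%:R :> R by rewrite ltr0n subn_gt0 (pilots_lt_block model).
have miss : \forall n \near \oo, (P [set w | (\sum_(b < n) \sum_t
    dens (S b w k t) (shat_rv U W S k b t w) <= n%:R * (taud%:R * lam - delta))%R]
    <= (eps / 9)%:E)%E.
  apply: (block_weak_law (f := fun ys => dens ys.2 ys.1) mdens dens_integrable dens_mean _ e9).
  by rewrite ltrBlDr ltrDl.
(* Excess power is stated as a lower deviation of -|s|^2, since the weak law at hand is
   one-sided. *)
have overload : \forall n \near \oo, (P [set w | (\sum_(b < n) \sum_t
    - 1 * Normc.normc (S b w k t) ^+ 2 <= n%:R * - (taud%:R * (1 + eta)))%R] <= (eps / 9)%:E)%E.
  have mf : measurable_fun setT (fun ys : C * C => - 1 * Normc.normc ys.2 ^+ 2).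
    apply: measurable_funM; first exact: measurable_cst.
    by apply: measurable_normc_sqr; exact: measurable_snd.
  have S2 b t := std_cnormal_L2 (measurable_symbol S b k t) (symbols_law model b k t).
  apply: (block_weak_law (f := fun ys => - 1 * Normc.normc ys.2 ^+ 2) (m := -1) mf _ _ _ e9).
  - by move=> b t; exact: (integrableZ_real (-1) (moment2_integrable (S2 b t))).
  - move=> b t; under eq_integral do rewrite EFinM.
    by rewrite (integralZl measurableT (moment2_integrable (S2 b t))) symbol_power mule1.
  - by rewrite mulrN1 ltrN2 ltr_pMr// ltrDl.
(* 54 = 2 * 9 * 3: the factor 2 of the bound on N, the 9 / eps of [fa], and the 3 / eps from the
   requirement N * fa <= eps / 3. *)
have decay : \forall n \near \oo, 54 / eps ^+ 2 * expR (- (n%:R * delta)) <= 1 :> R.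
  near=> n.
  have c0 : 0 < 54 / eps ^+ 2 by rewrite divr_gt0// exprn_gt0.
  rewrite expRN ler_pdivrMr ?expR_gt0// mul1r -[leLHS]lnK ?posrE// ler_expR -ler_pdivrMr//.
  apply: ltW; apply: (lt_le_trans (truncnS_gt _)); rewrite ler_nat.
  by near: n; exact: nbhs_infty_ge.
apply: filterS3 miss overload decay => n miss overload decay N NL.
pose theta := n%:R * (taud%:R * lam - delta).
pose D := [set cy : 'M[C]_(n, taud) * 'M[C]_(n, taud) | (theta < total_density cy)%R].
(* By Markov's inequality and [mean_false_alarm], a random codeword has a false alarm of at least
   [fa] with probability at most eps / 9. *)
pose fa := 9 / eps * expR (- theta).
have fa0 : 0 < fa by rewrite mulr_gt0 ?expR_gt0// divr_gt0.
pose F := [set c : 'M[C]_(n, taud) | power c <= n%:R * taud%:R * (1 + eta) /\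
  (false_alarm D c <= fa%:E)%E].
have mD : measurable D.
  have -> : D = ~` [set cy | (total_density cy <= theta)%R].
    by apply/seteqP; split => w; rewrite /D /=; rewrite ltNge => /negP.
  apply: measurableC; apply: measurable_le_set; last exact: measurable_cst.
  exact: measurable_total_density.
have mfa := measurable_false_alarm mD.
have mF : measurable F.
  apply: measurableI.
    by apply: measurable_le_set; [exact: measurable_power|exact: measurable_cst].
  by have := measurable_lee measurableT mfa (measurable_cst fa%:E); rewrite setTI.
have mfaw : measurable_fun setT (fun w => false_alarm D (sent n w)).
  exact: (measurableT_comp mfa (@measurable_sent n)).
have mDc c : measurable [set w | D (c, received n w)].
  have mf : measurable_fun setT (fun w => (c, received n w)).
    by apply: measurable_fun_pair; [exact: measurable_cst|exact: measurable_received].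
  by have := mf measurableT _ mD; rewrite setTI.
have fafin c : false_alarm D c \is a fin_num by apply: fin_num_measure; exact: mDc.
pose B1 := [set w | (\sum_(b < n) \sum_t
    dens (S b w k t) (shat_rv U W S k b t w) <= n%:R * (taud%:R * lam - delta))%R].
pose B2 := [set w | (\sum_(b < n) \sum_t
    - 1 * Normc.normc (S b w k t) ^+ 2 <= n%:R * - (taud%:R * (1 + eta)))%R].
pose B3 := [set w | fa <= fine (false_alarm D (sent n w))].
have mfine : measurable_fun setT (fun w => fine (false_alarm D (sent n w))).
  exact: (measurableT_comp (fine_measurable measurableT) mfaw).
have mB1 : measurable B1.
  apply: measurable_le_set; last exact: measurable_cst.
  apply: measurable_sum => b; apply: measurable_sum => t.
  exact: (measurableT_comp mdens (mpair b t)).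
have mB2 : measurable B2.
  apply: measurable_le_set; last exact: measurable_cst.
  apply: measurable_sum => b; apply: measurable_sum => t.
  apply: measurable_funM; first exact: measurable_cst.
  by apply: measurable_normc_sqr; exact: measurable_symbol.
have mB3 : measurable B3 by apply: measurable_le_set => //; exact: measurable_cst.
have PB3 : (P B3 <= (eps / 9)%:E)%E.
  apply: le_trans.
    by apply: (markov_ge0 P mfine) => // w; exact: fine_ge0.
  under eq_integral do rewrite fineK//.
  apply: (@le_trans _ _ (fa^-1%:E * (expR (- theta))%:E)%E).
    by rewrite lee_wpmul2l ?lee_fin ?invr_ge0 ?(ltW fa0)//; exact: mean_false_alarm.
  rewrite -EFinM lee_fin /fa le_eqVlt; apply/orP; left; apply/eqP.
  by field; rewrite !gt_eqF ?expR_gt0.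
have XD : (P [set w | ~ (F (sent n w) /\ D (sent n w, received n w))] <= (eps / 3)%:E)%E.
  apply: (@le_trans _ _ (P (B1 `|` B2 `|` B3))).
    apply: le_measure; rewrite ?inE.
    - apply: measurableC; apply: measurableI.
        by rewrite -[X in measurable X]setTI; exact: measurable_sent.
      have mf : measurable_fun setT (fun w => (sent n w, received n w)).
        by apply: measurable_fun_pair; [exact: measurable_sent|exact: measurable_received].
      by have := mf measurableT _ mD; rewrite setTI.
    - by apply: measurableU => //; exact: measurableU.
    - move=> w /= FD; apply: contrapT => /not_orP[/not_orP[nB1 nB2] nB3]; apply: FD.
      split; [split|].
      + move: nB2; rewrite /B2/= => /negP; rewrite -ltNge => /ltW.
        under eq_bigr do rewrite -mulr_sumr.
        rewrite -mulr_sumr mulN1r mulrN lerN2 mulrA => h; apply: le_trans h.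
        rewrite /power le_eqVlt; apply/orP; left; apply/eqP.
        by apply: eq_bigr => b _; apply: eq_bigr => t _; rewrite mxE.
      + move: nB3; rewrite /B3/= => /negP; rewrite -ltNge => /ltW.
        by rewrite -lee_fin fineK.
      + move: nB1; rewrite /B1/= => /negP; rewrite -ltNge /D /theta /total_density/=.
        congr (_ < _); apply: eq_bigr => b _; apply: eq_bigr => t _.
        by rewrite !mxE.
  apply: le_trans (measureU2 _ (measurableU _ _ mB1 mB2) mB3) _.
  have -> : (eps / 3 = eps / 9 + eps / 9 + eps / 9)%R by field.
  rewrite !EFinD leeD//; apply: le_trans (measureU2 _ mB1 mB2) _; exact: leeD.
have Nfa : N%:R * fa <= eps / 3.
  apply: (@le_trans _ _ (2 * expR (n%:R * (taud%:R * lam - 2 * delta)) * fa)).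
    by rewrite ler_wpM2r// ltW.
  rewrite /fa; have -> : expR (n%:R * (taud%:R * lam - 2 * delta)) =
      expR theta * expR (- (n%:R * delta)).
    by rewrite -expRD; congr expR; rewrite /theta; ring.
  have -> : 2 * (expR theta * expR (- (n%:R * delta))) * (9 / eps * expR (- theta)) =
      (eps / 3) * (54 / eps ^+ 2 * expR (- (n%:R * delta))) * (expR theta * expR (- theta)).
    by field; rewrite gt_eqF.
  by rewrite expRxMexpNx_1 mulr1 ler_piMr// divr_ge0// ltW.
have eps01 : (0 < eps <= 1)%R by rewrite eps0.
have [cs [szcs Fcs Pcs]] := feinstein (@measurable_sent n) (@measurable_received n)
  (@measurable_combined_obs n) (@combined_obs_law n) mF mD eps01
  (fun c Fc => proj2 Fc) (ltW fa0) Nfa XD (leqnn N).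
exists cs, (threshold_decode D cs); split => //.
- by move=> c /Fcs [].
- by move=> i; exact: measurable_threshold_decode.
Unshelve. all: by end_near. Qed.

End block_coding.

(** * From block codes to achievable rates, with silent blocks *)

Lemma leq_div_trunc (B D : nat) : (B <= B %/ D.+1 * D + B %/ D.+1 + D)%N.
Proof.
have := ltn_ceil B (ltn0Sn D); rewrite mulSn mulnS addSn ltnS.
by rewrite addnC [(_ + _ * D)%N]addnC.
Qed.

Section achievability.
Context {R : realType} {M K tauc taup : nat} {dE : measure_display}
  {E : measurableType dE} (U : uplink R M K tauc taup E).
Local Notation C := R[i].
Local Notation taud := (tauc - taup)%N.
Context {d : measure_display} {T : measurableType d} {P : probability T R}.
Variables (W : nat -> {RV P >-> E}) (S : nat -> {RV P >-> 'M[C]_(K, taud)}).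
Variables (Rcov : 'I_K -> 'M[C]_M) (sigma2 : R).
Hypothesis model : uplink_model U W S Rcov sigma2.
Variables (k : 'I_K) (b0 : nat) (t0 : 'I_taud).
Hypothesis shat_moment2 : (moment2 P (shat_rv U W S k b0 t0) < +oo)%E.
Hypothesis err_var_neq0 : err_var U W S k b0 t0 != 0.

(** The silent blocks come last: [insub] fails exactly when b >= n, and the row is then 0. The
    receiver discards these blocks with [truncate]. *)
Let pad n B (c : 'M[C]_(n, taud)) : 'M[C]_(B, taud) :=
  \matrix_(b, t) if (insub (val b) : option 'I_n) is Some b' then c b' t else 0.

Let truncate n B (nB : (n <= B)%N) (y : 'M[C]_(B, taud)) : 'M[C]_(n, taud) :=
  \matrix_(b, t) y (widen_ord nB b) t.

Let power_pad n B (nB : (n <= B)%N) (c : 'M[C]_(n, taud)) :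
  \sum_(b < B) \sum_(t < taud) Normc.normc (pad B c b t) ^+ 2 =
  \sum_(b < n) \sum_(t < taud) Normc.normc (c b t) ^+ 2.
Proof.
pose F (i : nat) := \sum_(t < taud)
  Normc.normc (if (insub i : option 'I_n) is Some b then c b t else 0) ^+ 2.
transitivity (\sum_(b < B) F b).
  by apply: eq_bigr => b _; apply: eq_bigr => t _; rewrite mxE.
rewrite (bigID (fun b : 'I_B => (b < n)%N))/= [X in _ + X]big1 ?addr0.
  rewrite -(big_ord_widen _ F nB); apply: eq_bigr => b _; apply: eq_bigr => t _.
  by rewrite valK.
move=> b nb; apply: big1 => t _; rewrite insubF ?(negbTE nb)//.
by rewrite Normc.normc0 expr0n.
Qed.

Let combined_obs_pad n B (nB : (n <= B)%N) (c : 'M[C]_(n, taud)) w :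
  truncate nB (combined_obs U W S k (pad B c) w) = combined_obs U W S k c w.
Proof.
have rowE b : row (widen_ord nB b) (pad B c) = row b c.
  by apply/rowP => t'; rewrite !mxE /= valK.
by apply/matrixP => b t; rewrite [LHS]mxE [LHS]mxE [RHS]mxE rowE.
Qed.

Let measurable_truncate n B (nB : (n <= B)%N) : measurable_fun setT (truncate nB).
Proof. by apply: measurable_matrix => b t; exact: measurable_entry. Qed.

Lemma achievable_combined : achievable P (combined_obs U W S k) (SE U W S k b0 t0).
Proof.
move=> eps eps0; set r := SE U W S k b0 t0.
(* At a rate of at most eps a single message, sent as the zero codeword, is enough. The other case
   yields 0 < e < L, on which the choice of the parameters below relies. *)
have [re|re] := leP r eps.
  near=> B; exists 1%N, (fun=> 0), (fun=> ord0); split=> //.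
  - by split=> //; rewrite ln1 !mul0r subr_le0.
  - move=> m; rewrite big1 ?ler0n// => b _; apply: big1 => t _.
    by rewrite mxE Normc.normc0 expr0n.
  - move=> m; have -> : (fun=> ord0) @^-1` [set m] = [set: 'M[C]_(B, taud)].
      by apply/seteqP; split => // y _; exact/esym/ord1.
    exact: measurableT.
  - move=> m; have -> : [set _ | ord0 <> m] = set0 :> set T.
      by apply/seteqP; split => // w; apply; exact/esym/ord1.
    by rewrite measure0 lee_fin ltW.
have tauc0 : 0 < tauc%:R :> R.
  by rewrite ltr0n (leq_ltn_trans _ (pilots_lt_block model)).
have ln20 : 0 < ln 2 :> R by rewrite ln_gt0// ltr1n.
pose L : R := taud%:R * ln (1 + SINR U W S k b0 t0).
have rE : r * (tauc%:R * ln 2) = L.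
  rewrite /r /SE /L natrB ?(ltnW (pilots_lt_block model))//.
  by field; rewrite !gt_eqF.
(* The slack eps converted from bits per channel use to nats per block, the unit of [L]. It is spent
   in thirds: 2 * (e / 6) in [block_code], e / 3 for the silent blocks, e / 3 for the remainder of
   the division of B. *)
pose e := eps * (tauc%:R * ln 2).
have e0 : 0 < e by rewrite !mulr_gt0.
have eL : e < L by rewrite -rE ltr_pM2r// mulr_gt0.
have L0 : 0 < L := lt_trans e0 eL.
(* One silent block per [Dn] active ones loses L nats; as Dn > 3 L / e, this is less than e / 3 per
   active block. *)
pose Dn := (Num.truncn (3 * L / e)).+1.
have DnL : 3 * L / e < Dn%:R := truncnS_gt _.
have Dn0 : 0 < Dn%:R :> R by rewrite ltr0n.
have eta0 : 0 < Dn%:R^-1 :> R by rewrite invr_gt0.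
have delta0 : 0 < e / 6 by rewrite divr_gt0.
have eps01 : 0 < Num.min eps 1 <= 1 by rewrite lt_min eps0 ltr01/= ge_min lexx orbT.
have [n0 _ code] := block_code model shat_moment2 err_var_neq0 eps01 eta0 delta0.
near=> B.
(* The [n] active blocks may exceed their power by the factor 1 + 1 / Dn, which amounts to the
   allowance of q (Dn + 1) <= B blocks. *)
pose q := (B %/ Dn.+1)%N; pose n := (q * Dn)%N.
have qB : (q * Dn.+1 <= B)%N by rewrite leq_trunc_div.
have nB : (n <= B)%N by apply: leq_trans qB; rewrite leq_mul2l leqnSn orbT.
have n0n : (n0 <= n)%N.
  apply: (@leq_trans q); last by rewrite /n leq_pmulr.
  rewrite leq_divRL//; near: B; exact: nbhs_infty_ge.
have B0 : 0 < B%:R :> R by rewrite ltr0n; near: B; exact: nbhs_infty_gt.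
have Bbig : Dn%:R * L <= B%:R * (e / 3).
  rewrite -ler_pdivrMr ?divr_gt0//; apply: ltW.
  apply: (lt_le_trans (truncnS_gt _)); rewrite ler_nat.
  by near: B; exact: nbhs_infty_ge.
have rate : B%:R * (L - e) <= n%:R * (L - 2 * (e / 6)).
  have nx : n%:R = q%:R * Dn%:R :> R by rewrite natrM.
  have h1 : B%:R - q%:R - Dn%:R <= n%:R :> R.
    rewrite lerBlDr lerBlDr -!natrD ler_nat addnAC.
    exact: leq_div_trunc.
  have h2 : q%:R * L <= B%:R * (e / 3).
    apply: (@le_trans _ _ (n%:R * (e / 3))).
      rewrite nx -mulrA ler_wpM2l//.
      by move: DnL; rewrite ltr_pdivrMr// => /ltW; lra.
    by rewrite ler_wpM2r ?ler_nat// divr_ge0// ltW.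
  apply: (@le_trans _ _ ((B%:R - q%:R - Dn%:R) * (L - 2 * (e / 6)))).
    have q0 : 0 <= q%:R :> R by [].
    have := mulr_ge0 q0 (ltW e0); have := mulr_ge0 (ltW Dn0) (ltW e0); lra.
  by rewrite ler_wpM2r//; lra.
have x0 : 0 <= n%:R * (L - 2 * (e / 6)) by rewrite mulr_ge0//; lra.
pose x := expR (n%:R * (L - 2 * (e / 6))).
(* Rounding up to N' + 1 messages loses no rate, keeps the message set nonempty for [inord], and
   stays below 2 x because x >= 1. *)
pose N' := Num.truncn x.
have N'x : N'.+1%:R <= 2 * x.
  rewrite -natr1 mulr2n mulrDl !mul1r lerD//.
    by rewrite truncn_le// expR_ge0.
  by rewrite -expR0 ler_expR.
have [cs [dec [szcs powcs mdec Pcs]]] := code n n0n N'.+1 N'x.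
pose c0 : 'M[C]_(n, taud) := 0.
(* The threshold decoder returns an out-of-range index when nothing passes; [inord] maps it to some
   message, which can only shrink the error events. *)
exists N'.+1, (fun m : 'I_N'.+1 => pad B (nth c0 cs m)),
  (fun y => inord (dec (truncate nB y))); split.
- split=> //; have xN : x <= N'.+1%:R by rewrite ltW// truncnS_gt.
  rewrite ler_pdivlMr; last by rewrite natrM mulr_gt0.
  rewrite ler_pdivlMr// natrM.
  have -> : (r - eps) * (B%:R * tauc%:R) * ln 2 = B%:R * (L - e).
    by rewrite -rE /e; ring.
  apply: (le_trans rate); rewrite -[leLHS]expRK ler_ln ?posrE ?expR_gt0//.
- move=> m; rewrite power_pad//.
  apply: (le_trans (powcs _ (mem_nth _ _))); first by rewrite szcs.
  have -> : n%:R * taud%:R * (1 + Dn%:R^-1) = (q * Dn.+1)%:R * taud%:R :> R.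
    by rewrite /n !natrM -natr1; field; rewrite gt_eqF.
  by rewrite [leRHS]natrM ler_wpM2r// ler_nat.
- move=> m.
  have -> : (fun y : 'M[C]_(B, taud) => inord (dec (truncate nB y))) @^-1` [set m] =
      \bigcup_(i in [set i | inord i = m :> 'I_N'.+1])
        (truncate nB @^-1` [set y | dec y = i]).
    apply/seteqP; split => y /=; first by move=> <-; exists (dec (truncate nB y)).
    by move=> [i /= <- <-].
  apply: bigcup_measurable => i _.
  by rewrite -[X in measurable X]setTI; exact: measurable_truncate.
- move=> m; have epsm : ((Num.min eps 1)%:E <= eps%:E)%E by rewrite lee_fin ge_min lexx.
  apply: (le_trans _ epsm); apply: (le_trans _ (Pcs c0 m (ltn_ord m))).
  set c := nth c0 cs m.
  have mobs : measurable_fun setT (combined_obs U W S k c : T -> _).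
    have mcw : measurable_fun setT (fun w : T => (c, w)).
      by apply: measurable_fun_pair; [exact: measurable_cst|exact: measurable_id].
    exact: (measurableT_comp (@measurable_combined_obs _ _ _ _ _ _ _ U _ _ _ W S k n) mcw).
  have mQ (Q : set nat) : measurable [set w | Q (dec (combined_obs U W S k c w))].
    rewrite (_ : [set w | _] = \bigcup_(i in Q)
        (combined_obs U W S k c @^-1` [set y | dec y = i])).
      apply: bigcup_measurable => i _; rewrite -[X in measurable X]setTI.
      exact: mobs.
    by apply/seteqP; split => w /=; [exists (dec (combined_obs U W S k c w))|move=> [i Qi ->]].
  under eq_set do rewrite combined_obs_pad.
  apply: le_measure; rewrite ?inE.
  - exact: (mQ [set i | inord i <> m]).
  - exact: (mQ [set i | i <> m :> nat]).
  - by move=> w /= dm dm'; apply: dm; rewrite dm' inord_val.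
Unshelve. all: by end_near. Qed.

(** The combined output is the measurable function [comb] of received pilots and data, so a decoder
    may start by computing it; this uses that the combiner depends on the pilots alone. *)
Lemma achievable_received (r : R) : achievable P (combined_obs U W S k) r ->
  achievable P (rx_obs U W S k) r.
Proof.
move=> ach eps eps0; have [n0 _ code] := ach eps eps0.
near=> B.
have [N [cw [dec [rate pow mdec err]]]] : exists (N : nat)
    (cw : 'I_N -> 'M[C]_(B, taud)) (dec : 'M[C]_(B, taud) -> 'I_N),
    [/\ (0 < N)%N /\ r - eps <= (ln N%:R / ln 2) / (B * tauc)%:R,
        forall m, \sum_(b < B) \sum_(t < taud) (Normc.normc (cw m b t)) ^+ 2
                    <= (B * taud)%:R,
        forall m, measurable (dec @^-1` [set m])
      & forall m, (P [set w | dec (combined_obs U W S k (cw m) w) <> m] <= eps%:E)%E].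
  by apply: code; near: B; exact: nbhs_infty_ge.
pose comb (o : B.-tuple ('M[C]_(M, taup) * 'M[C]_(M, taud))) : 'M[C]_(B, taud) :=
  \matrix_(b, t) ((combiner U k (tnth o b).1) ^t* *m col t (tnth o b).2) 0 0.
have mcomb : measurable_fun setT comb.
  apply: measurable_matrix => b t; apply: (measurableT_comp (measurable_entry 0 0)).
  apply: measurable_mulmx.
    apply: measurable_adjmx; apply: (measurableT_comp (measurable_funPT (combiner U k))).
    exact: (measurableT_comp measurable_fst (measurable_tnth b)).
  apply: measurable_col.
  exact: (measurableT_comp measurable_snd (measurable_tnth b)).
exists N, cw, (dec \o comb); split => // m.
  by have := mcomb measurableT _ (mdec m); rewrite setTI.
apply: le_trans (err m); rewrite le_eqVlt; apply/orP; left; apply/eqP.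
congr (P _); apply/seteqP.
have combE w : comb (rx_obs U W S k (cw m) w) = combined_obs U W S k (cw m) w.
  by apply/matrixP => b' t; rewrite [LHS]mxE [RHS]mxE tnth_mktuple.
by split => w /=; rewrite combE.
Unshelve. all: by end_near. Qed.

Lemma SE_le_ergodic_capacity :
  ((SE U W S k b0 t0)%:E <= ergodic_capacity U W S k)%E.
Proof.
apply: ereal_sup_ubound; exists (SE U W S k b0 t0) => //.
exact: achievable_received achievable_combined.
Qed.

End achievability.

(** * The additive distortion model *)

Section gaussian_vectors.
Context {R : realType} {d} {T : measurableType d} (P : probability T R).
Local Notation C := R[i].

Lemma mutual_indep_cV_law m (X Y : T -> 'cV[C]_m) :
  measurable_fun setT X -> measurable_fun setT Y ->
  mutual_indep P (fun i w => X w i 0) -> mutual_indep P (fun i w => Y w i 0) ->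
  (forall i, same_law P (fun w => X w i 0) (fun w => Y w i 0)) ->
  same_law P X Y.
Proof.
move=> mX mY iX iY XY; apply: mx_law_unique => // F mF.
have colE (Z : T -> 'cV[C]_m) :
    [set w | forall i j, F i j (Z w i j)] = [set w | forall i, F i 0 (Z w i 0)].
  by apply/seteqP; split => w FZ i; [exact: FZ|move=> j; rewrite ord1; exact: FZ].
rewrite !colE; apply: etrans (iX (fun i => F i 0) (fun i => mF i 0)) _.
apply: etrans _ (esym (iY (fun i => F i 0) (fun i => mF i 0))).
by apply: eq_bigr => i _; exact: XY.
Qed.

End gaussian_vectors.

Section gaussian_vector_symmetry.
Context {R : realType} {d} {T : measurableType d} (P : probability T R).
Local Notation C := R[i].

(** With a possibly singular covariance there is no density to inspect; the sign is pulled back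
    through X = A w (in law) to the independent entries of w. *)
Lemma cnormal_vec_opp m (X : T -> 'cV[C]_m) (Sigma : 'M[C]_m) :
  cnormal_vec P X Sigma -> same_law P (fun w => - X w) X.
Proof.
move=> [d' [T' [P' [w [A [sw iw _ XA]]]]]] B mB.
have mw i : measurable_fun setT (fun x => w x i 0).
  exact: (measurableT_comp (measurable_entry i 0) (measurable_funPT w)).
have mN : measurable (-%R @^-1` B : set 'cV[C]_m).
  have := measurable_oppmx (@measurable_id _ 'cV[C]_m setT) measurableT mB.
  by rewrite setTI.
have opp_w : same_law P' (fun x => - w x) w.
  apply: mutual_indep_cV_law => //; first exact: measurable_oppmx.
    have := mutual_indep_comp (f := fun _ (z : C) => - z)
      (fun _ => measurable_complexN (@measurable_id _ C setT)) iw.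
    by move=> iN D mD; have := iN D mD; congr (P' _ = _);
      [apply/seteqP; split => x Dx i; have := Dx i; rewrite mxE|
       apply: eq_bigr => i _; congr (P' _); apply/seteqP; split => x; rewrite /= mxE].
  move=> i D mD.
  apply: etrans (std_cnormal_opp (mw i) (sw i) mD).
  by congr (P' _); apply/seteqP; split => x; rewrite /= mxE.
have mAB : measurable ((fun z => A *m z) @^-1` B : set 'cV[C]_m).
  have := measurable_mulmx (measurable_cst A) (@measurable_id _ 'cV[C]_m setT) measurableT mB.
  by rewrite setTI.
apply: (etrans (XA _ mN)); rewrite (XA B mB).
apply: etrans (opp_w _ mAB); congr (P' _).
by apply/seteqP; split => x /=; rewrite mulmxN.
Qed.

End gaussian_vector_symmetry.

Section signed_independence.
Context {R : realType} {d} {T : measurableType d} (P : probability T R).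
Local Notation C := R[i].
Context {dA dB} {EA : measurableType dA} {EB : measurableType dB}.
Variables (X : T -> EA) (Y : T -> EB).
Hypotheses (mX : measurable_fun setT X) (mY : measurable_fun setT Y).
Hypothesis XY : indep2 P X Y.

(** Meant for the weight |s_k|^2, of mean one. [indep2_expectation] covers nonnegative functions
    only, so [f] is split into positive and negative parts. *)
Lemma indep2_integral_weight (f : EA -> R) (g : EB -> R) :
  measurable_fun setT f -> measurable_fun setT g ->
  P.-integrable setT (EFin \o (fun w => f (X w))) ->
  (forall y, 0 <= g y) -> (\int[P]_w (g (Y w))%:E = 1)%E ->
  fine (\int[P]_w (f (X w) * g (Y w))%:E)%E = fine (\int[P]_w (f (X w))%:E)%E.
Proof.
move=> mf mg intf g0 g1.
have goo : (\int[P]_w (g (Y w))%:E < +oo)%E by rewrite g1 ltry.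
have part (h : EA -> R) : measurable_fun setT h -> (forall x, 0 <= h x <= `|f x|) ->
    [/\ P.-integrable setT (EFin \o (fun w => h (X w))),
     P.-integrable setT (EFin \o (fun w => h (X w) * g (Y w))) &
     (\int[P]_w (h (X w) * g (Y w))%:E = \int[P]_w (h (X w))%:E)%E].
  move=> mh hf; have h0 x : 0 <= h x by case/andP: (hf x).
  have mhX : measurable_fun setT (fun w => h (X w)) by exact: (measurableT_comp mh mX).
  have mgY : measurable_fun setT (fun w => g (Y w)) by exact: (measurableT_comp mg mY).
  have hi : P.-integrable setT (EFin \o (fun w => h (X w))).
    apply: le_integrable intf => //; first exact/measurable_EFinP.
    by move=> w _; rewrite lee_fin ger0_norm; [case/andP: (hf (X w))|].
  have hoo : (\int[P]_w (h (X w))%:E < +oo)%E.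
    by have := integrable_fin_num measurableT hi; rewrite ge0_fin_numE//;
      apply: integral_ge0 => w _; rewrite lee_fin.
  have E := indep2_expectation mX mY XY h0 g0 mh mg hoo goo.
  split => //; last by rewrite E g1 mule1.
  apply/integrableP; split; first by apply/measurable_EFinP; exact: measurable_funM.
  under eq_integral do rewrite /= ger0_norm ?mulr_ge0//.
  by rewrite E g1 mule1.
pose fp x := Num.max (f x) 0; pose fn x := Num.max (- f x) 0.
have mfp : measurable_fun setT fp by apply: measurable_maxr => //; exact: measurable_cst.
have mfn : measurable_fun setT fn.
  by apply: measurable_maxr; [exact: measurable_funN|exact: measurable_cst].
have fE x : f x = fp x + (- 1) * fn x.
  by rewrite /fp /fn !maxEle oppr_le0; case: (ltgtP (f x) 0) => [fx|fx|->]; ring.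
have [|ip ipg Ep] := part fp mfp.
  by move=> x; rewrite le_max lexx orbT ge_max ler_norm normr_ge0.
have [|ineg ineg' En] := part fn mfn.
  by move=> x; rewrite le_max lexx orbT ge_max -normrN ler_norm normr_ge0.
have -> : (\int[P]_w (f (X w) * g (Y w))%:E =
    \int[P]_w (fp (X w) * g (Y w) + (- 1) * (fn (X w) * g (Y w)))%:E)%E.
  by apply: eq_integral => w _; rewrite fE mulrDl mulrA.
have -> : (\int[P]_w (f (X w))%:E = \int[P]_w (fp (X w) + (- 1) * fn (X w))%:E)%E.
  by apply: eq_integral => w _; rewrite fE.
rewrite (fine_integralD ipg (integrableZ_real (-1) ineg')).
rewrite (fine_integralD ip (integrableZ_real (-1) ineg)).
by rewrite (fine_integralZ _ ineg') (fine_integralZ _ ineg) Ep En.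
Qed.

Lemma cexp_indep_weight (f : EA -> C) (g : EB -> R) :
  measurable_fun setT f -> measurable_fun setT g ->
  cintegrable P (fun w => f (X w)) ->
  (forall y, 0 <= g y) -> (\int[P]_w (g (Y w))%:E = 1)%E ->
  cexp P (fun w => f (X w) * (g (Y w))%:C) = cexp P (fun w => f (X w)).
Proof.
move=> /measurable_complexP[mr mi] mg [ir ii] g0 g1; apply: complex_eqP.
- rewrite !cexp_ReE -(indep2_integral_weight (f := fun x => complex.Re (f x)) mr mg ir g0 g1).
  by congr fine; apply: eq_integral => w _; case: (f (X w)) => x y /=; rewrite mulr0 subr0.
- rewrite !cexp_ImE -(indep2_integral_weight (f := fun x => complex.Im (f x)) mi mg ii g0 g1).
  by congr fine; apply: eq_integral => w _; case: (f (X w)) => x y /=; rewrite mulr0 add0r.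
Qed.

Lemma moment2_indepM (f : EA -> C) (g : EB -> C) :
  measurable_fun setT f -> measurable_fun setT g ->
  L2 P (fun w => f (X w)) -> L2 P (fun w => g (Y w)) ->
  (moment2 P (fun w => f (X w) * g (Y w))%R =
   moment2 P (fun w => f (X w)) * moment2 P (fun w => g (Y w)))%E.
Proof.
move=> mf mg [_ f2] [_ g2]; rewrite !moment2E in f2 g2 *.
under eq_integral do rewrite normc_sqrM.
apply: (indep2_expectation (f := fun x => Normc.normc (f x) ^+ 2)
  (g := fun y => Normc.normc (g y) ^+ 2) mX mY XY) => //.
- by move=> x; exact: sqr_ge0.
- by move=> x; exact: sqr_ge0.
- exact: measurable_normc_sqr.
- exact: measurable_normc_sqr.
Qed.

End signed_independence.

(** * Second moments of the combined signal under additive distortion *)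

Section additive_distortion.
Context {R : realType} {M K tauc taup : nat} {dE : measure_display}
  {E : measurableType dE} (U : uplink R M K tauc taup E).
Local Notation C := R[i].
Local Notation taud := (tauc - taup)%N.
Context {d : measure_display} {T : measurableType d} {P : probability T R}.
Variables (W : nat -> {RV P >-> E}) (S : nat -> {RV P >-> 'M[C]_(K, taud)}).
Variables (Rcov : 'I_K -> 'M[C]_M) (sigma2 : R).
Hypothesis model : uplink_model U W S Rcov sigma2.
Variables (k : 'I_K) (b : nat) (t : 'I_taud).
Variables (epsilon : 'I_M -> R) (r : {RV P >-> 'cV[C]_M}).
Hypothesis r_law : cnormal_vec P r 1%:M.
Hypothesis r_indep : indep2 P r (sample_data U W S b t).
Hypothesis additive : additive_dist U W S b t epsilon r.

Let xE i (e : E) : C := ((v U k e) ^t* *m h U i e) 0 0.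
Let x i w := xE i (W b w).
Let s i w : C := S b w i t.
Let sx i w := s i w * x i w.
Let noiseE (e : E) : C := ((v U k e) ^t* *m noise_at U t e) 0 0.
Let N w := noiseE (W b w).
Let distES (es : E * 'M[C]_(K, taud)) : C :=
  ((v U k es.1) ^t* *m dist_at U t es.1 es.2) 0 0.
Let D w := distES (W b w, S b w).

Hypothesis x_moment2 : forall i, (moment2 P (x i) < +oo)%E.
Hypothesis N_moment2 : (moment2 P N < +oo)%E.
Hypothesis D_moment2 : (moment2 P D < +oo)%E.

Let m_xE i : measurable_fun setT (xE i).
Proof.
apply: (measurableT_comp (measurable_entry 0 0)); apply: measurable_mulmx.
  by apply: measurable_adjmx; exact: measurable_v.
exact: measurable_h.
Qed.

Let mnoiseE : measurable_fun setT noiseE.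
Proof.
apply: (measurableT_comp (measurable_entry 0 0)); apply: measurable_mulmx.
  by apply: measurable_adjmx; exact: measurable_v.
exact: measurable_noise_at.
Qed.

Let mdistES : measurable_fun setT distES.
Proof.
apply: (measurableT_comp (measurable_entry 0 0)); apply: measurable_mulmx.
  apply: measurable_adjmx.
  exact: (measurableT_comp (measurable_v U k) measurable_fst).
exact: measurable_dist_at.
Qed.

Let mx i : measurable_fun setT (x i).
Proof. exact: (measurableT_comp (m_xE i) (measurable_funPT (W b))). Qed.

Let ms i : measurable_fun setT (s i). Proof. exact: measurable_symbol. Qed.

Let x2 i : L2 P (x i). Proof. exact: (conj (mx i) (x_moment2 i)). Qed.

Let s2 i : L2 P (s i).
Proof. exact: (std_cnormal_L2 (ms i) (symbols_law model b i t)). Qed.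

Let N2 : L2 P N.
Proof. exact: (conj (measurableT_comp mnoiseE (measurable_funPT (W b))) N_moment2). Qed.

Let D2 : L2 P D.
Proof. exact: (conj (measurableT_comp mdistES (measurable_block W S b)) D_moment2). Qed.

Let WS_indep : indep2 P (W b) (S b). Proof. exact: (symbols_indep_rest model). Qed.

Let mWb : measurable_fun setT (W b). Proof. exact: measurable_funPT. Qed.
Let mSb : measurable_fun setT (S b). Proof. exact: measurable_funPT. Qed.

Let sx_moment2 i : moment2 P (sx i) = moment2 P (x i).
Proof.
have me : measurable_fun setT (fun s : 'M[C]_(K, taud) => s i t) by exact: measurable_entry.
have := moment2_indepM mWb mSb WS_indep (m_xE i) me (x2 i) (s2 i).
have -> : moment2 P (fun w => S b w i t) = 1%E.
  by rewrite moment2E std_cnormal_moment2//; [exact: ms|exact: (symbols_law model)].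
rewrite mule1 => <-; congr moment2; apply/funext => w; exact: mulrC.
Qed.

Let sx2 i : L2 P (sx i).
Proof. by split; [exact: measurable_complexM|rewrite sx_moment2; case: (x2 i)]. Qed.

(** A symmetry of the law of the symbols: the whole row of one user changes sign, all other users
    being untouched. *)
Let flip i0 (s' : 'M[C]_(K, taud)) : 'M[C]_(K, taud) :=
  \matrix_(i, t') (if i == i0 then - s' i t' else s' i t').

Let mflip i0 : measurable_fun setT (flip i0).
Proof.
apply: measurable_matrix => i t'; case: (i == i0); last exact: measurable_entry.
by apply: measurable_complexN; exact: measurable_entry.
Qed.

Let flip_law i0 : same_law P (fun w => flip i0 (S b w)) (S b).
Proof.
pose g (it : 'I_K * 'I_taud) (z : C) := if it.1 == i0 then - z else z.
have mg it : measurable_fun setT (g it).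
  rewrite /g; case: (it.1 == i0) => //.
  exact: measurable_complexN.
apply: mutual_indep_mx_same_law => //.
- exact: (measurableT_comp (mflip i0) mSb).
- have := mutual_indep_comp mg (symbols_indep model b).
  by congr mutual_indep; apply/funext => it; apply/funext => w; rewrite /flip mxE.
- exact: (symbols_indep model b).
- move=> i t'; rewrite /flip; under [X in same_law P X _]eq_fun do rewrite mxE.
  case: (i == i0) => //.
  exact: (std_cnormal_opp (measurable_symbol S b i t') (symbols_law model b i t')).
Qed.

(** [W] is independent of the symbols, so flipping the symbols alone preserves the law of the pair,
    and the mean of an odd function equals its own opposite. *)
Lemma cexp_odd_symbol i0 (f : E * 'M[C]_(K, taud) -> C) : measurable_fun setT f ->
  (forall e s', f (e, flip i0 s') = - f (e, s')) ->
  cintegrable P (fun w => f (W b w, S b w)) -> cexp P (fun w => f (W b w, S b w)) = 0.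
Proof.
move=> mf f_odd intf; apply: eq_opp_complex; rewrite -cexpN//.
have same : same_law P (fun w => (W b w, S b w)) (fun w => (W b w, flip i0 (S b w))).
  apply: indep2_same_law => //; first exact: (measurableT_comp (mflip i0) mSb).
    exact: (indep2_comp (f := id) _ (mflip i0) WS_indep).
  by move=> A mA; rewrite flip_law.
have := same_law_cexp (measurable_block W S b) _ mf same.
move=> ->; last by apply: measurable_fun_pair => //; exact: (measurableT_comp (mflip i0) mSb).
by congr cexp; apply/funext => w; rewrite f_odd.
Qed.

Let sample : Type := ('M[C]_(M, K) * 'M[C]_(M, taup) * 'cV[C]_M * 'cV[C]_K)%type.

Let msample : measurable_fun setT (sample_data U W S b t).
Proof.
exact: (measurableT_comp measurable_fst
  (measurableT_comp (measurable_sample_data U t) (measurable_block W S b))).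
Qed.

Let mr : measurable_fun setT r. Proof. exact: measurable_funPT. Qed.

Let sample_r_law : same_law P (fun w => (r w, sample_data U W S b t w))
  (fun w => (- r w, sample_data U W S b t w)).
Proof.
apply: indep2_same_law => //; first exact: measurable_oppmx.
- apply: (indep2_comp (f := fun z : 'cV[C]_M => - z) (g := id)) => //.
  exact: measurable_oppmx.
- by move=> A mA; rewrite (cnormal_vec_opp r_law).
Qed.

(** The same symmetry argument with the sign of [r]. The remaining arguments are confined to
    [sample], since [r] is assumed independent only of the data of its own sample. *)
Lemma cexp_odd_distortion (f : 'cV[C]_M * sample -> C) : measurable_fun setT f ->
  (forall z a, f (- z, a) = - f (z, a)) ->
  cintegrable P (fun w => f (r w, sample_data U W S b t w)) ->
  cexp P (fun w => f (r w, sample_data U W S b t w)) = 0.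
Proof.
move=> mf f_odd intf; apply: eq_opp_complex; rewrite -cexpN//.
have mrs : measurable_fun setT (fun w => (r w, sample_data U W S b t w)).
  exact: measurable_fun_pair.
have mrs' : measurable_fun setT (fun w => (- r w, sample_data U W S b t w)).
  by apply: measurable_fun_pair => //; exact: measurable_oppmx.
rewrite (same_law_cexp mrs mrs' mf sample_r_law).
by congr cexp; apply/funext => w; rewrite f_odd.
Qed.

Let gain (a : sample) (m : 'I_M) : R := epsilon m * Num.sqrt
  (\sum_(i < K) fine (moment2 P (fun w => tx U (S b w) i t)) *
     Normc.normc (a.1.1.1 m i) ^+ 2).

(** A priori the hardware responds to the entire block; the additive model lets the combined
    distortion be written through [r] and the data of sample t, visibly odd in [r]. *)
Let dist_of (za : 'cV[C]_M * sample) : C :=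
  \sum_(m < M) (combiner U k za.2.1.1.2 m 0)^*%R * ((gain za.2 m)%:C * za.1 m 0).

Let mdist_of : measurable_fun setT dist_of.
Proof.
have ma : measurable_fun setT (fun za : 'cV[C]_M * sample => za.2) by exact: measurable_snd.
have ma1 := measurableT_comp measurable_fst ma.
have ma11 := measurableT_comp measurable_fst ma1.
apply: measurable_complex_sum => m; apply: measurable_complexM.
  apply: measurable_conj; apply: (measurableT_comp (measurable_entry m 0)).
  apply: (measurableT_comp (measurable_funPT (combiner U k))).
  exact: (measurableT_comp measurable_snd ma11).
apply: measurable_complexM; last first.
  exact: (measurableT_comp (measurable_entry m 0) measurable_fst).
apply: measurable_real_complex; apply: measurable_funM; first exact: measurable_cst.
apply: (measurableT_comp (continuous_measurable_fun (@sqrt_continuous R))).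
apply: measurable_sum => i; apply: measurable_funM; first exact: measurable_cst.
apply: measurable_normc_sqr; apply: (measurableT_comp (measurable_entry m i)).
exact: (measurableT_comp measurable_fst ma11).
Qed.

Let dist_of_odd z a : dist_of (- z, a) = - dist_of (z, a).
Proof.
by rewrite /dist_of -sumrN; apply: eq_bigr => m _; rewrite !mxE !mulrN.
Qed.

Let DE w : D w = dist_of (r w, sample_data U W S b t w).
Proof.
rewrite /D /distES /= (additive w) mul_diag_mx mxE /dist_of; apply: eq_bigr => m _.
rewrite !mxE; congr (_ * _).
rewrite (bigD1 m)//= [X in _ + X]big1; last first.
  by move=> m' /negbTE mm'; rewrite !mxE eq_sym mm' mulr0n mulr0 mul0r.
rewrite addr0 !mxE eqxx mulr1n; congr (_%:C * _); congr (_ * Num.sqrt _).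
by rewrite summxE; apply: eq_bigr => i _; rewrite !mxE eqxx mulr1n.
Qed.

Let triple (e : E) := (chan U e, pilot_noise U e, pilot_dist U e).

(** The combiner is recomputed from the channels and the pilot-phase noise and distortion, of which
    the data-phase noise is independent; changing the sign of the noise then leaves the combiner
    unchanged. *)
Let noise_of (nz : 'cV[C]_M * ('M[C]_(M, K) * 'M[C]_(M, taup) * 'M[C]_(M, taup))) : C :=
  ((combiner U k (\sum_(i < K) col i nz.2.1.1 *m pilot U i + nz.2.1.2 + nz.2.2)) ^t*
     *m nz.1) 0 0.

Let mnoise_of : measurable_fun setT noise_of.
Proof.
have m2 : measurable_fun setT (fun nz : 'cV[C]_M *
  ('M[C]_(M, K) * 'M[C]_(M, taup) * 'M[C]_(M, taup)) => nz.2) by exact: measurable_snd.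
have m21 := measurableT_comp measurable_fst m2.
apply: (measurableT_comp (measurable_entry 0 0)); apply: measurable_mulmx.
  apply: measurable_adjmx; apply: (measurableT_comp (measurable_funPT (combiner U k))).
  apply: measurable_addmx; last exact: (measurableT_comp measurable_snd m2).
  apply: measurable_addmx; last exact: (measurableT_comp measurable_snd m21).
  apply: measurable_summx => i; apply: measurable_mulmx; last exact: measurable_cst.
  by apply: measurable_col; exact: (measurableT_comp measurable_fst m21).
exact: measurable_fst.
Qed.

Let cexp_N : cexp P N = 0.
Proof.
apply: eq_opp_complex; rewrite -cexpN; last exact: L2_cintegrable.
have mn : measurable_fun setT (fun w => noise_at U t (W b w)).
  exact: (measurableT_comp (measurable_noise_at U t) mWb).
have mt : measurable_fun setT (fun w => triple (W b w)).
  apply: (measurableT_comp _ mWb); apply: measurable_fun_pair; last exact: measurable_funPT.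
  by apply: measurable_fun_pair; exact: measurable_funPT.
have ind : indep2 P (fun w => noise_at U t (W b w)) (fun w => triple (W b w)).
  apply: (indep2_comp (f := col t) (g := id) _ _ (noise_indep model b)) => //.
  exact: (measurable_col t (@measurable_id _ _ setT)).
have same : same_law P (fun w => (noise_at U t (W b w), triple (W b w)))
    (fun w => (- noise_at U t (W b w), triple (W b w))).
  apply: indep2_same_law => //; first exact: measurable_oppmx.
    apply: (indep2_comp (f := fun z : 'cV[C]_M => - z) (g := id)) => //.
    exact: measurable_oppmx.
  by move=> A mA; rewrite (cnormal_vec_opp (noise_law model b t)).
have m1 : measurable_fun setT (fun w => (noise_at U t (W b w), triple (W b w))).
  exact: measurable_fun_pair.
have m2 : measurable_fun setT (fun w => (- noise_at U t (W b w), triple (W b w))).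
  by apply: measurable_fun_pair => //; exact: measurable_oppmx.
have := same_law_cexp m1 m2 mnoise_of same.
have -> : (fun w => noise_of (noise_at U t (W b w), triple (W b w))) = N by [].
move=> ->; congr cexp; apply/funext => w.
by rewrite /noise_of /= mulmxN mxE.
Qed.

Let inner_odd_even i0 (z g : E * 'M[C]_(K, taud) -> C) :
  measurable_fun setT z -> measurable_fun setT g ->
  (forall e s', z (e, flip i0 s') = - z (e, s')) ->
  (forall e s', g (e, flip i0 s') = g (e, s')) ->
  L2 P (fun w => z (W b w, S b w)) -> L2 P (fun w => g (W b w, S b w)) ->
  inner P (fun w => z (W b w, S b w)) (fun w => g (W b w, S b w)) = 0.
Proof.
move=> mz mg z_odd g_even z2 g2.
apply: (cexp_odd_symbol (i0 := i0) (f := fun es => z es * (g es)^*%R)).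
- by apply: measurable_complexM => //; exact: measurable_conj.
- by move=> e s'; rewrite z_odd g_even mulNr.
- exact: L2_cintegrableM.
Qed.

Let symE i (es : E * 'M[C]_(K, taud)) : C := es.2 i t.
Let sxE i (es : E * 'M[C]_(K, taud)) : C := es.2 i t * xE i es.1.

Let m_symE i : measurable_fun setT (symE i).
Proof. exact: (measurableT_comp (measurable_entry i t) measurable_snd). Qed.

Let m_sxE i : measurable_fun setT (sxE i).
Proof.
apply: measurable_complexM; first exact: m_symE.
exact: (measurableT_comp (m_xE i) measurable_fst).
Qed.

Let sxE_odd i e s' : sxE i (e, flip i s') = - sxE i (e, s').
Proof. by rewrite /sxE /= mxE eqxx mulNr. Qed.

Let inner_sx_sx i j : i != j -> inner P (sx i) (sx j) = 0.
Proof.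
move=> /negbTE ij.
apply: (inner_odd_even (m_sxE i) (m_sxE j) (@sxE_odd i) _ (sx2 i) (sx2 j)).
by move=> e s'; rewrite /sxE /= mxE eq_sym ij.
Qed.

Let inner_sx_s i j : i != j -> inner P (sx i) (s j) = 0.
Proof.
move=> /negbTE ij.
apply: (inner_odd_even (m_sxE i) (m_symE j) (@sxE_odd i) _ (sx2 i) (s2 j)).
by move=> e s'; rewrite /symE /= mxE eq_sym ij.
Qed.

Let m_noise : measurable_fun setT (fun es : E * 'M[C]_(K, taud) => noiseE es.1).
Proof. exact: (measurableT_comp mnoiseE measurable_fst). Qed.

Let inner_sx_N i : inner P (sx i) N = 0.
Proof.
by apply: (inner_odd_even (m_sxE i) m_noise (@sxE_odd i) _ (sx2 i) N2).
Qed.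

Let inner_s_N i : inner P (s i) N = 0.
Proof.
apply: (inner_odd_even (i0 := i) (m_symE i) m_noise _ _ (s2 i) N2) => // e s'.
by rewrite /symE /= mxE eqxx.
Qed.

Let cexp_sx i : cexp P (sx i) = 0.
Proof. exact: (cexp_odd_symbol (m_sxE i) (@sxE_odd i) (L2_cintegrable (sx2 i))). Qed.

(** Here s_k meets its own conjugate: |s_k|^2 is an independent weight of mean one and drops out. *)
Let inner_sx_sk : inner P (sx k) (s k) = cexp P (x k).
Proof.
pose g (s' : 'M[C]_(K, taud)) := Normc.normc (s' k t) ^+ 2.
have mg : measurable_fun setT g by apply: measurable_normc_sqr; exact: measurable_entry.
have g1 : (\int[P]_w (g (S b w))%:E = 1)%E.
  exact: (std_cnormal_moment2 (ms k) (symbols_law model b k t)).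
have := cexp_indep_weight mWb mSb WS_indep (m_xE k) mg (L2_cintegrable (x2 k))
  (fun s' => sqr_ge0 _) g1.
move=> <-; congr cexp; apply/funext => w.
by rewrite /sx /g normc_sqrE -/(s k w) -/(x k w) mulrA [x k w * _]mulrC.
Qed.

(** As a function of the block, the distortion is not known to be even in the symbols, so the sign
    changed here is that of [r]. One statement then covers symbols, signals, noise and constants. *)
Let inner_D (g : sample -> C) : measurable_fun setT g ->
  L2 P (fun w => g (sample_data U W S b t w)) ->
  inner P D (fun w => g (sample_data U W S b t w)) = 0.
Proof.
move=> mg g2; have DD : D = (fun w => dist_of (r w, sample_data U W S b t w)).
  by apply/funext => w; exact: DE.
rewrite /inner DD.
apply: (cexp_odd_distortion (f := fun za => dist_of za * (g za.2)^*%R)).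
- apply: measurable_complexM; first exact: mdist_of.
  by apply: measurable_conj; exact: (measurableT_comp mg measurable_snd).
- by move=> z a; rewrite dist_of_odd mulNr.
- by move: (L2_cintegrableM D2 g2); rewrite DD.
Qed.

Let m_weight : measurable_fun setT (fun a : sample => (combiner U k a.1.1.2) ^t*).
Proof.
have m1 : measurable_fun setT (fun a : sample => a.1) by exact: measurable_fst.
apply: measurable_adjmx; apply: (measurableT_comp (measurable_funPT (combiner U k))).
exact: (measurableT_comp measurable_snd (measurableT_comp measurable_fst m1)).
Qed.

Let inner_D_s i : inner P D (s i) = 0.
Proof.
have -> : s i = (fun w => (sample_data U W S b t w).2 i 0).
  by apply/funext => w; rewrite /sample_data /= mxE.
apply: (inner_D (g := fun a => a.2 i 0)).
  exact: (measurableT_comp (measurable_entry i 0) measurable_snd).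
by under eq_fun do rewrite /sample_data /= mxE; exact: s2.
Qed.

Let inner_D_sx i : inner P D (sx i) = 0.
Proof.
pose g (a : sample) : C := a.2 i 0 *
  ((combiner U k a.1.1.2) ^t* *m col i a.1.1.1) 0 0.
have m1 : measurable_fun setT (fun a : sample => a.1) by exact: measurable_fst.
have sxg : sx i = (fun w => g (sample_data U W S b t w)).
  by apply/funext => w; rewrite /sx /g /sample_data /= [col t _ _ _]mxE.
rewrite sxg; apply: inner_D; last by rewrite -sxg.
apply: measurable_complexM.
  exact: (measurableT_comp (measurable_entry i 0) measurable_snd).
apply: (measurableT_comp (measurable_entry 0 0)); apply: measurable_mulmx => //.
apply: measurable_col.
exact: (measurableT_comp measurable_fst (measurableT_comp measurable_fst m1)).
Qed.

Let inner_D_N : inner P D N = 0.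
Proof.
have m1 : measurable_fun setT (fun a : sample => a.1) by exact: measurable_fst.
pose g (a : sample) : C := ((combiner U k a.1.1.2) ^t* *m a.1.2) 0 0.
have mg : measurable_fun setT g.
  apply: (measurableT_comp (measurable_entry 0 0)); apply: measurable_mulmx.
    exact: m_weight.
  exact: (measurableT_comp measurable_snd m1).
exact: (inner_D mg N2).
Qed.

Let cexp_D : cexp P D = 0.
Proof. by rewrite -inner_cst1//; apply: (inner_D (g := fun=> 1)) => //; exact: L2_cst. Qed.

Let amp i : C := (Num.sqrt (rho U i))%:C.

Let signal w : C := \sum_(i < K) amp i * sx i w.
Let residual w : C := N w + D w.

Let shat_rvE : shat_rv U W S k b t = (fun w => signal w + residual w).
Proof.
apply/funext => w; rewrite /shat_rv shatE /sample_shat /= !mulmxDr.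
rewrite mxE [X in X + _ = _]mxE -addrA; congr (_ + _).
rewrite mulmx_sumr summxE; apply: eq_bigr => i _.
by rewrite -scalemxAr mxE [col t _ _ _]mxE -mulrA.
Qed.

Let amp_sx2 i : L2 P (fun w => amp i * sx i w). Proof. exact: L2Z. Qed.
Let signal2 : L2 P signal. Proof. exact: L2_sum. Qed.
Let residual2 : L2 P residual. Proof. exact: L2D. Qed.

Let inner_suml (F : 'I_K -> T -> C) (Y : T -> C) : (forall i, L2 P (F i)) -> L2 P Y ->
  inner P (fun w => \sum_(i < K) F i w) Y = \sum_(i < K) inner P (F i) Y.
Proof.
move=> F2 Y2; rewrite /inner -cexp_sum; last by move=> i; exact: L2_cintegrableM.
by congr cexp; apply/funext => w; rewrite mulr_suml.
Qed.

Let inner_signal (Y : T -> C) : L2 P Y ->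
  inner P signal Y = \sum_(i < K) amp i * inner P (sx i) Y.
Proof.
by move=> Y2; rewrite inner_suml//; apply: eq_bigr => i _; rewrite innerZl.
Qed.

Let corrE : corr U W S k b t = amp k * cexp P (x k).
Proof.
rewrite -[LHS]/(inner P (shat_rv U W S k b t) (s k)) shat_rvE innerDl//.
rewrite inner_signal// (innerDl N2 D2 (s2 k)) inner_D_s (inner_conj (s2 k) N2) inner_s_N conjC0 !addr0.
by rewrite (bigD1 k)//= inner_sx_sk big1 ?addr0// => i ik; rewrite inner_sx_s ?mulr0.
Qed.

Let normc_amp i : Normc.normc (amp i) ^+ 2 = rho U i.
Proof. by rewrite normc_sqr /= expr0n addr0 sqr_sqrtr// (rho_ge0 model). Qed.

Let inner_signal_residual : inner P signal residual = 0.
Proof.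
rewrite inner_signal//; apply: big1 => i _; rewrite innerDr// inner_sx_N.
by rewrite (inner_conj D2 (sx2 i)) inner_D_sx conjC0 addr0 mulr0.
Qed.

Let inner_signal_signal :
  inner P signal signal = (\sum_(i < K) fine (moment2 P (x i)) * rho U i)%:C.
Proof.
rewrite inner_signal// rmorph_sum/=; apply: eq_bigr => i _.
rewrite (inner_conj signal2 (sx2 i)) inner_signal// (bigD1 i)//= big1 => [|j ji]; last first.
  by rewrite inner_sx_sx// mulr0.
rewrite addr0 inner_self// sx_moment2 -normc_amp.
by apply: complex_eqP; rewrite /= !(mulr0, mul0r, subr0, addr0, expr0n, oppr0)//= sqrtr_sqr
   -normrX ger0_norm ?sqr_ge0//; ring.
Qed.

Let inner_residual_residual :
  inner P residual residual = (fine (moment2 P N) + fine (moment2 P D))%:C.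
Proof.
rewrite (innerDl N2 D2 residual2) (innerDr N2 D2 N2) (innerDr N2 D2 D2).
rewrite inner_D_N (inner_conj D2 N2) inner_D_N conjC0 (inner_self N2) (inner_self D2).
by rewrite addr0 add0r; apply: complex_eqP => //=; rewrite addr0.
Qed.

Let cexp_shat : cexp P (shat_rv U W S k b t) = 0.
Proof.
rewrite shat_rvE cexpD; [|exact: L2_cintegrable..].
rewrite cexp_sum => [|i]; last exact: L2_cintegrable.
rewrite big1 ?add0r => [|i _]; last first.
  by rewrite cexpZ ?cexp_sx ?mulr0//; exact: L2_cintegrable.
by rewrite cexpD ?cexp_N ?cexp_D ?addr0//; exact: L2_cintegrable.
Qed.

Let shat2 : L2 P (shat_rv U W S k b t).
Proof. by rewrite shat_rvE; exact: L2D. Qed.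

(** The error has mean zero, so its variance is its second moment, and a s_k is the orthogonal
    projection of shat on s_k: E|shat - a s_k|^2 = E|shat|^2 - |a|^2. *)
Lemma err_var_additive : err_var U W S k b t =
  \sum_(i < K) fine (moment2 P (x i)) * rho U i
  - Normc.normc (cexp P (x k)) ^+ 2 * rho U k
  + fine (moment2 P N) + fine (moment2 P D).
Proof.
set a := corr U W S k b t.
have as2 : L2 P (fun w => a * s k w) by exact: L2Z.
have err2 : L2 P (fun w => shat_rv U W S k b t w - a * s k w) by exact: L2B.
have inner_Ys : inner P (shat_rv U W S k b t) (s k) = a by [].
have err0 : cexp P (fun w => shat_rv U W S k b t w - a * s k w) = 0.
  rewrite cexpB ?cexp_shat; [|exact: L2_cintegrable..].
  rewrite cexpZ; last exact: L2_cintegrable.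
  by rewrite (std_cnormal_mean (ms k) (symbols_law model b k t)) mulr0 subr0.
suff self : (err_var U W S k b t)%:C = (\sum_(i < K) fine (moment2 P (x i)) * rho U i
  - Normc.normc (cexp P (x k)) ^+ 2 * rho U k
  + fine (moment2 P N) + fine (moment2 P D))%:C by exact: (congr1 (@complex.Re R) self).
have -> : err_var U W S k b t =
    fine (moment2 P (fun w => shat_rv U W S k b t w - a * s k w)).
  rewrite /err_var /cvar err0; congr (fine (moment2 P _)).
  by apply/funext => w; rewrite subr0.
have inner_YY : inner P (shat_rv U W S k b t) (shat_rv U W S k b t) =
    (\sum_(i < K) fine (moment2 P (x i)) * rho U i)%:C
    + (fine (moment2 P N) + fine (moment2 P D))%:C.
  rewrite shat_rvE (innerDl signal2 residual2 (L2D signal2 residual2)).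
  rewrite (innerDr signal2 residual2 signal2) (innerDr signal2 residual2 residual2).
  rewrite (inner_conj signal2 residual2) inner_signal_residual conjC0 addr0 add0r.
  by rewrite inner_signal_signal inner_residual_residual.
have inner_ss : inner P (s k) (s k) = 1.
  exact: (inner_std_cnormal (ms k) (symbols_law model b k t)).
rewrite -(inner_self err2) (innerBl shat2 as2 err2) (innerBr shat2 as2 shat2).
rewrite (innerBr shat2 as2 as2) (innerZr a shat2 (s2 k)) (innerZl a (s2 k) shat2).
rewrite (innerZl a (s2 k) as2) (innerZr a (s2 k) (s2 k)) inner_ss.
rewrite (inner_conj shat2 (s2 k)) inner_Ys inner_YY.
(* Here q is E|shat|^2 and z is [corr]: the cross terms and E|a s_k|^2 all equal |z|^2. *)
have -> (q z : C) : q - z^*%R * z - (z * z^*%R - z * (z^*%R * 1)) = q - z * z^*%R by ring.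
rewrite -normc_sqrE /a corrE normc_sqrM normc_amp.
have gen (q n' d' c p : R) :
    q%:C + (n' + d')%:C - (p * c)%:C = (q - c * p + n' + d')%:C.
  by apply: complex_eqP => /=; ring.
exact: gen.
Qed.

Lemma SINR_additive : SINR U W S k b t =
  Normc.normc (cexp P (x k)) ^+ 2 * rho U k /
  (\sum_(i < K) fine (moment2 P (x i)) * rho U i
   - Normc.normc (cexp P (x k)) ^+ 2 * rho U k
   + fine (moment2 P N) + fine (moment2 P D)).
Proof. by rewrite /SINR err_var_additive corrE normc_sqrM normc_amp [rho U k * _]mulrC. Qed.

End additive_distortion.

Theorem theorem2 (R : realType) (M K tauc taup : nat)
    (dE : measure_display) (E : measurableType dE)
    (U : uplink R M K tauc taup E)
    (d : measure_display) (T : measurableType d) (P : probability T R)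
    (W : nat -> {RV P >-> E})
    (S : nat -> {RV P >-> 'M[R[i]]_(K, tauc - taup)})
    (Rcov : 'I_K -> 'M[R[i]]_M) (sigma2 : R)
    (model : uplink_model U W S Rcov sigma2)
    (k : 'I_K) (b : nat) (t : 'I_(tauc - taup))
    (shat_moment2 : (moment2 P (shat_rv U W S k b t) < +oo)%E)
    (err_var_neq0 : err_var U W S k b t != 0) :
  [/\ achievable P (combined_obs U W S k) (SE U W S k b t),
      ((SE U W S k b t)%:E <= ergodic_capacity U W S k)%E
    & forall (epsilon : 'I_M -> R) (r : {RV P >-> 'cV[R[i]]_M}),
      let vH w := (v U k (W b w)) ^t* in
      let vh i w := (vH w *m h U i (W b w)) 0 0 in
      let vn w := (vH w *m noise_at U t (W b w)) 0 0 in
      let ve w := (vH w *m dist_at U t (W b w) (S b w)) 0 0 in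
      (forall m, 0 <= epsilon m) ->
      cnormal_vec P r 1%:M ->
      indep2 P r (sample_data U W S b t) ->
      additive_dist U W S b t epsilon r ->
      (forall i, moment2 P (vh i) < +oo)%E ->
      (moment2 P vn < +oo)%E ->
      (moment2 P ve < +oo)%E ->
      SINR U W S k b t =
        (Normc.normc (cexp P (vh k))) ^+ 2 * rho U k /
        (\sum_(i < K) fine (moment2 P (vh i)) * rho U i
         - (Normc.normc (cexp P (vh k))) ^+ 2 * rho U k
         + fine (moment2 P vn) + fine (moment2 P ve))].
Proof.
split.
- exact: (achievable_combined model shat_moment2 err_var_neq0).
- exact: (SE_le_ergodic_capacity model shat_moment2 err_var_neq0).
- move=> epsilon r vH vh vn ve _ r_law r_indep additive vh2 vn2 ve2.
  exact: (SINR_additive model r_law r_indep additive vh2 vn2 ve2).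
Qed.
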